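(* Let $a<a'\le b'<b$ and let $\psi_1\colon[a,a']\to\mathbb R$, $\psi_2\colon[b',b]\to\mathbb R$ be bounded measurable functions, positive almost everywhere, such that $\int_a^{a'}\psi_1(t)\,dt=\int_{b'}^b\psi_2(t)\,dt$. Let $\omega$ be a modulus of continuity, $c=(a'+b')/2$, and let $\rho\colon[a,c]\to[c,b]$ be defined by $$\int_a^s\psi_1(t)\,dt=\int_{\rho(s)}^b\psi_2(t)\,dt\ \text{ if } s\in[a,a'],\qquad \rho(s)=a'+b'-s\ \text{ if } s\in[a',c].$$ Let $X$ be an $L$-space and $$S(\psi_1,\psi_2)=\sup_{f\in H^\omega([a,b],X)}h_X\left(\int_a^{a'}f(t)\psi_1(t)\,dt,\int_{b'}^bf(t)\psi_2(t)\,dt\right).$$ Then $$S(\psi_1,\psi_2)\le\int_a^{a'}\psi_1(s)\,\omega(\rho(s)-s)\,ds=\int_{b'}^{b}\psi_2(t)\,\omega(t-\rho^{-1}(t))\,dt .$$ If $\omega$ is a concave modulus of continuity and $X$ is isotropic, then the inequality turns into equality. In this case the supremum is attained on the functions $(\pm g+\alpha)_x(\cdot)+y\in H^\omega([a,b],X)$, where $\alpha\in\mathbb R$, $y\in X$, $x\in X^{\rm c}\cap X^{\rm inv}$, $h_X(x,\theta)=1$, and $$g(t)=\begin{cases}-\int_t^c\omega'(\rho(s)-s)\,ds,& a\le t\le c,\\ \int_c^t\omega'(s-\rho^{-1}(s))\,ds,& c\le t\le b.\end{cases}$$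
   Context: A modulus of continuity is a non-decreasing continuous semi-additive function $\omega\colon[0,\infty)\to[0,\infty)$ (i.e. $\omega(s+t)\le\omega(s)+\omega(t)$) with $\omega(0)=0$. A semilinear space is a set $X$ with addition and multiplication by real numbers such that for all $x,y,z\in X$, $\alpha,\beta\in\mathbb R$: $x+y=y+x$; $x+(y+z)=(x+y)+z$; there is $\theta\in X$ with $x+\theta=x$ for all $x$; $\alpha(x+y)=\alpha x+\alpha y$; $\alpha(\beta x)=(\alpha\beta)x$; $1\cdot x=x$, $0\cdot x=\theta$. An $L$-space is a semilinear space $X$ with a complete separable metric $h_X$ such that $h_X(\alpha x,\alpha y)=|\alpha|h_X(x,y)$ and $h_X(x+z,y+z)\le h_X(x,y)$; it is isotropic if the last inequality is always an equality. An element $x$ is convex if $(\alpha+\beta)x=\alpha x+\beta x$ for all $\alpha,\beta\ge0$; $X^{\rm c}$ is the set of convex elements. An element $x$ is invertible if there is $x'\in X$ with $x+x'=\theta$ (then $x'$ is unique); $X^{\rm inv}$ is the set of invertible elements. Standing assumption: $X^{\rm inv}\cap X^{\rm c}\ne\{\theta\}$. $X$ is equipped with a fixed convexifying operator $P$: a surjection $P\colon X\to X^{\rm c}$ with $h_X(P(x),P(y))\le h_X(x,y)$, $P\circ P=P$, $P(\alpha x+\beta y)=\alpha P(x)+\beta P(y)$ for all $x,y\in X$, $\alpha,\beta\in\mathbb R$. Integral: for a simple mapping $f$ taking values $f_1,\dots,f_n$ on pairwise disjoint measurable sets $T_1,\dots,T_n$, $\int_a^bf(s)\,ds:=\sum_iP(f_i)\mu(T_i)$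 ($\mu$ the Lebesgue measure); for a uniform limit $f$ of simple mappings $f^k$ (in particular for a continuous $X$-valued function multiplied by a bounded measurable real function), $\int_a^bf:=\lim_k\int_a^bf^k$. $H^\omega([a,b],X)$ is the class of $f\colon[a,b]\to X$ with $h_X(f(t'),f(t''))\le\omega(|t'-t''|)$ for all $t',t''\in[a,b]$. For $f\colon[a,b]\to\mathbb R$ and $x\in X^{\rm inv}$, $f_x(t):=f_+(t)\cdot x+f_-(t)\cdot x'$, where $\xi_\pm=\max\{\pm\xi,0\}$. *)

(* Defs.v *)
From HB Require Import structures.
From mathcomp Require Import all_boot all_order all_algebra.
From mathcomp Require Import all_classical all_reals all_analysis.

Set Implicit Arguments.
Unset Strict Implicit.
Unset Printing Implicit Defensive.

Import Order.TTheory GRing.Theory Num.Theory.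
Import numFieldNormedType.Exports.

Local Open Scope classical_set_scope.
Local Open Scope ring_scope.

(* Not an [lSemiModType]: (a + b) x = a x + b x is not required; the elements
   satisfying it for a, b >= 0 are the convex ones. *)
HB.mixin Record isLSpace (R : realType) X & Metric R X & Complete X := {
  theta : X;
  ladd : X -> X -> X;
  lscale : R -> X -> X;
  laddC : forall x y, ladd x y = ladd y x;
  laddA : forall x y z, ladd x (ladd y z) = ladd (ladd x y) z;
  ladd0 : forall x, ladd x theta = x;
  lscaleDr : forall a x y, lscale a (ladd x y) = ladd (lscale a x) (lscale a y);
  lscaleA : forall a b x, lscale a (lscale b x) = lscale (a * b) x;
  lscale1 : forall x, lscale 1 x = x;
  lscale0 : forall x, lscale 0 x = theta;
  lspace_separable : exists2 D : set X, countable D & dense D;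
  mdist_lscale : forall a x y,
    mdist (lscale a x) (lscale a y) = `|a| * mdist x y :> R;
  mdist_ladd : forall x y z,
    mdist (ladd x z) (ladd y z) <= mdist x y :> R
}.

#[short(type="lspaceType")]
HB.structure Definition LSpace (R : realType) :=
  {X of isLSpace R X & Metric R X & Complete X}.

Section LSpaceTheory.
Context {R : realType} (X : lspaceType R).

Fact ladd0l : left_id (@theta R X) ladd.
Proof. by move=> x; rewrite laddC ladd0. Qed.

HB.instance Definition _ :=
  Monoid.isComLaw.Build X theta ladd laddA laddC ladd0l.

Definition isotropic : Prop :=
  forall x y z : X, mdist (ladd x z) (ladd y z) = mdist x y :> R.

Definition convex_elt : set X :=
  [set x | forall a b : R, 0 <= a -> 0 <= b ->
     lscale (a + b) x = ladd (lscale a x) (lscale b x)].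

Definition inv_elt : set X := [set x | exists y : X, ladd x y = theta].

Definition convexifying (P : X -> X) : Prop :=
  [/\ range P = convex_elt,
      forall x y : X, mdist (P x) (P y) <= mdist x y :> R,
      P \o P = P &
      forall (a b : R) (x y : X),
        P (ladd (lscale a x) (lscale b y)) = ladd (lscale a (P x)) (lscale b (P y))].

End LSpaceTheory.
Arguments isotropic {R} X.
Arguments convex_elt {R} X.
Arguments inv_elt {R} X.

(* The element x' of an invertible x (unique); theta if x is not invertible. *)
Definition linv {R : realType} {X : lspaceType R} (x : X) : X :=
  xget theta [set y : X | ladd x y = theta].

Definition lift_at {R : realType} {X : lspaceType R}
    (f : R -> R) (x : X) (t : R) : X :=
  ladd (lscale (f^\+ t) x) (lscale (f^\- t) (linv x)).

(* R with the sigma-algebra of all Lebesgue measurable sets, not only the Borel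
   ones *)
Notation lebesgue_type R := (caratheodory_type (@wlength R idfun)^*%mu).
Notation leb R := (@completed_lebesgue_measure R).

Section Integral.
Context {R : realType} {X : lspaceType R}.
Implicit Types (P : X -> X) (A : set R) (f : R -> X).

(* f is simple on A, and I is its integral *)
Definition is_simple_integral P A f (I : X) : Prop :=
  exists (n : nat) (v : 'I_n -> X) (T : 'I_n -> set R),
    [/\ forall i, measurable (T i : set (lebesgue_type R)),
        trivIset [set: 'I_n] T,
        \bigcup_i T i = A,
        forall i t, T i t -> f t = v i &
        I = \big[ladd/theta]_(i < n) lscale (fine (leb R (T i))) (P (v i))].

Definition is_integral P A f (I : X) : Prop :=
  exists (F : nat -> R -> X) (J : nat -> X),
    [/\ forall k, is_simple_integral P A (F k) (J k),
        {uniform A, F @ \oo --> f} &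
        J k @[k --> \oo] --> I].

(* The integral depends on f through P \o f only, and it is P \o f that is asked
   to be a uniform limit of simple mappings; [is_integral_conv] shows that this
   extends the integral of uniform limits f of simple mappings.  The extension
   makes psi *: f integrable for f continuous and psi bounded measurable: the
   axioms do not make a |-> a x continuous, or even measurable, for a non-convex
   x. *)
Definition integral P A f : X := xget theta (is_integral P A (P \o f)).

Lemma is_integral_conv P A f (I : X) :
  convexifying P -> is_integral P A f I -> is_integral P A (P \o f) I.
Proof.
move=> [_ Plip PP _] [F [J [simF FfA JI]]].
have PPx x : P (P x) = P x by rewrite -[LHS]/((P \o P) x) PP.
exists (fun k => P \o F k), J; split=> //.
- move=> k; have [n [v [T [mT tT UT Tv ->]]]] := simF k.
  exists n, (P \o v), T; split=> //; first by move=> i t /Tv /= ->.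
  by apply: eq_bigr => i _; rewrite /= PPx.
- move=> /= U /uniform_nbhs[E [/= entE EU]].
  move: entE; rewrite -entourage_ballE => -[e /= e0 eE].
  have : nbhs (f : {uniform` A -> X})
      [set h | forall y, A y -> ball (f y) e (h y)].
    apply/uniform_nbhs; exists [set xy : X * X | ball xy.1 e xy.2]; split=> //.
    by rewrite -entourage_ballE; exists e.
  move=> /FfA; rewrite !nbhs_filterE; apply: (@filterS _ \oo) => k /= Fk.
  apply: EU => y Ay /=; apply: eE => /=; move: (Fk y Ay).
  by rewrite !ballEmdist /=; exact: le_lt_trans.
Qed.

End Integral.

Section Setting.
Context {R : realType}.
Implicit Types (omega psi : R -> R) (A : set R).

Definition modulus_of_continuity omega : Prop :=
  [/\ {in `[0, +oo[ &, {homo omega : s t / s <= t}},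
      {within `[0, +oo[, continuous omega},
      forall s t, 0 <= s -> 0 <= t -> omega (s + t) <= omega s + omega t,
      forall t, 0 <= t -> 0 <= omega t &
      omega 0 = 0].

Definition concave_modulus omega : Prop :=
  modulus_of_continuity omega /\
  forall s t l, 0 <= s -> 0 <= t -> 0 <= l <= 1 ->
    l * omega s + (1 - l) * omega t <= omega (l * s + (1 - l) * t).

Definition weight A psi : Prop :=
  [/\ measurable_fun (A : set (lebesgue_type R)) psi,
      [bounded psi t | t in A] &
      {ae leb R, forall t, A t -> 0 < psi t}].

Definition Hclass {X : lspaceType R} omega (a b : R) : set (R -> X) :=
  [set f | forall t1 t2, t1 \in `[a, b] -> t2 \in `[a, b] ->
     mdist (f t1) (f t2) <= omega `|t1 - t2|].

Section Rho.
Variables (a a' b' b : R) (psi1 psi2 : R -> R).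

(* On [a, a'] the point rho s is sought in [b', b], where psi2 is given. *)
Definition rho (s : R) : R :=
  if s <= a' then
    xget b [set r | r \in `[b', b] /\
      (\int[leb R]_(t in `[a, s]) (psi1 t)%:E =
       \int[leb R]_(t in `[r, b]) (psi2 t)%:E)%E]
  else a' + b' - s.

Definition rho_inv : R -> R :=
  'pinv_(fun=> a) `[a, (a' + b') / 2] rho.

(* [derive1 omega] carries no information where a concave omega is not
   differentiable; these are at most countably many points, and the arguments
   below are strictly monotone in s. *)
Definition extremal omega (t : R) : R :=
  let c := (a' + b') / 2 in
  if t <= c then - \int[leb R]_(s in `[t, c]) (derive1 omega (rho s - s))
  else \int[leb R]_(s in `[c, t]) (derive1 omega (s - rho_inv s)).

Definition deviation {X : lspaceType R} (P : X -> X) (f : R -> X) : R :=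
  mdist (integral P `[a, a'] (fun t => lscale (psi1 t) (f t)))
        (integral P `[b', b] (fun t => lscale (psi2 t) (f t))).

Definition sup_deviation {X : lspaceType R} (P : X -> X) omega : \bar R :=
  ereal_sup [set (deviation P f)%:E | f in Hclass omega a b].

End Rho.
End Setting.

(* Main.v *)
(* Mass transport: rho carries the measure psi1 dt on [a, a'] to psi2 dt on
   [b', b], so that the two integrals of f differ by at most the integral of
   psi1 (s) h (f s, f (rho s)) <= psi1 (s) omega (rho s - s).  Every identity or
   inequality of this kind is proved without a change of variables, by comparing
   the increments of both sides on small intervals ]s, t] and [rho t, rho s[
   (local_to_global).

   For a concave omega with supergradient p, the slope of omega at u lies below
   p at every smaller point; since rho s - s shrinks as s grows to c, this gives
   |g s - g t| <= omega |s - t| and, by a second difference estimate,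
   g (rho s) - g s = omega (rho s - s).  In the isotropic case t |-> t_x is an
   isometry of the real line into X, so the lift of g attains the bound. *)
Require Import Defs.
From HB Require Import structures.
From mathcomp Require Import all_boot all_order all_algebra.
From mathcomp Require Import all_classical all_reals all_analysis.
From mathcomp Require Import measurable_realfun lra ring.
Import Order.TTheory GRing.Theory Num.Theory.
Import numFieldNormedType.Exports.
Local Open Scope classical_set_scope.
Local Open Scope ring_scope.

Set Implicit Arguments.
Unset Strict Implicit.

(** * L-spaces *)

(** In an L-space [(a + b) x] splits only for nonnegative coefficients and convex [x], and no limit
    theorem is at hand for [integral]. The vector integral is therefore used through three facts
    only: existence for maps of [Hclass], additivity over adjacent intervals, and an estimate that
    replaces the map on a short interval by its value at one point. [local_to_global] adds up such
    estimates; its function [m] is chosen each time so that the errors are [e] times the increments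
    of [m]. As [m] may jump, a supergradient composed with [rho s - s] can serve as [m].

    The other obstacle is the slope of a concave [omega], which may be unbounded near 0, that is,
    near [s = c], where [rho s - s] vanishes. Upper estimates of integrals of slopes are hence made
    on truncations, and identities for [g] are first transported along intervals that stay away from
    [c], then extended by continuity. *)

Section LSpaceAlgebra.
Context {R : realType} {X : lspaceType R}.
Implicit Types (x y z w : X) (a b c : R).
Local Notation d x y := (@mdist R X x y).

Lemma lscale_theta a : lscale a (theta : X) = theta.
Proof. by rewrite -(lscale0 (theta : X)) lscaleA mulr0. Qed.

Lemma laddACA x y z w :
  ladd (ladd x y) (ladd z w) = ladd (ladd x z) (ladd y w).
Proof. by rewrite -!laddA (laddA y) (laddC y) -laddA. Qed.

Lemma mdist_ladd2 x y z w :
  d (ladd x z) (ladd y w) <= d x y + d z w.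
Proof.
rewrite (le_trans (metric_triangle _ (ladd y z) _))// lerD ?mdist_ladd//.
by rewrite !(laddC y) mdist_ladd.
Qed.

Lemma mdist_big_ladd (I : Type) (r : seq I) (Q : pred I) (F G : I -> X) :
  d (\big[ladd/theta]_(i <- r | Q i) F i) (\big[ladd/theta]_(i <- r | Q i) G i)
  <= \sum_(i <- r | Q i) d (F i) (G i).
Proof.
elim/big_ind3 : _ => [|x1 x2 u y1 y2 v h1 h2|//]; first by rewrite mdistxx.
by rewrite (le_trans (mdist_ladd2 _ _ _ _))// lerD.
Qed.

Lemma convex_lscale a x : convex_elt X x -> convex_elt X (lscale a x).
Proof.
by move=> cx b c b0 c0; rewrite !lscaleA !(mulrC _ a) -!lscaleA cx// lscaleDr.
Qed.

Lemma convex_ladd x y : convex_elt X x -> convex_elt X y ->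
  convex_elt X (ladd x y).
Proof.
move=> cx cy a b a0 b0; rewrite !lscaleDr cx// cy// !laddA; congr ladd.
by rewrite -!laddA; congr ladd; rewrite laddC.
Qed.

Lemma convex_theta : convex_elt X theta.
Proof. by move=> a b _ _; rewrite !lscale_theta ladd0. Qed.

Lemma convex_big_lscale (I : Type) (r : seq I) (Q : pred I) (c : I -> R) x :
  convex_elt X x -> (forall i, 0 <= c i) ->
  \big[ladd/theta]_(i <- r | Q i) lscale (c i) x =
  lscale (\sum_(i <- r | Q i) c i) x.
Proof.
(* The induction carries the sign of the partial sum along, because convexity splits sums of
   nonnegative coefficients only. *)
move=> cx c0; suff [] : \big[ladd/theta]_(i <- r | Q i) lscale (c i) x =
    lscale (\sum_(i <- r | Q i) c i) x /\ 0 <= \sum_(i <- r | Q i) c i by [].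
apply: (big_rec2 (fun u v => u = lscale v x /\ 0 <= v)) => //=.
  by rewrite lscale0.
by move=> i _ v _ [-> v0]; rewrite -cx// addr_ge0.
Qed.

Lemma mdist_lscale_theta a x : d (lscale a x) theta = `|a| * d x theta.
Proof. by rewrite -{1}(lscale_theta a) mdist_lscale. Qed.

(** For coefficients of the same sign, convexity writes the larger multiple as the smaller one plus
    the multiple by the difference; negative ones are reduced to this case by passing to
    [lscale (-1) x]. For opposite signs the path through [theta] has length [|a| + |b| = |a - b|]
    times the distance of [x] to [theta]. *)
Lemma mdist_lscale2_convex a b x : convex_elt X x ->
  d (lscale a x) (lscale b x) <= `|a - b| * d x theta.
Proof.
have pos y u v : convex_elt X y -> 0 <= v -> v <= u ->
    d (lscale u y) (lscale v y) <= (u - v) * d y theta.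
  move=> cy v0 vu; rewrite -{1}(subrK v u) cy ?subr_ge0//.
  rewrite -[X in d _ X](ladd0l (lscale v y)) (le_trans (mdist_ladd _ _ _))//.
  by rewrite mdist_lscale_theta ger0_norm ?subr_ge0.
move=> cx; wlog ba : a b / b <= a => [hw|].
  by case/orP: (le_total a b) => ?; [rewrite metric_sym distrC|]; exact: hw.
rewrite ger0_norm ?subr_ge0//; have [b0|b0] := leP 0 b; first exact: pos.
have [a0|a0] := leP a 0.
  have -> : lscale a x = lscale (- a) (lscale (-1) x).
    by rewrite lscaleA mulrN1 opprK.
  have -> : lscale b x = lscale (- b) (lscale (-1) x).
    by rewrite lscaleA mulrN1 opprK.
  have := pos (lscale (-1) x) (- b) (- a) (convex_lscale _ cx).
  rewrite lerN2 oppr_ge0 metric_sym => /(_ a0 ba) /le_trans; apply.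
  by rewrite mdist_lscale_theta normrN1 mul1r opprK addrC.
rewrite (le_trans (metric_triangle _ theta _))// (metric_sym theta).
by rewrite !mdist_lscale_theta (gtr0_norm a0) (ltr0_norm b0) -mulrDl.
Qed.

Lemma linvP x : inv_elt X x -> ladd x (linv x) = theta.
Proof.
move=> [y xy]; rewrite /linv.
by case: xgetP => [z _ -> //|/(_ y)].
Qed.

Lemma ladd_inv_uniq x y z : ladd x y = theta -> ladd x z = theta -> y = z.
Proof.
move=> xy xz; rewrite -(ladd0 y) -xz laddA (laddC y) xy.
by rewrite laddC ladd0.
Qed.

(** Both sides of the convexity identity are inverses of [lscale (a + b) x], and inverses are
    unique. *)
Lemma convex_linv x : convex_elt X x -> inv_elt X x -> convex_elt X (linv x).
Proof.
move=> cx ix a b a0 b0; apply: (@ladd_inv_uniq (lscale (a + b) x)).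
  by rewrite -lscaleDr linvP// lscale_theta.
rewrite cx// -laddA [X in ladd _ X](_ : _ = lscale a (linv x)).
  by rewrite -lscaleDr linvP// lscale_theta.
rewrite laddC -laddA [X in ladd _ X]laddC -lscaleDr linvP//.
by rewrite lscale_theta ladd0.
Qed.

Section Convexifying.
Variables (P : X -> X) (hP : convexifying P).

Lemma convexifying_convex x : convex_elt X (P x).
Proof. by case: hP => <- _ _ _; exists x. Qed.

Lemma convexifying_idem x : P (P x) = P x.
Proof. by case: hP => _ _ PP _; rewrite -[LHS]/((P \o P) x) PP. Qed.

Lemma convexifying_id x : convex_elt X x -> P x = x.
Proof. by case: hP => <- _ _ _ [y _ <-]; exact: convexifying_idem. Qed.

Lemma convexifying_lip x y : d (P x) (P y) <= d x y.
Proof. by case: hP. Qed.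

Lemma convexifying_lscale a x : P (lscale a x) = lscale a (P x).
Proof.
case: hP => _ _ _ /(_ a 0 x theta).
by rewrite !lscale0 !ladd0.
Qed.

Lemma convexifying_ladd x y : P (ladd x y) = ladd (P x) (P y).
Proof. by case: hP => _ _ _ /(_ 1 1 x y); rewrite !lscale1. Qed.

Lemma convexifying_theta : P theta = theta.
Proof. exact: (convexifying_id convex_theta). Qed.

End Convexifying.
End LSpaceAlgebra.

(** * Induction along a real interval *)

Section LocalToGlobal.
Context {R : realType}.

Lemma dist_between (s z t v e : R) : s <= z -> z <= t -> s <= v -> v <= t ->
  t - s < e -> `|v - z| < e.
Proof. by move=> *; rewrite ltr_norml; apply/andP; split; lra. Qed.

(* The increments of K - e m are additive, so an interval on which they are
   locally nonpositive has a nonpositive total increment, for every e. *)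
Lemma local_to_global (K m : R -> R) (a b : R) : a <= b ->
  (forall e x, 0 < e -> a <= x <= b -> exists2 d, 0 < d &
     forall s t, a <= s -> s <= x -> x <= t -> t <= b -> t - s < d ->
       K t - K s <= e * (m t - m s)) ->
  K b <= K a.
Proof.
move=> ab loc.
suff H e : 0 < e -> K b - K a <= e * (m b - m a).
  rewrite -subr_le0; apply/ler_addgt0Pr => e e0; rewrite add0r.
  (* Applying the claim to [e / c] makes the total error at most [e]; the summand 1 keeps [c]
     positive when [m b = m a]. *)
  pose c := `|m b - m a| + 1; have c0 : 0 < c by rewrite ltr_wpDl.
  rewrite (le_trans (H (e / c) _)) ?divr_gt0//.
  rewrite -mulrA ler_piMr ?(ltW e0)// mulrC ler_pdivrMr// mul1r.
  by rewrite (le_trans (ler_norm _))// lerDl.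
(* Real induction: [S] holds the points reached from [a] with the desired bound. The local
   hypothesis at [sup S] is used twice, to the left to put [sup S] into [S], and to the right to
   pass beyond it unless it equals [b]. *)
move=> e0; pose E t := K t - K a <= e * (m t - m a).
pose S := [set t | a <= t <= b /\ E t].
have Sa : S a by split; rewrite ?lexx// /E !subrr mulr0.
have hS : has_sup S by split; [exists a|exists b => t [/andP[_ ->]]].
have Sab t : S t -> t <= sup S by move=> St; exact: (sup_upper_bound hS).
have ax : a <= sup S by exact: Sab.
have xb : sup S <= b by apply: ge_sup; [exists a|move=> t [/andP[_ ->]]].
have [|d d0 hd] := loc e (sup S) e0; first by rewrite ax.
have Estep s t : E s -> K t - K s <= e * (m t - m s) -> E t.
  by rewrite /E => Es st; lra.
have Ex : E (sup S).
  have [s Ss xs] := sup_adherent d0 hS.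
  case: (Ss) => /andP[as_ sb] Es; apply: (Estep s) => //.
  by apply: hd => //; [exact: Sab|rewrite ltrBlDr addrC -ltrBlDr].
suff -> : b = sup S by [].
apply/eqP; rewrite eq_le xb andbT leNgt; apply/negP => {}xb.
pose t := Num.min b (sup S + d / 2).
have xt : sup S < t by rewrite lt_min xb ltrDl divr_gt0.
have tb : t <= b by rewrite ge_min lexx.
have : S t.
  split; first by rewrite (le_trans ax (ltW xt)).
  apply: (Estep (sup S)) => //; apply: hd => //; first exact: ltW.
  rewrite ltrBlDl (@le_lt_trans _ _ (sup S + d / 2)) ?ge_min ?lexx ?orbT//.
  by rewrite ltrD2l ltr_pdivrMr// ltr_pMr// ltr1n.
by move/Sab; rewrite leNgt xt.
Qed.

End LocalToGlobal.

(** * Completed Lebesgue measure *)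

Section CompletedLebesgue.
Context {R : realType}.
Local Notation mu := (leb R).
Local Notation LT := (lebesgue_type R).

Lemma leb_measurable_borel (A : set R) :
  measurable (A : set (measurableTypeR R)) -> measurable (A : set LT).
Proof. exact: sub_caratheodory. Qed.

Lemma leb_measurable_itv (i : interval R) : measurable ([set` i] : set LT).
Proof. by apply: leb_measurable_borel; exact: measurable_itv. Qed.

Lemma leb_itv (i : interval R) :
  mu [set` i] = (if i.1 < i.2 then (i.2 : \bar R) - i.1 else 0)%E.
Proof. exact: lebesgue_measure_itv. Qed.

Lemma leb_countable0 (A : set R) : countable A -> mu A = 0%E.
Proof. exact: countable_lebesgue_measure0. Qed.

Lemma leb_measurable_countable (A : set R) : countable A ->
  measurable (A : set LT).
Proof.
move=> cA; apply: completed_lebesgue_measure_is_complete.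
by exists A; split => //; [apply: leb_measurable_borel; exact: countable_measurable
  | exact: leb_countable0].
Qed.

(** The preimage of a ray under a monotone function is an interval, and rays generate the Borel
    sets. *)
Lemma leb_nondecreasing_measurable (i : interval R) (f : R -> R) :
  {in i &, {homo f : x y / x <= y}} ->
  measurable_fun ([set` i] : set LT) f.
Proof.
move=> fi; apply: (measurability (@RGenCInfty.G R)) => [|_ [_ [r ->] <-]].
  exact: RGenCInfty.measurableE.
apply: leb_measurable_borel; apply: is_interval_measurable => s t.
move=> [si rs] [ti _] u /andP[su ut].
have ui : [set` i] u by apply: (interval_is_interval si ti); rewrite su.
split; first exact: ui.
move: rs; rewrite /= !in_itv/= !andbT => /le_trans; apply.
exact: fi.
Qed.

Lemma leb_nonincreasing_measurable (i : interval R) (f : R -> R) :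
  {in i &, {homo f : x y /~ x <= y}} ->
  measurable_fun ([set` i] : set LT) f.
Proof.
move=> fi; rewrite -(opprK f); apply/measurable_funN.
apply: leb_nondecreasing_measurable => x y xi yi xy.
by rewrite lerN2; exact: fi.
Qed.

End CompletedLebesgue.

(** * Bounded measurable real integrands *)

Section BoundedIntegrands.
Context {R : realType}.
Local Notation mu := (leb R).
Local Notation LT := (lebesgue_type R).
Implicit Types (A B : set R) (psi phi : R -> R).

Lemma leb_aeS (Q1 Q2 : R -> Prop) : (forall t, Q1 t -> Q2 t) ->
  {ae mu, forall t, Q1 t} -> {ae mu, forall t, Q2 t}.
Proof.
move=> Q12 [N [mN N0 sN]]; exists N; split => // t nQ2.
by apply: sN => /Q12.
Qed.

(** The four conditions are bundled since they make every integrability obligation automatic. The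
    bound [M] is kept explicit because it enters the error of each cell. *)
Definition bdd_mfun (M : R) A psi : Prop :=
  [/\ measurable (A : set LT), (mu A < +oo)%E,
      measurable_fun (A : set LT) psi & forall t, A t -> `|psi t| <= M].

Lemma bdd_mfun_subset M A B psi : measurable (B : set LT) -> B `<=` A ->
  bdd_mfun M A psi -> bdd_mfun M B psi.
Proof.
move=> mB BA [mA fA mpsi Mpsi]; split => //.
- by rewrite (le_lt_trans _ fA)// le_measure ?inE.
- exact: measurable_funS mpsi.
- by move=> t /BA; exact: Mpsi.
Qed.

Lemma bdd_mfunM M N A psi phi :
  bdd_mfun M A psi -> bdd_mfun N A phi ->
  bdd_mfun (M * N) A (fun t => psi t * phi t).
Proof.
move=> [mA fA mpsi Mpsi] [_ _ mphi Nphi]; split; [exact: mA|exact: fA| |].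
  exact: (measurable_funM mpsi mphi).
by move=> t At; rewrite normrM ler_pM// ?Mpsi ?Nphi.
Qed.

Lemma bdd_mfunD M N A psi phi :
  bdd_mfun M A psi -> bdd_mfun N A phi ->
  bdd_mfun (M + N) A (fun t => psi t + phi t).
Proof.
move=> [mA fA mpsi Mpsi] [_ _ mphi Nphi]; split; [exact: mA|exact: fA| |].
  exact: (measurable_funD mpsi mphi).
by move=> t At; rewrite (le_trans (ler_normD _ _))// lerD ?Mpsi ?Nphi.
Qed.

Lemma bdd_mfun_cst A c : measurable (A : set LT) -> (mu A < +oo)%E ->
  bdd_mfun `|c| A (fun=> c).
Proof. by move=> mA fA; split => //; exact: measurable_cst. Qed.

Lemma bdd_mfun_norm M A psi : bdd_mfun M A psi ->
  bdd_mfun M A (fun t => `|psi t|).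
Proof.
move=> [mA fA mpsi Mpsi]; split; [exact: mA|exact: fA| |].
  exact: (measurableT_comp (@normr_measurable R setT) mpsi).
by move=> t /Mpsi; rewrite normr_id.
Qed.

Lemma bdd_mfun_integrable M A psi : bdd_mfun M A psi ->
  mu.-integrable (A : set LT) (EFin \o psi).
Proof.
move=> [mA fA mpsi Mpsi]; apply: measurable_bounded_integrable => //.
exists M; split; first exact: num_real.
by move=> N MN t At; rewrite /= (le_trans (Mpsi t At))// ltW.
Qed.

Lemma bdd_mfun_EFin M A psi : bdd_mfun M A psi ->
  measurable_fun (A : set LT) (EFin \o psi).
Proof. by move=> /bdd_mfun_integrable; exact: measurable_int. Qed.

Lemma integral_bdd_mfun M A psi : bdd_mfun M A psi ->
  (\int[mu]_(t in A) (psi t)%:E = (\int[mu]_(t in A) psi t)%:E)%E.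
Proof.
move=> h; have [mA _ _ _] := h; rewrite fineK//; apply: integrable_fin_num => //.
exact: bdd_mfun_integrable h.
Qed.

Lemma le_norm_Rintegral M A psi : bdd_mfun M A psi ->
  `|\int[mu]_(t in A) psi t| <= M * fine (mu A).
Proof.
move=> h; have [mA fA mpsi Mpsi] := h.
rewrite (le_trans (le_normr_Rintegral _ (bdd_mfun_integrable h)))//.
rewrite -(Rintegral_cst mu mA) le_Rintegral//.
- exact: (bdd_mfun_integrable (bdd_mfun_norm h)).
- exact: (bdd_mfun_integrable (bdd_mfun_cst M mA fA)).
Qed.

Lemma Rintegral_setU_bdd M A B psi : bdd_mfun M A psi -> bdd_mfun M B psi ->
  [disjoint A & B] -> \int[mu]_(t in A `|` B) psi t =
  \int[mu]_(t in A) psi t + \int[mu]_(t in B) psi t.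
Proof.
move=> [mA fA mpsiA MA] [mB fB mpsiB MB] AB; rewrite Rintegral_setU//.
apply: (@bdd_mfun_integrable M); split.
- exact: measurableU.
- by rewrite (le_lt_trans (measureU2 mu mA mB))// lte_add_pinfty.
- exact/measurable_funU.
- by move=> t [/MA|/MB].
Qed.

(** The real cell estimate: when [phi] oscillates little on a short interval, it may be frozen at
    [c], with an error that is small compared with the length of the interval. *)
Lemma Rintegral_cell M N A psi phi (c e : R) :
  bdd_mfun M A psi -> bdd_mfun N A phi ->
  (forall t, A t -> `|phi t - c| <= e) ->
  `|\int[mu]_(t in A) (psi t * phi t) - c * \int[mu]_(t in A) psi t|
  <= M * e * fine (mu A).
Proof.
move=> hpsi hphi phic; have [mA fA _ _] := hpsi.
have hc : bdd_mfun e A (fun t => phi t - c).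
  by have [] := bdd_mfunD hphi (bdd_mfun_cst (- c) mA fA).
rewrite -RintegralZl//; last exact: bdd_mfun_integrable hpsi.
have hcpsi := bdd_mfunM (bdd_mfun_cst c mA fA) hpsi.
rewrite -RintegralB//; last exact: (bdd_mfun_integrable hcpsi).
  have := le_norm_Rintegral (bdd_mfunM hpsi hc).
  by congr (`|_| <= _); apply: eq_Rintegral => t _; ring.
exact: (bdd_mfun_integrable (bdd_mfunM hpsi hphi)).
Qed.

Lemma Rintegral_ae_eq M N A psi phi :
  bdd_mfun M A psi -> bdd_mfun N A phi ->
  {ae mu, forall t, A t -> psi t = phi t} ->
  \int[mu]_(t in A) psi t = \int[mu]_(t in A) phi t.
Proof.
move=> hpsi hphi pp; have [mA _ _ _] := hpsi; congr fine.
have := @ae_eq_integral _ LT R mu A _ _ mA (bdd_mfun_EFin hpsi)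
  (bdd_mfun_EFin hphi); apply.
by apply: leb_aeS pp => t h /h /= ->.
Qed.

(** If the integral vanished, so would [psi] almost everywhere; together with the null set where
    positivity fails, this would cover [A] by two null sets. *)
Lemma Rintegral_gt0 M A psi : bdd_mfun M A psi -> (0 < mu A)%E ->
  {ae mu, forall t, A t -> 0 < psi t} -> 0 < \int[mu]_(t in A) psi t.
Proof.
move=> h A0 psi0; have [mA fA mpsi Mpsi] := h.
have habs := bdd_mfun_norm h.
have -> : \int[mu]_(t in A) psi t = \int[mu]_(t in A) `|psi t|.
  apply: (Rintegral_ae_eq h habs); apply: leb_aeS psi0 => t psi0 /psi0 ?.
  by rewrite gtr0_norm.
rewrite lt_neqAle Rintegral_ge0 ?andbT//; apply/eqP => int0.
have psiE := integral_bdd_mfun habs; rewrite -int0 in psiE.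
have [+ _] := ae_eq_integral_abs mu mA (bdd_mfun_EFin h).
move=> /(_ psiE) [N1 [mN1 N10 sN1]].
case: psi0 => N2 [mN2 N20 sN2].
suff : A `<=` N1 `|` N2.
  move=> AN; have : (mu A <= mu (N1 `|` N2))%E.
    by rewrite le_measure ?inE//; exact: measurableU.
  move=> muA; have muN := measureU2 mu mN1 mN2.
  have N0 : (mu N1 + mu N2 = 0)%E.
    by rewrite -[RHS]adde0; exact: (f_equal2 adde N10 N20).
  have := le_trans muA muN; rewrite [X in (_ <= X)%E]N0 leNgt.
  by rewrite A0.
move=> t At; have [N1t|N1t] := pselect (N1 t); [by left|right].
apply: sN2 => /= /(_ At) t0; apply: N1t; apply: sN1 => /= /(_ At) [].
by apply/eqP; rewrite gt_eqF.
Qed.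

Lemma Rintegral_ge0_ae M A psi : bdd_mfun M A psi ->
  {ae mu, forall t, A t -> 0 < psi t} -> 0 <= \int[mu]_(t in A) psi t.
Proof.
move=> h psi0; have [mA fA mpsi Mpsi] := h.
have habs := bdd_mfun_norm h.
rewrite (Rintegral_ae_eq h habs) ?Rintegral_ge0//.
by apply: leb_aeS psi0 => t psi0 /psi0 ?; rewrite gtr0_norm.
Qed.

Lemma weight_bdd_mfun A psi : measurable (A : set LT) -> (mu A < +oo)%E ->
  weight A psi -> exists2 M, 0 <= M & bdd_mfun M A psi.
Proof.
(* [bounded] gives a bound by every number strictly above [M], hence the summand 1. *)
move=> mA fA [mpsi [M [_ hM]] _]; exists (`|M| + 1); first by rewrite addr_ge0.
by split => // t At; apply: hM => //; rewrite (le_lt_trans (ler_norm _))// ltrDl.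
Qed.

Lemma fine_leb_itv (x y : bool) (s t : R) : s <= t ->
  fine (mu [set` Interval (BSide x s) (BSide y t)]) = t - s.
Proof.
move=> st; rewrite leb_itv /= lte_fin; case: ltP => //= ts.
by apply/esym/eqP; rewrite subr_eq0 eq_le ts.
Qed.

Lemma leb_itv_fin (x y : bool) (s t : R) :
  (mu [set` Interval (BSide x s) (BSide y t)] < +oo)%E.
Proof. by rewrite leb_itv /=; case: ifP => _ //; rewrite -EFinB ltry. Qed.

End BoundedIntegrands.

(** * The integral of L-space valued maps *)

Section SimpleIntegral.
Context {R : realType} {X : lspaceType R} (P : X -> X).
Hypothesis hP : convexifying P.
Local Notation mu := (leb R).
Local Notation LT := (lebesgue_type R).
Local Notation d x y := (@mdist R X x y).
Implicit Types (A B T : set R) (F G : R -> X).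

Lemma leb_subset_fin A B : measurable (A : set LT) -> measurable (B : set LT) ->
  B `<=` A -> (mu A < +oo)%E -> (mu B < +oo)%E.
Proof.
by move=> mA mB BA fA; rewrite (le_lt_trans _ fA)// le_measure ?inE.
Qed.

Lemma fine_leb_partition n (S : 'I_n -> set R) T :
  (forall i, measurable (S i : set LT)) -> trivIset setT S ->
  measurable (T : set LT) -> T `<=` \bigcup_i S i -> (mu T < +oo)%E ->
  fine (mu T) = \sum_(i < n) fine (mu (T `&` S i)).
Proof.
move=> mS tS mT TS fT.
have mTS i : measurable (T `&` S i : set LT) by exact: measurableI.
have TE : T = \big[setU/set0]_(i < n) (T `&` S i).
  rewrite -bigcup_seq; apply/seteqP; split => [t Tt|t [i _ []]//].
  by have [i _ Si] := TS t Tt; exists i => //=; rewrite mem_index_enum.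
have tTS : trivIset setT (fun i => T `&` S i).
  exact: trivIset_setIl.
rewrite sum_fine => [|i _]; last first.
  rewrite ge0_fin_numE ?measure_ge0//.
  by apply: (leb_subset_fin mT (mTS i)) => //; exact: subIsetl.
rewrite {1}TE; congr fine.
apply: (@measure_semi_additive_ord _ LT R mu n _ mTS tTS).
by rewrite -TE.
Qed.

(** Frees the index set from being an ordinal: unions of domains use a sum type, refinements of
    partitions a product type. *)
Lemma is_simple_integral_fin (I : finType) (v : I -> X) (T : I -> set R) A F :
  (forall i, measurable (T i : set LT)) -> trivIset setT T ->
  \bigcup_i T i = A -> (forall i t, T i t -> F t = v i) ->
  is_simple_integral P A F
    (\big[ladd/theta]_(i : I) lscale (fine (mu (T i))) (P (v i))).
Proof.
move=> mT tT UT Tv; exists #|I|, (v \o enum_val), (T \o enum_val).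
split.
- by move=> i; exact: mT.
- move=> i j _ _ ij; apply: enum_val_inj; exact: tT ij.
- rewrite -UT; apply/seteqP; split => [t [i _ Ti]|t [i _ Ti]].
    by exists (enum_val i).
  by exists (enum_rank i) => //=; rewrite enum_rankK.
- move=> i t; exact: Tv.
- rewrite (reindex (@enum_val I I))//=.
  by exists enum_rank => i _; rewrite ?enum_valK ?enum_rankK.
Qed.

(* Both integrals are sums over the common refinement, by convexity of the
   values of P. *)
Lemma mdist_simple_integral A F G J K N e :
  measurable (A : set LT) -> (mu A < +oo)%E ->
  is_simple_integral P A F J -> is_simple_integral P A G K ->
  mu.-negligible N -> (forall t, A t -> ~ N t -> d (P (F t)) (P (G t)) <= e) ->
  d J K <= e * fine (mu A).
Proof.
move=> mA fA [n [v [T [mT tT UT Tv ->]]]] [m [w [S [mS tS US Sw ->]]]] negN FG.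
have TA i : T i `<=` A by rewrite -UT => t Ti; exists i.
have SA i : S i `<=` A by rewrite -US => t Ti; exists i.
have TE i : fine (mu (T i)) = \sum_(j < m) fine (mu (T i `&` S j)).
  apply: fine_leb_partition => //; first by rewrite US.
  exact: leb_subset_fin fA.
have SE j : fine (mu (S j)) = \sum_(i < n) fine (mu (T i `&` S j)).
  under eq_bigr do rewrite setIC.
  apply: fine_leb_partition => //; first by rewrite UT.
  exact: leb_subset_fin fA.
have c0 i j : 0 <= fine (mu (T i `&` S j)) by rewrite fine_ge0.
have cP x : convex_elt X (P x) by exact: convexifying_convex.
under eq_bigr do rewrite TE -convex_big_lscale//.
under [X in d _ X]eq_bigr do rewrite SE -convex_big_lscale//.
rewrite [X in d _ X]exchange_big/= (le_trans (mdist_big_ladd _ _ _ _))//.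
have AE : fine (mu A) = \sum_(i < n) \sum_(j < m) fine (mu (T i `&` S j)).
  rewrite (@fine_leb_partition n T A) ?UT//; apply: eq_bigr => i _.
  by rewrite -TE; congr (fine (mu _)); apply/setIidr; exact: TA.
rewrite AE mulr_sumr ler_sum// => i _.
rewrite (le_trans (mdist_big_ladd _ _ _ _))// mulr_sumr ler_sum// => j _.
rewrite mdist_lscale ger0_norm// mulrC.
(* A null cell contributes nothing. A cell of positive measure is not contained in the negligible
   set [N], so it has a point at which the two simple mappings can be compared. *)
have [->|/eqP TS0] := eqVneq (mu (T i `&` S j)) 0%E; first by rewrite !mulr0.
rewrite ler_wpM2r//.
have [t [[Tt St] Nt]] : exists t, (T i `&` S j) t /\ ~ N t.
  apply/not_existsP => h; apply: TS0.
  have mTS : measurable (T i `&` S j : set LT) by exact: measurableI.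
  case: negN => N' [mN' N'0 NN'].
  apply/eqP; rewrite eq_le measure_ge0 andbT -[leRHS]N'0.
  rewrite le_measure ?inE// => t TSt; apply: NN'.
  by have /not_andP[//|/contrapT] := h t.
by rewrite -(Tv _ _ Tt) -(Sw _ _ St); apply: FG => //; exact: TA Tt.
Qed.

End SimpleIntegral.

Section UniformLimits.
Context {R : realType} {X : lspaceType R}.
Local Notation d x y := (@mdist R X x y).

Lemma uniform_mdistP (A : set R) (F : nat -> R -> X) (f : R -> X) :
  {uniform A, F @ \oo --> f} <->
  forall e, 0 < e -> \forall k \near \oo, forall t, A t -> d (f t) (F k t) < e.
Proof.
split=> [FfA e e0|Fe].
  have : nbhs (f : {uniform` A -> X})
      [set h | forall y, A y -> ball (f y) e (h y)].
    apply/uniform_nbhs; exists [set xy : X * X | ball xy.1 e xy.2]; split=> //.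
    by rewrite -entourage_ballE; exists e.
  move=> /FfA; rewrite !nbhs_filterE; apply: (@filterS _ \oo) => k /= Fk y Ay.
  by move: (Fk y Ay); rewrite ballEmdist.
move=> U /uniform_nbhs[E [/= entE EU]].
move: entE; rewrite -entourage_ballE => -[e /= e0 eE].
move: (Fe e e0); rewrite !nbhs_filterE; apply: (@filterS _ \oo) => k /= Fk.
by apply: EU => y Ay /=; apply: eE => /=; rewrite ballEmdist; exact: Fk.
Qed.

End UniformLimits.

(** * Integrals of uniform limits of simple mappings *)

Section IntegralTheory.
Context {R : realType} {X : lspaceType R} (P : X -> X).
Hypothesis hP : convexifying P.
Local Notation mu := (leb R).
Local Notation LT := (lebesgue_type R).
Local Notation d x y := (@mdist R X x y).
Implicit Types (A B T N : set R) (f g F G : R -> X).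

Lemma mdist_is_integral A f g J K N e :
  measurable (A : set LT) -> (mu A < +oo)%E ->
  is_integral P A f J -> is_integral P A g K ->
  mu.-negligible N -> (forall t, A t -> ~ N t -> d (P (f t)) (P (g t)) <= e) ->
  d J K <= e * fine (mu A).
Proof.
move=> mA fA [F [Jk [sF /uniform_mdistP Ff JkJ]]].
move=> [G [Kk [sG /uniform_mdistP Gg KkK]]] negN fg.
apply/ler_addgt0Pr => eta eta0.
pose m := fine (mu A); have m0 : 0 <= m by rewrite fine_ge0.
(* The approximation costs [c] at each of the two integrals and [2 * c] pointwise, that is
   [2 * c * m] after integration; the total is [c * (2 + 2 * m) = eta]. *)
pose c := eta / (2 + 2 * m).
have m2 : 0 < 2 + 2 * m by rewrite ltr_wpDr// mulr_ge0.
have c0 : 0 < c by rewrite divr_gt0.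
move: (Ff c c0) (Gg c c0) => {}Ff {}Gg.
move/metricType_numDomainType.cvgrPdist_lt : JkJ => /(_ c c0) JkJ.
move/metricType_numDomainType.cvgrPdist_lt : KkK => /(_ c c0) KkK.
near \oo => k.
have Fk : forall t, A t -> d (f t) (F k t) < c by near: k.
have Gk : forall t, A t -> d (g t) (G k t) < c by near: k.
have Jkc : d J (Jk k) < c by near: k.
have Kkc : d K (Kk k) < c by near: k.
have : d (Jk k) (Kk k) <= (e + 2 * c) * m.
  apply: (mdist_simple_integral hP mA fA (sF k) (sG k) negN) => t At Nt.
  have h1 := le_lt_trans (convexifying_lip hP _ _) (Fk t At).
  have h2 := le_lt_trans (convexifying_lip hP _ _) (Gk t At).
  rewrite metric_sym in h1.
  have := metric_triangle (P (F k t)) (P (f t)) (P (G k t)).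
  have := metric_triangle (P (f t)) (P (g t)) (P (G k t)).
  have := fg t At Nt; lra.
have := metric_triangle J (Jk k) K.
have := metric_triangle (Jk k) (Kk k) K.
rewrite (metric_sym (Kk k)).
have -> : eta = c * (2 + 2 * m) by rewrite divfK ?gt_eqF.
rewrite -/m; nra.
Unshelve. all: by end_near. Qed.

Lemma is_integral_uniq A f J K :
  measurable (A : set LT) -> (mu A < +oo)%E ->
  is_integral P A f J -> is_integral P A f K -> J = K.
Proof.
move=> mA fA fJ fK; apply/mdist_positivity/eqP.
rewrite eq_le mdist_ge0 andbT -[leRHS](mul0r (fine (mu A))).
apply: (mdist_is_integral mA fA fJ fK (N := set0)); first exact: negligible_set0.
by move=> t _ _; rewrite mdistxx.
Qed.

Lemma is_integral_simple A F J :
  is_simple_integral P A F J -> is_integral P A F J.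
Proof.
move=> sF; exists (fun=> F), (fun=> J); split => //; last exact: cvg_cst.
by apply/uniform_mdistP => e e0; near=> k => t _; rewrite mdistxx.
Unshelve. all: by end_near. Qed.

Lemma eq_is_simple_integral A F G J : (forall t, A t -> F t = G t) ->
  is_simple_integral P A F J -> is_simple_integral P A G J.
Proof.
move=> FG [n [v [T [mT tT UT Tv ->]]]]; exists n, v, T; split => // i t Ti.
by rewrite -FG ?(Tv i)// -UT; exists i.
Qed.

Lemma is_simple_integral_setU A B F J K : [disjoint A & B] ->
  is_simple_integral P A F J -> is_simple_integral P B F K ->
  is_simple_integral P (A `|` B) F (ladd J K).
Proof.
move=> /disj_setPS AB [n [v [T [mT tT UT Tv ->]]]] [m [w [S [mS tS US Sw ->]]]].
have TA i : T i `<=` A by rewrite -UT => t Ti; exists i.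
have SB i : S i `<=` B by rewrite -US => t Ti; exists i.
have := @is_simple_integral_fin R X P ('I_n + 'I_m)%type
  (fun ij => match ij with inl i => v i | inr j => w j end)
  (fun ij => match ij with inl i => T i | inr j => S j end) (A `|` B) F.
rewrite big_sumType/=; apply.
- by move=> [i|j]; [exact: mT|exact: mS].
- move=> [i|i] [j|j] _ _ [t [ti tj]].
  + by congr inl; apply: tT => //; exists t.
  + by have [] := AB t; split; [exact: TA ti|exact: SB tj].
  + by have [] := AB t; split; [exact: TA tj|exact: SB ti].
  + by congr inr; apply: tS => //; exists t.
- rewrite -UT -US; apply/seteqP; split => [t [[i|j] _ ?]|t [[i _ ?]|[j _ ?]]].
  + by left; exists i.
  + by right; exists j.
  + by exists (inl i).
  + by exists (inr j).
- by move=> [i|j] t; [exact: Tv|exact: Sw].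
Qed.

Lemma is_integral_setU A B f J K : [disjoint A & B] ->
  is_integral P A f J -> is_integral P B f K ->
  is_integral P (A `|` B) f (ladd J K).
Proof.
move=> AB [F [Jk [sF /uniform_mdistP Ff JkJ]]].
move=> [G [Kk [sG /uniform_mdistP Gf KkK]]].
have nAB t : A t -> ~ B t.
  by move: AB => /disj_setPS AB At Bt; have [] := AB t.
pose H k t := if t \in A then F k t else G k t.
exists H, (fun k => ladd (Jk k) (Kk k)); split.
- move=> k; apply: is_simple_integral_setU => //.
    by apply: eq_is_simple_integral (sF k) => t At; rewrite /H mem_set.
  apply: eq_is_simple_integral (sG k) => t Bt; rewrite /H memNset// => At.
  exact: nAB At Bt.
- apply/uniform_mdistP => e e0; near=> k => t ABt.
  have Fk : forall t, A t -> d (f t) (F k t) < e by near: k; exact: Ff.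
  have Gk : forall t, B t -> d (f t) (G k t) < e by near: k; exact: Gf.
  rewrite /H; case: ifPn => [/set_mem|]; first exact: Fk.
  by move=> /negP nAt; apply: Gk; case: ABt => // At; case: nAt; exact: mem_set.
- apply/metricType_numDomainType.cvgrPdist_lt => e e0.
  have e20 : 0 < e / 2 by rewrite divr_gt0.
  move/metricType_numDomainType.cvgrPdist_lt : JkJ => /(_ _ e20) JkJ.
  move/metricType_numDomainType.cvgrPdist_lt : KkK => /(_ _ e20) KkK.
  near=> k.
  rewrite (le_lt_trans (mdist_ladd2 _ _ _ _))// [ltRHS]splitr ltrD//.
    by near: k.
  by near: k.
Unshelve. all: by end_near. Qed.

(** [kappa] labels the cells of a partition and [xi] samples one point in each. For an empty cell
    [xi] returns the default 0, which is harmless: the cell has measure zero and no point of [A]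
    carries its label. *)
Lemma simple_approximation A f e (I : finType) (kappa : R -> I) :
  (forall i, measurable (A `&` [set t | kappa t = i] : set LT)) ->
  (forall s t, A s -> A t -> kappa s = kappa t -> d (f s) (f t) <= e) ->
  let xi i := xget 0 (A `&` [set t | kappa t = i]) in
  is_simple_integral P A (fun t => f (xi (kappa t)))
    (\big[ladd/theta]_(i : I)
      lscale (fine (mu (A `&` [set t | kappa t = i]))) (P (f (xi i)))) /\
  forall t, A t -> d (f t) (f (xi (kappa t))) <= e.
Proof.
move=> mA fe xi; split.
  apply: is_simple_integral_fin => //.
  - by move=> i j _ _ [t [/= [_ <-] [_ <-]]].
  - by apply/seteqP; split => [t [i _ []]//|t At]; exists (kappa t).
  - by move=> i t [_ /= ->].
move=> t At; have [] : (A `&` [set s | kappa s = kappa t]) (xi (kappa t)).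
  by rewrite /xi; case: xgetP => [x -> //|/(_ t)]; case; split.
by move=> Ax /= kx; apply: fe.
Qed.

(** A Riemann-type criterion. Partitions of oscillation [1 / (k + 1)] give simple mappings whose
    integrals form a Cauchy sequence by [mdist_simple_integral], and [X] is complete. *)
Lemma is_integral_exists A f :
  measurable (A : set LT) -> (mu A < +oo)%E ->
  (forall e, 0 < e -> exists (I : finType) (kappa : R -> I),
    (forall i, measurable (A `&` [set t | kappa t = i] : set LT)) /\
    (forall s t, A s -> A t -> kappa s = kappa t -> d (f s) (f t) <= e)) ->
  exists I, is_integral P A f I.
Proof.
move=> mA fA part.
have approx k : exists FJ : (R -> X) * X, is_simple_integral P A FJ.1 FJ.2 /\
    forall t, A t -> d (f t) (FJ.1 t) <= k.+1%:R^-1.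
  have [//|I [kappa [mk fk]]] := part k.+1%:R^-1.
  by have [s1 s2] := simple_approximation mk fk; eexists (_, _); split; eauto.
have [FJ hFJ] := choice approx.
have cv : cvg ((fun k => (FJ k).2) @ \oo).
  apply/cauchy_cvgP/cauchy_ballP => e e0; near_simpl.
  pose m := fine (mu A) + 1; have m0 : 0 < m by rewrite ltr_wpDl// fine_ge0.
  have near_small : \forall k \near \oo, k.+1%:R^-1 < e / (2 * m).
    by apply: near_infty_natSinv_lt (PosNum _); rewrite divr_gt0// mulr_gt0.
  near=> k l => /=; rewrite ballEmdist/=.
  have [sk fk] := hFJ k; have [sl fl] := hFJ l.
  have : d (FJ k).2 (FJ l).2 <= (k.+1%:R^-1 + l.+1%:R^-1) * fine (mu A).
    apply: (mdist_simple_integral hP mA fA sk sl (N := set0)).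
      exact: negligible_set0.
    move=> t At _; rewrite (le_trans (convexifying_lip hP _ _))//.
    rewrite (le_trans (metric_triangle _ (f t) _))// lerD// ?fl//.
    by rewrite metric_sym fk.
  move=> /le_lt_trans; apply.
  have kl : k.+1%:R^-1 + l.+1%:R^-1 < e / (2 * m) + e / (2 * m).
    by apply: ltrD; [near: k|near: l]; exact: near_small.
  have mA0 : 0 <= fine (mu A) by rewrite fine_ge0.
  apply: (@le_lt_trans _ _ ((e / (2 * m) + e / (2 * m)) * fine (mu A))).
    by rewrite ler_wpM2r// ltW.
  rewrite -mulrDl -mulr2n -(mulr_natl e) -mulf_div divff// mul1r.
  by rewrite -mulrA gtr_pMr// mulrC ltr_pdivrMr// mul1r ltrDl.
exists (lim ((fun k => (FJ k).2) @ \oo)), (fun k => (FJ k).1), (fun k => (FJ k).2).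
split => //; first by move=> k; have [] := hFJ k.
apply/uniform_mdistP => e e0; near=> k => t At.
have [_ /(_ t At) /le_lt_trans] := hFJ k; apply.
by near: k; exact: (near_infty_natSinv_lt (PosNum e0)).
Unshelve. all: by end_near. Qed.

End IntegralTheory.

(** * Integrals of maps multiplied by a weight *)

Section WeightedIntegral.
Context {R : realType}.
Local Notation mu := (leb R).
Local Notation LT := (lebesgue_type R).
Implicit Types (A : set R) (psi h : R -> R).

(** The cells are the preimages of consecutive intervals of length [eta]; boundedness of [h] leaves
    finitely many of them. *)
Lemma level_partition M A h eta : bdd_mfun M A h -> 0 < eta ->
  exists n (kappa : R -> 'I_n.+1),
    (forall i, measurable (A `&` [set t | kappa t = i] : set LT)) /\
    (forall s t, A s -> A t -> kappa s = kappa t -> `|h s - h t| < eta).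
Proof.
move=> [mA fA mh Mh] eta0; pose n := Num.truncn (2 * M / eta).
pose k t := Num.truncn ((h t + M) / eta).
have hM t : A t -> 0 <= (h t + M) / eta.
  by move=> /Mh; rewrite ler_norml => /andP[+ _] => ?; rewrite divr_ge0 ?(ltW eta0)//; lra.
have kn t : A t -> (k t < n.+1)%N.
  move=> At; rewrite ltnS; apply: le_truncn; rewrite ler_pM2r ?invr_gt0//.
  by move: (Mh _ At); rewrite ler_norml => /andP[_]; lra.
have kE t i : A t -> (k t = i) <-> (eta * i%:R - M <= h t < eta * i.+1%:R - M).
  move=> At; have : (k t == i) = (eta * i%:R - M <= h t < eta * i.+1%:R - M).
    rewrite truncn_eq ?hM// ler_pdivlMr// ltr_pdivrMr//.
    by rewrite lerBlDr ltrBrDr !(mulrC eta).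
  by move=> <-; split => [->|/eqP].
(* Outside [A] the level may exceed [n], and [inord] then returns a meaningless index; both claims
   look at points of [A] only. *)
exists n, (fun t => inord (k t)); split => [i|s t As At /(congr1 val)/=].
- rewrite (_ : A `&` _ =
      A `&` h @^-1` `[eta * i%:R - M, eta * i.+1%:R - M[%classic).
    by apply: mh => //; exact: measurable_itv.
  apply/seteqP; split => t [At /=].
    move=> /(congr1 val)/=; rewrite inordK ?kn// => /(kE _ _ At) hi.
    by split => //=; rewrite in_itv.
  rewrite in_itv => /(kE _ _ At) hi; split => //=; apply/val_inj => /=.
  by rewrite hi inord_val.
- rewrite !inordK ?kn// => ks.
  have /(kE s _ As) hs := erefl (k s).
  have /(kE t _ At) := esym ks.
  move: hs => /andP[h1 h2] /andP[h3 h4].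
  rewrite ltr_norml; move: h2 h4; rewrite -natr1 mulrDr mulr1 => h2 h4.
  by apply/andP; split; lra.
Qed.

Lemma Rintegral_partition M A h (I : finType) (kappa : R -> I) :
  bdd_mfun M A h ->
  (forall i, measurable (A `&` [set t | kappa t = i] : set LT)) ->
  \int[mu]_(t in A) h t =
  \sum_(i : I) \int[mu]_(t in A `&` [set t | kappa t = i]) h t.
Proof.
move=> hh mk; pose T i := A `&` [set t | kappa t = i].
have AE : A = \big[setU/set0]_(i <- index_enum I) T i.
  rewrite -bigcup_seq; apply/seteqP; split => [t At|t [i _ []]//].
  by exists (kappa t) => //=; rewrite mem_index_enum.
have hT i : bdd_mfun M (T i) h by apply: (bdd_mfun_subset (mk i)) hh => t [].
apply: EFin_inj; rewrite -(integral_bdd_mfun hh) -sumEFin.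
under [RHS]eq_bigr => i _ do rewrite -(integral_bdd_mfun (hT i)).
rewrite {1}AE; apply: (@integral_bigsetU_EFin _ LT R mu I T h).
- exact: mk.
- exact: index_enum_uniq.
- by move=> i j _ _ [t [/= [_ <-] [_ <-]]].
- by rewrite -AE; exact: bdd_mfun_EFin hh.
Qed.

Context {X : lspaceType R} (P : X -> X).
Hypothesis hP : convexifying P.
Local Notation d x y := (@mdist R X x y).
Implicit Types (f : R -> X).

Lemma integralE A f J : measurable (A : set LT) -> (mu A < +oo)%E ->
  is_integral P A (P \o f) J -> Defs.integral P A f = J.
Proof.
move=> mA fA fJ; rewrite /Defs.integral.
by case: xgetP => [K -> fK|/(_ J)//]; exact: (is_integral_uniq hP mA fA fK fJ).
Qed.

(** The partition is the product of a cut of the line, on whose cells [f] varies little, and a cut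
    by the levels of [psi]. A change of [f] is controlled because [P] is 1-Lipschitz, a change of
    [psi] because the value [P (f t)] is convex. *)
Lemma is_integral_weight_exists M L C A psi f :
  bdd_mfun M A psi -> (forall t, A t -> `|t| <= L) ->
  (forall t, A t -> d (f t) theta <= C) ->
  (forall e, 0 < e -> exists2 eta, 0 < eta &
     forall s t, A s -> A t -> `|s - t| < eta -> d (f s) (f t) <= e) ->
  exists J, is_integral P A (P \o (fun t => lscale (psi t) (f t))) J.
Proof.
move=> hpsi AL fC fcont; have [mA fA _ Mpsi] := hpsi.
apply: is_integral_exists => // e e0.
pose e1 := e / (2 * (`|M| + 1)); pose e2 := e / (2 * (`|C| + 1)).
have M0 : 0 < `|M| + 1 by rewrite ltr_wpDl.
have C0 : 0 < `|C| + 1 by rewrite ltr_wpDl.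
have e10 : 0 < e1 by rewrite divr_gt0// mulr_gt0.
have e20 : 0 < e2 by rewrite divr_gt0// mulr_gt0.
have [eta eta0 feta] := fcont _ e10.
have hid : bdd_mfun L A (fun t => t).
  split; [exact: mA|exact: fA| |exact: AL].
  move=> _ B mB; apply: measurableI => //.
  exact: leb_measurable_borel.
have [n [k [mk hk]]] := level_partition hid eta0.
have [m [l [ml hl]]] := level_partition hpsi e20.
exists ('I_n.+1 * 'I_m.+1)%type, (fun t => (k t, l t)); split.
  move=> [i j]; rewrite (_ : _ `&` _ =
    (A `&` [set t | k t = i]) `&` (A `&` [set t | l t = j])).
    exact: measurableI.
  apply/seteqP; split => [t [At /= [<- <-]]//|t [[At /= ki] [_ /= li]]].
  by split => //=; rewrite ki li.
move=> s t As At [/(hk _ _ As At) /(feta _ _ As At) fst /(hl _ _ As At) lst] /=.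
rewrite !(convexifying_lscale hP).
rewrite (le_trans (metric_triangle _ (lscale (psi s) (P (f t))) _))//.
rewrite mdist_lscale.
have d1 := le_trans (convexifying_lip hP (f s) (f t)) fst.
have d2 := mdist_lscale2_convex (psi s) (psi t) (convexifying_convex hP (f t)).
have d3 : d (P (f t)) theta <= `|C| + 1.
  rewrite -(convexifying_theta hP) (le_trans (convexifying_lip hP _ _))//.
  by rewrite (le_trans (fC t At))// (le_trans (ler_norm C))// lerDl.
have Ms : `|psi s| <= `|M| + 1.
  by rewrite (le_trans (Mpsi s As))// (le_trans (ler_norm M))// lerDl.
have : `|psi s| * d (P (f s)) (P (f t)) <= (`|M| + 1) * e1.
  by apply: ler_pM => //; exact: mdist_ge0.
have : `|psi s - psi t| * d (P (f t)) theta <= e2 * (`|C| + 1).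
  by apply: ler_pM => //; [exact: mdist_ge0|exact: ltW].
have -> : (`|M| + 1) * e1 = e / 2.
  by rewrite /e1; field; rewrite gt_eqF.
have -> : e2 * (`|C| + 1) = e / 2.
  by rewrite /e2; field; rewrite gt_eqF.
lra.
Qed.

(** Approximation on level sets of [psi] yields the sum of [mu (T i) psi (x i) z]. Convexity of [z]
    and nonnegativity of [psi] collapse it to a real Riemann sum times [z], and that sum is close to
    the integral of [psi]. *)
Lemma is_integral_lscale M A psi z : bdd_mfun M A psi -> (forall t, 0 <= psi t) ->
  convex_elt X z ->
  is_integral P A (fun t => lscale (psi t) z)
    (lscale (\int[mu]_(t in A) psi t) z).
Proof.
move=> hpsi psi0 cz; have [mA fA mpsi Mpsi] := hpsi.
pose D := d z theta; have D0 : 0 <= D by exact: mdist_ge0.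
have osc n (k : R -> 'I_n.+1) eta :
    (forall s t, A s -> A t -> k s = k t -> `|psi s - psi t| < eta) ->
    forall s t, A s -> A t -> k s = k t ->
    d (lscale (psi s) z) (lscale (psi t) z) <= eta * D.
  move=> hk s t As At kst; rewrite (le_trans (mdist_lscale2_convex _ _ cz))//.
  by rewrite ler_wpM2r// ltW// hk.
have [J HJ] : exists J, is_integral P A (fun t => lscale (psi t) z) J.
  apply: is_integral_exists => // e e0.
  have D10 : 0 < D + 1 by rewrite ltr_wpDl.
  have [|n [k [mk hk]]] := level_partition hpsi (eta := e / (D + 1)).
    by rewrite divr_gt0.
  exists 'I_n.+1, k; split => // s t As At /(osc _ _ _ hk _ _ As At)/le_trans; apply.
  by rewrite -mulrA ler_piMr ?(ltW e0)// mulrC ler_pdivrMr// mul1r lerDl.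
suff -> : lscale (\int[mu]_(t in A) psi t) z = J by [].
apply/esym/mdist_positivity/eqP; rewrite eq_le mdist_ge0 andbT.
apply/ler_addgt0Pr => e e0; rewrite add0r.
pose m := fine (mu A); have m0 : 0 <= m by rewrite fine_ge0.
(* Two errors of size [eta * D * m] occur: from the simple mapping, and from the Riemann sum. The
   summand 1 keeps [c] positive. *)
pose c := 2 * D * m + 1.
have c0 : 0 < c by rewrite ltr_wpDl// !mulr_ge0.
pose eta := e / c; have eta0 : 0 < eta by rewrite divr_gt0.
have [n [k [mk hk]]] := level_partition hpsi eta0.
have [simJ approx] := simple_approximation P mk (osc _ _ _ hk).
set K := \big[_/_]_(_ | _) _ in simJ.
have JK : d J K <= eta * D * m.
  apply: (mdist_is_integral hP mA fA HJ (is_integral_simple simJ) (N := set0)).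
    exact: negligible_set0.
  by move=> t At _; rewrite (le_trans (convexifying_lip hP _ _))// approx.
pose T i := A `&` [set t | k t = i].
(* On an empty cell this is [psi 0], still nonnegative because [psi] is assumed so on the whole
   line. *)
pose x i := psi (xget 0 (T i)).
have KE : K = lscale (\sum_i fine (mu (T i)) * x i) z.
  rewrite -convex_big_lscale// => [|i]; last first.
    by apply: mulr_ge0; [rewrite fine_ge0|exact: psi0].
  apply: eq_bigr => i _; rewrite (convexifying_lscale hP) (convexifying_id hP cz).
  by rewrite lscaleA.
have hT i : bdd_mfun M (T i) psi by apply: (bdd_mfun_subset (mk i)) hpsi => t [].
have mE : m = \sum_i fine (mu (T i)).
  rewrite /m; have := Rintegral_partition (bdd_mfun_cst 1 mA fA) mk.
  rewrite Rintegral_cst// mul1r => ->; apply: eq_bigr => i _.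
  by rewrite Rintegral_cst// mul1r.
have sums : `|\sum_i fine (mu (T i)) * x i - \int[mu]_(t in A) psi t| <= eta * m.
  rewrite (Rintegral_partition hpsi mk) -sumrB (le_trans (ler_norm_sum _ _ _))//.
  rewrite mE mulr_sumr ler_sum// => i _.
  have h1 := bdd_mfun_cst 1 (mk i) (leb_subset_fin mA (mk i) (@subIsetl _ _ _) fA).
  have h2 t : T i t -> `|psi t - x i| <= eta.
    move=> Tt; have [Ax kx] : T i (xget 0 (T i)).
      by case: xgetP => [y -> //|/(_ t)].
    by case: Tt => At kt; apply/ltW/hk => //; rewrite kt kx.
  have := Rintegral_cell h1 (hT i) h2.
  rewrite Rintegral_cst// mul1r normr1 mul1r mulrC distrC.
  by congr (`|_ - _| <= _); apply: eq_Rintegral => t _; rewrite mul1r.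
rewrite (le_trans (metric_triangle _ K _))//.
have KI : d K (lscale (\int[mu]_(t in A) psi t) z) <= eta * m * D.
  rewrite KE (le_trans (mdist_lscale2_convex _ _ cz))//.
  by rewrite ler_wpM2r.
have -> : e = eta * c by rewrite /eta divfK// gt_eqF.
rewrite /c; nra.
Qed.

Lemma weighted_integral_cell M A psi f z e J : bdd_mfun M A psi ->
  {ae mu, forall t, A t -> 0 < psi t} ->
  is_integral P A (P \o (fun t => lscale (psi t) (f t))) J ->
  (forall t, A t -> d (P (f t)) (P z) <= e) ->
  d J (lscale (\int[mu]_(t in A) psi t) (P z)) <= M * e * fine (mu A).
Proof.
move=> hpsi psi0 HJ fe; have [mA fA mpsi Mpsi] := hpsi.
(* [is_integral_lscale] wants a weight that is nonnegative everywhere; the positive part is one, and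
   it differs from [psi] on a null set only. *)
pose psip t := Num.max (psi t) 0.
have hpsip : bdd_mfun M A psip.
  split; [exact: mA|exact: fA| |].
    exact: (measurable_funrpos mpsi).
  move=> t At; rewrite /psip maxEle; case: ifP => _; last exact: Mpsi.
  by rewrite normr0 (le_trans _ (Mpsi t At)).
have -> : \int[mu]_(t in A) psi t = \int[mu]_(t in A) psip t.
  apply: (Rintegral_ae_eq hpsi hpsip); apply: leb_aeS psi0 => t h /h t0.
  by rewrite /psip max_l// ltW.
have cPz := convexifying_convex hP z.
have psip0 t : 0 <= psip t by rewrite /psip le_max lexx orbT.
(* The last argument makes the null set where positivity of [psi] fails the exceptional set of the
   comparison. *)
apply: (mdist_is_integral hP mA fA HJ (is_integral_lscale hpsip psip0 cPz) psi0).
move=> t At /contrapT /(_ At) t0.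
rewrite /= (convexifying_idem hP) !(convexifying_lscale hP) (convexifying_idem hP).
rewrite /psip max_l ?(ltW t0)// mdist_lscale.
by apply: ler_pM; rewrite ?mdist_ge0// ?Mpsi// fe.
Qed.

End WeightedIntegral.

(** * The rearrangement rho *)

Section RealAuxiliary.
Context {R : realType}.

Lemma within_continuous_itvP (i : interval R) (f : R -> R) :
  {within [set` i], continuous f} <->
  forall x, x \in i -> forall e, 0 < e -> exists2 d, 0 < d &
    forall y, y \in i -> `|x - y| < d -> `|f x - f y| < e.
Proof.
rewrite subspace_continuousP; split => [h x xi e e0|h x xi].
  have /cvgrPdist_lt/(_ e e0) := h x xi.
  rewrite near_withinE => -[d /= d0 hd]; exists d => // y yi xy.
  exact: hd.
apply/cvgrPdist_lt => e e0; have [d d0 hd] := h x xi e e0.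
rewrite near_withinE; exists d => //= y /= xy yi.
exact: hd.
Qed.

Lemma lipschitz_IVT (M : R) (f : R -> R) (p q v : R) : p <= q ->
  (forall s t, p <= s <= q -> p <= t <= q -> `|f s - f t| <= M * `|s - t|) ->
  f p <= v <= f q -> exists2 s, p <= s <= q & f s = v.
Proof.
move=> pq fM /andP[pv vq].
have [|||s sI <-] := @IVT R f p q v.
- exact: pq.
- apply/within_continuous_itvP => x xi e e0.
  have M0 : 0 < `|M| + 1 by rewrite ltr_wpDl.
  exists (e / (`|M| + 1)); first by rewrite divr_gt0.
  move=> y yi xy; rewrite !in_itv/= in xi yi.
  rewrite (le_lt_trans (fM _ _ xi yi))//.
  rewrite (@le_lt_trans _ _ ((`|M| + 1) * `|x - y|))//.
    by rewrite ler_wpM2r// (le_trans (ler_norm M))// lerDl.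
  by rewrite mulrC -ltr_pdivlMr.
- by rewrite ge_min le_max pv vq orbT.
- by exists s; [rewrite in_itv in sI|].
Qed.

Variable omega : R -> R.
Hypothesis homega : modulus_of_continuity omega.

Lemma modulus_le s t : 0 <= s -> s <= t -> omega s <= omega t.
Proof.
case: homega => mono _ _ _ _ s0 st; apply: mono => //.
  by rewrite in_itv/= s0.
by rewrite in_itv/= (le_trans s0 st).
Qed.

Lemma modulus_ge0 t : 0 <= t -> 0 <= omega t.
Proof. by case: homega => _ _ _ + _; exact. Qed.

Lemma modulus0 : omega 0 = 0.
Proof. by case: homega. Qed.

Lemma modulus_small e : 0 < e ->
  exists2 d, 0 < d & forall t, 0 <= t -> t < d -> omega t <= e.
Proof.
move=> e0; case: homega => _ /within_continuous_itvP h _ _ w0.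
have [|d d0 hd] := h 0 _ e e0; first by rewrite in_itv/= lexx.
exists d => // t t0 td; have := hd t; rewrite in_itv/= t0 => /(_ isT).
rewrite sub0r normrN ger0_norm// => /(_ td).
by rewrite w0 sub0r normrN => /ltW/(le_trans (ler_norm _)).
Qed.

Lemma modulus_sub s t : 0 <= s -> 0 <= t ->
  `|omega s - omega t| <= omega `|s - t|.
Proof.
case: homega => _ _ sub _ _.
wlog st : s t / s <= t => [hw s0 t0|s0 t0].
  case/orP: (le_total s t) => ?; first exact: hw.
  by rewrite distrC (distrC s); exact: hw.
rewrite distrC ger0_norm ?subr_ge0; last exact: modulus_le.
rewrite distrC ger0_norm ?subr_ge0// lerBlDl.
by rewrite -{1}(subrKC s t) sub ?subr_ge0.
Qed.

Lemma modulus_within_continuous (i : interval R) (h : R -> R) :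
  (forall s t, s \in i -> t \in i -> `|h s - h t| <= omega `|s - t|) ->
  {within [set` i], continuous h}.
Proof.
move=> hh; apply/within_continuous_itvP => x xi e e0.
have [|d d0 hd] := @modulus_small (e / 2); first by rewrite divr_gt0.
exists d => // y yi xy; rewrite (le_lt_trans (hh x y xi yi))//.
by rewrite (le_lt_trans (hd _ _ xy))// ltr_pdivrMr// ltr_pMr// ltr1n.
Qed.

End RealAuxiliary.

Section Rearrangement.
Context {R : realType} (a a' b' b : R) (psi1 psi2 : R -> R).
Hypotheses (haa' : a < a') (ha'b' : a' <= b') (hb'b : b' < b).
Hypotheses (hpsi1 : weight `[a, a'] psi1) (hpsi2 : weight `[b', b] psi2).
Local Notation mu := (leb R).
Local Notation LT := (lebesgue_type R).
Hypothesis hpsi : (\int[mu]_(t in `[a, a']) (psi1 t)%:E =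
                   \int[mu]_(t in `[b', b]) (psi2 t)%:E)%E.
Local Notation rho := (rho a a' b' b psi1 psi2).
Local Notation rho_inv := (rho_inv a a' b' b psi1 psi2).
Local Notation c := ((a' + b') / 2).

Lemma weight_bounded : exists2 M, 0 <= M &
  bdd_mfun M `[a, a'] psi1 /\ bdd_mfun M `[b', b] psi2.
Proof.
have [M1 M10 h1] := weight_bdd_mfun (leb_measurable_itv _) (leb_itv_fin _ _ _ _) hpsi1.
have [M2 M20 h2] := weight_bdd_mfun (leb_measurable_itv _) (leb_itv_fin _ _ _ _) hpsi2.
exists (M1 + M2); first by rewrite addr_ge0.
case: h1 h2 => [m1 f1 g1 b1] [m2 f2 g2 b2]; split.
  split; [exact: m1|exact: f1|exact: g1|].
  by move=> t /b1 /le_trans; apply; rewrite lerDl.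
split; [exact: m2|exact: f2|exact: g2|].
by move=> t /b2 /le_trans; apply; rewrite lerDr.
Qed.

Lemma disjoint_itvcc_oc (x y z : R) : [disjoint `[x, y]%classic & `]y, z]%classic].
Proof.
apply/disj_setPS => t [/=]; rewrite !in_itv/= => /andP[_ ty] /andP[yt _].
by rewrite ltNge ty in yt.
Qed.

Lemma disjoint_itvco_cc (x y z : R) : [disjoint `[x, y[%classic & `[y, z]%classic].
Proof.
apply/disj_setPS => t [/=]; rewrite !in_itv/= => /andP[_ ty] /andP[yt _].
by rewrite ltNge yt in ty.
Qed.

Lemma itvccU_oc (x y z : R) : x <= y -> y <= z ->
  `[x, z]%classic = `[x, y]%classic `|` `]y, z]%classic.
Proof.
by move=> xy yz; rewrite (@itv_bndbnd_setU _ _ _ (BRight y)) ?bnd_simp.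
Qed.

Lemma itvcoU_cc (x y z : R) : x <= y -> y <= z ->
  `[x, z]%classic = `[x, y[%classic `|` `[y, z]%classic.
Proof.
by move=> xy yz; rewrite (@itv_bndbnd_setU _ _ _ (BLeft y)) ?bnd_simp.
Qed.

Lemma bdd_mfun_subitv M (i j : interval R) h : (j <= i)%O ->
  bdd_mfun M [set` i] h -> bdd_mfun M [set` j] h.
Proof.
move=> ji; apply: bdd_mfun_subset; first exact: leb_measurable_itv.
exact: (subitvP ji).
Qed.

Lemma Rintegral_itvcc_oc M h (p q s t : R) : bdd_mfun M `[p, q] h ->
  p <= s -> s <= t -> t <= q ->
  \int[mu]_(u in `[p, t]) h u =
  \int[mu]_(u in `[p, s]) h u + \int[mu]_(u in `]s, t]) h u.
Proof.
move=> hh ps st tq; rewrite (itvccU_oc ps st).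
apply: (@Rintegral_setU_bdd _ M); last exact: disjoint_itvcc_oc.
- by apply: bdd_mfun_subitv hh; rewrite subitvE !bnd_simp/= (le_trans st).
- by apply: bdd_mfun_subitv hh; rewrite subitvE !bnd_simp/= ps tq.
Qed.

Lemma Rintegral_itvco_cc M h (p q s t : R) : bdd_mfun M `[p, q] h ->
  p <= s -> s <= t -> t <= q ->
  \int[mu]_(u in `[s, q]) h u =
  \int[mu]_(u in `[s, t[) h u + \int[mu]_(u in `[t, q]) h u.
Proof.
move=> hh ps st tq; rewrite (itvcoU_cc st tq).
apply: (@Rintegral_setU_bdd _ M); last exact: disjoint_itvco_cc.
- by apply: bdd_mfun_subitv hh; rewrite subitvE !bnd_simp/= ps tq.
- by apply: bdd_mfun_subitv hh; rewrite subitvE !bnd_simp/= (le_trans ps).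
Qed.

Lemma Rintegral_cc0 M h (p q : R) : p <= q -> bdd_mfun M `[p, q] h ->
  \int[mu]_(u in `[p, p]) h u = 0 /\ \int[mu]_(u in `[q, q]) h u = 0.
Proof.
move=> pq hh; split; apply/eqP; rewrite -normr_eq0 eq_le normr_ge0 andbT.
- rewrite (@le_trans _ _ (M * fine (mu `[p, p])))//.
    by apply: le_norm_Rintegral; apply: bdd_mfun_subitv hh; rewrite subitvE !bnd_simp ?lexx ?pq.
  by rewrite fine_leb_itv// subrr mulr0.
- rewrite (@le_trans _ _ (M * fine (mu `[q, q])))//.
    by apply: le_norm_Rintegral; apply: bdd_mfun_subitv hh; rewrite subitvE !bnd_simp ?lexx ?pq.
  by rewrite fine_leb_itv// subrr mulr0.
Qed.

Local Notation F1 s := (\int[mu]_(u in `[a, s]) psi1 u).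
Local Notation F2 r := (\int[mu]_(u in `[r, b]) psi2 u).

Lemma mass1 s t : a <= s -> s <= t -> t <= a' ->
  F1 t - F1 s = \int[mu]_(u in `]s, t]) psi1 u.
Proof.
move=> as_ st ta'; have [M M0 [h1 _]] := weight_bounded.
by rewrite (Rintegral_itvcc_oc h1 as_ st ta') addrC addKr.
Qed.

Lemma mass2 s t : b' <= s -> s <= t -> t <= b ->
  F2 s - F2 t = \int[mu]_(u in `[s, t[) psi2 u.
Proof.
move=> bs st tb; have [M M0 [_ h2]] := weight_bounded.
by rewrite (Rintegral_itvco_cc h2 bs st tb) addrK.
Qed.

Lemma weight_subset_ae (i j : interval R) (psi : R -> R) : (j <= i)%O ->
  {ae mu, forall t, [set` i] t -> 0 < psi t} ->
  {ae mu, forall t, [set` j] t -> 0 < psi t}.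
Proof.
by move=> ji h; apply: leb_aeS h => t ht /(subitvP ji); exact: ht.
Qed.

Lemma weight_ae (i j : interval R) psi : weight [set` i] psi -> (j <= i)%O ->
  {ae mu, forall t, [set` j] t -> 0 < psi t}.
Proof.
by move=> [_ _ h] ji; exact: weight_subset_ae h.
Qed.

Lemma F1_lt s t : a <= s -> s < t -> t <= a' -> F1 s < F1 t.
Proof.
move=> as_ st ta'; rewrite -subr_gt0 mass1// ?(ltW st)//.
have ji : (`]s, t] <= `[a, a'])%O by rewrite subitvE !bnd_simp/= as_ ta'.
have [M M0 [h1 _]] := weight_bounded.
apply: (Rintegral_gt0 (bdd_mfun_subitv ji h1)); last exact: weight_ae hpsi1 ji.
by rewrite leb_itv/= lte_fin st -EFinB lte_fin subr_gt0.
Qed.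

Lemma F2_lt s t : b' <= s -> s < t -> t <= b -> F2 t < F2 s.
Proof.
move=> bs st tb; rewrite -subr_gt0 mass2// ?(ltW st)//.
have ji : (`[s, t[ <= `[b', b])%O by rewrite subitvE !bnd_simp/= bs tb.
have [M M0 [_ h2]] := weight_bounded.
apply: (Rintegral_gt0 (bdd_mfun_subitv ji h2)); last exact: weight_ae hpsi2 ji.
by rewrite leb_itv/= lte_fin st -EFinB lte_fin subr_gt0.
Qed.

Lemma F2_inj s t : b' <= s <= b -> b' <= t <= b -> F2 s = F2 t -> s = t.
Proof.
move=> /andP[as_ sa] /andP[at_ ta] E; case: (ltgtP s t) => // st.
- by have := F2_lt as_ st ta; rewrite E ltxx.
- by have := F2_lt at_ st sa; rewrite E ltxx.
Qed.

Lemma F_lipschitz : exists2 M, 0 <= M &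
  (forall s t, a <= s <= a' -> a <= t <= a' -> `|F1 s - F1 t| <= M * `|s - t|) /\
  (forall s t, b' <= s <= b -> b' <= t <= b -> `|F2 s - F2 t| <= M * `|s - t|).
Proof.
have [M M0 [h1 h2]] := weight_bounded; exists M => //; split => s t.
- wlog st : s t / s <= t => [hw sI tI|/andP[as_ sa] /andP[at_ ta]].
    case/orP: (le_total s t) => ?; first exact: hw.
    by rewrite distrC (distrC s); exact: hw.
  rewrite distrC mass1// distrC (ger0_norm (_ : 0 <= t - s)) ?subr_ge0//.
  rewrite -(fine_leb_itv false false st); apply: le_norm_Rintegral.
  by apply: bdd_mfun_subitv h1; rewrite subitvE !bnd_simp/= as_ ta.
- wlog st : s t / s <= t => [hw sI tI|/andP[as_ sa] /andP[at_ ta]].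
    case/orP: (le_total s t) => ?; first exact: hw.
    by rewrite distrC (distrC s); exact: hw.
  rewrite mass2// distrC (ger0_norm (_ : 0 <= t - s)) ?subr_ge0//.
  rewrite -(fine_leb_itv true true st); apply: le_norm_Rintegral.
  by apply: bdd_mfun_subitv h2; rewrite subitvE !bnd_simp/= as_ ta.
Qed.

Lemma F1a : F1 a = 0.
Proof.
by have [M M0 [h1 _]] := weight_bounded; have [] := Rintegral_cc0 (ltW haa') h1.
Qed.

Lemma F2b : F2 b = 0.
Proof.
by have [M M0 [_ h2]] := weight_bounded; have [] := Rintegral_cc0 (ltW hb'b) h2.
Qed.

Lemma F1a'E : F1 a' = F2 b'.
Proof. by rewrite /Rintegral hpsi. Qed.

(** The default of [xget] does not occur: [F2] is Lipschitz and falls from [F2 b' = F1 a'] to 0, so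
    it takes the value [F1 s]. *)
Lemma rho_spec s : a <= s <= a' -> b' <= rho s <= b /\ F1 s = F2 (rho s).
Proof.
move=> /andP[as_ sa]; have [M M0 [h1 h2]] := weight_bounded.
have e1 : (\int[mu]_(t in `[a, s]) (psi1 t)%:E = (F1 s)%:E)%E.
  apply: integral_bdd_mfun; apply: bdd_mfun_subitv h1.
  by rewrite subitvE !bnd_simp/= ?lexx ?sa.
have e2 r : r \in `[b', b] -> (\int[mu]_(t in `[r, b]) (psi2 t)%:E = (F2 r)%:E)%E.
  rewrite in_itv/= => /andP[br _]; apply: integral_bdd_mfun.
  by apply: bdd_mfun_subitv h2; rewrite subitvE !bnd_simp/= ?lexx ?br.
rewrite /Defs.rho sa e1; case: xgetP => [r _ [rI]|].
  by move=> E; move: (rI); rewrite in_itv/= => rI'; move: E; rewrite e2// => -[].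
have [L L0 [_ FL]] := F_lipschitz.
(* The intermediate value lemma is stated for an increase from left to right, so it is applied to
   [- F2]. *)
have FLN u v : b' <= u <= b -> b' <= v <= b -> `|- F2 u - - F2 v| <= L * `|u - v|.
  by move=> uI vI; rewrite opprK addrC distrC; exact: FL.
have [|r rI] := lipschitz_IVT (ltW hb'b) FLN (v := - F1 s).
  rewrite F2b !lerN2 -F1a'E; apply/andP; split.
    by have := sa; rewrite le_eqVlt => /predU1P[->//|/(F1_lt as_) h]; rewrite ltW// h.
  have := as_; rewrite le_eqVlt => /predU1P[<-|h]; first by rewrite F1a.
  by rewrite -F1a ltW// F1_lt.
move/oppr_inj => Fr /(_ r) []; split; first by rewrite in_itv.
by rewrite e2 ?in_itv// Fr.
Qed.

Lemma rho_uniq s r : a <= s <= a' -> b' <= r <= b -> F1 s = F2 r -> rho s = r.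
Proof.
move=> sI rI E; have [rhoI rhoE] := rho_spec sI.
by apply: F2_inj => //; rewrite -rhoE.
Qed.

(** At [s = a'] the definition uses the mass equation, not the reflection; the two agree there
    because the total masses are equal. *)
Lemma rho_mid s : a' <= s -> rho s = a' + b' - s.
Proof.
rewrite le_eqVlt => /predU1P[<-|as_].
  rewrite (@rho_uniq a' b')//; rewrite ?lexx ?(ltW haa') ?(ltW hb'b)//.
  - by rewrite addrC addKr.
  - exact: F1a'E.
by rewrite /Defs.rho leNgt as_.
Qed.

Lemma rho_a : rho a = b.
Proof.
by rewrite (@rho_uniq a b) ?lexx ?(ltW haa') ?(ltW hb'b)// F1a F2b.
Qed.

Lemma rho_c : rho c = c.
Proof. by move: ha'b' => ?; rewrite rho_mid; lra. Qed.

Lemma rho_mass s t : a <= s -> s <= t -> t <= a' ->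
  \int[mu]_(u in `]s, t]) psi1 u = \int[mu]_(u in `[rho t, rho s[) psi2 u.
Proof.
move=> as_ st ta.
have sI : a <= s <= a' by rewrite as_ (le_trans st).
have tI : a <= t <= a' by rewrite ta (le_trans as_).
have [rsI Es] := rho_spec sI; have [rtI Et] := rho_spec tI.
rewrite -mass1// -mass2 ?Es ?Et//; [by case/andP: rtI| |by case/andP: rsI].
rewrite leNgt; apply/negP => rst.
have := F2_lt _ rst _; rewrite -Es -Et.
case/andP: rsI => -> _; case/andP: rtI => _ -> /(_ isT isT).
apply/negP; rewrite -leNgt; have := st.
by rewrite le_eqVlt => /predU1P[->//|st']; rewrite ltW// F1_lt.
Qed.

Lemma rho_lt1 s t : a <= s -> s < t -> t <= a' -> rho t < rho s.
Proof.
move=> as_ st ta.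
have sI : a <= s <= a' by rewrite as_ (le_trans (ltW st)).
have tI : a <= t <= a' by rewrite ta (le_trans as_)// ltW.
have [/andP[bs sb] Es] := rho_spec sI; have [/andP[bt tb] Et] := rho_spec tI.
rewrite ltNge; apply/negP => rst.
have := F1_lt as_ st ta; apply/negP; rewrite -leNgt Es Et.
move: rst; rewrite le_eqVlt => /predU1P[->//|rst].
by rewrite ltW// F2_lt.
Qed.

Lemma rho_lt s t : a <= s -> s < t -> t <= c -> rho t < rho s.
Proof.
move: (haa') (ha'b') => ? ?.
move=> as_ st tc; have [ta|/ltW at_] := leP t a'; first exact: rho_lt1.
have [sa|/ltW a's] := leP s a'; last by rewrite !rho_mid//; lra.
rewrite (rho_mid at_); have [E|sa'] := eqVneq s a'.
  by rewrite E rho_mid//; lra.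
have := @rho_lt1 s a' as_; rewrite lt_neqAle sa' sa => /(_ isT (lexx _)).
rewrite (@rho_mid a')//; lra.
Qed.

Lemma rho_le s t : a <= s -> s <= t -> t <= c -> rho t <= rho s.
Proof.
move=> as_; rewrite le_eqVlt => /predU1P[->//|st tc].
by rewrite ltW// rho_lt.
Qed.

Lemma rho_itv s : a <= s <= c -> c <= rho s <= b.
Proof.
move=> /andP[as_ sc]; apply/andP; split.
  by rewrite -[leLHS]rho_c rho_le.
by rewrite -[leRHS]rho_a rho_le.
Qed.

Lemma rho_surj t : c <= t <= b -> exists2 s, a <= s <= c & rho s = t.
Proof.
move: (haa') (ha'b') => ? ?.
move=> /andP[ct tb]; have [tb'|/ltW b't] := leP t b'.
  by exists (a' + b' - t); [apply/andP; split; lra|rewrite rho_mid; lra].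
have [L L0 [FL _]] := F_lipschitz.
have [|s sI Es] := lipschitz_IVT (ltW haa') FL (v := F2 t).
  rewrite F1a F1a'E; apply/andP; split.
    by have := tb; rewrite le_eqVlt => /predU1P[->|h]; rewrite ?F2b// -F2b ltW// F2_lt.
  by have := b't; rewrite le_eqVlt => /predU1P[->//|h]; rewrite ltW// F2_lt.
exists s.
  case/andP: sI => -> sa; rewrite (le_trans sa)// ler_pdivlMr// mulr_natr.
  by rewrite mulr2n lerD2l.
by apply: rho_uniq => //; rewrite b't.
Qed.

Lemma rho_inj s t : a <= s <= c -> a <= t <= c -> rho s = rho t -> s = t.
Proof.
move=> /andP[as_ sc] /andP[at_ tc] E; case: (ltgtP s t) => // st.
- by have := rho_lt as_ st tc; rewrite E ltxx.
- by have := rho_lt at_ st sc; rewrite E ltxx.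
Qed.

Lemma rhoK s : a <= s <= c -> rho_inv (rho s) = s.
Proof.
move=> sI; rewrite /Defs.rho_inv pinvKV//; last by rewrite inE/= in_itv.
by move=> u v; rewrite !inE/= !in_itv/=; exact: rho_inj.
Qed.

Lemma rho_invK t : c <= t <= b -> rho (rho_inv t) = t.
Proof. by move=> /rho_surj[s sI <-]; rewrite rhoK. Qed.

Lemma rho_inv_itv t : c <= t <= b -> a <= rho_inv t <= c.
Proof. by move=> /rho_surj[s sI <-]; rewrite rhoK. Qed.

Lemma rho_inv_lt s t : c <= s -> s < t -> t <= b -> rho_inv t < rho_inv s.
Proof.
move=> cs st tb.
have sI : c <= s <= b by rewrite cs (le_trans (ltW st)).
have tI : c <= t <= b by rewrite tb (le_trans cs)// ltW.
rewrite ltNge; apply/negP => h.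
have /andP[as_ _] := rho_inv_itv sI; have /andP[_ tc] := rho_inv_itv tI.
by have := rho_le as_ h tc; rewrite !rho_invK// leNgt st.
Qed.

(** A strictly decreasing map of a segment onto a segment is continuous, so no estimate on the
    weights is required. The same argument serves [rho_inv]. *)
Lemma rho_continuous x e : a <= x <= c -> 0 < e -> exists2 d, 0 < d &
  forall y, a <= y <= c -> `|x - y| < d -> `|rho x - rho y| < e.
Proof.
move=> xI e0.
have /andP[ax xc] := xI.
have : {within `[a, c], continuous rho}.
  apply: segment_dec_surj_continuous.
  - move=> s t; rewrite !in_itv/= => /andP[as_ sc] /andP[at_ tc].
    apply/idP/idP => [|st]; last exact: rho_le.
    by apply: contraTT; rewrite -!ltNge => ts; exact: rho_lt.
  - move=> v /=; rewrite in_itv/= rho_a rho_c => /rho_surj[s sI Es].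
    by exists s; rewrite /= ?in_itv.
move/within_continuous_itvP => /(_ x _ e e0)[|d d0 hd]; first by rewrite in_itv.
by exists d => // y yI; apply: hd; rewrite in_itv.
Qed.

Lemma rho_inv_continuous : {within `[c, b], continuous rho_inv}.
Proof.
apply: segment_dec_surj_continuous.
- move=> s t; rewrite !in_itv/= => /andP[cs sb] /andP[ct tb].
  apply/idP/idP => [|]; last first.
    by rewrite le_eqVlt => /predU1P[->//|ts]; rewrite ltW// rho_inv_lt.
  by apply: contraTT; rewrite -!ltNge => ts; exact: rho_inv_lt.
- move=> s /=; rewrite in_itv/= -[X in rho_inv X <= _]rho_a.
  rewrite -[X in _ <= rho_inv X]rho_c !rhoK.
  - move=> sI; exists (rho s); last by rewrite rhoK.
    by rewrite /= in_itv/=; exact: rho_itv.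
  - by move: (haa') (ha'b') => ? ?; apply/andP; split; lra.
  - by move: (haa') (ha'b') => ? ?; apply/andP; split; lra.
Qed.

End Rearrangement.

(** * Transport along rho *)

Lemma nondecreasing_bdd_mfun (R : realType) (phi : R -> R) (p q : R) : p <= q ->
  {in `[p, q] &, {homo phi : s t / s <= t}} ->
  bdd_mfun (`|phi p| + `|phi q|) `[p, q] phi.
Proof.
move=> pq phi_nd.
split; [exact: leb_measurable_itv|exact: leb_itv_fin| |].
  exact: leb_nondecreasing_measurable.
move=> t /= tI; have /andP[pt tq] : p <= t <= q by rewrite in_itv/= in tI.
have h1 : phi p <= phi t by apply: phi_nd; rewrite ?in_itv/= ?lexx ?pq.
have h2 : phi t <= phi q by apply: phi_nd; rewrite ?in_itv/= ?lexx ?pq.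
have := ler_norm (phi q); have := ler_norm (- phi p); rewrite normrN => h3 h4.
have := normr_ge0 (phi q); have := normr_ge0 (phi p).
by rewrite ler_norml => h5 h6; apply/andP; split; lra.
Qed.

Section HclassIntegral.
Context {R : realType} {X : lspaceType R} (P : X -> X).
Hypothesis hP : convexifying P.
Local Notation mu := (leb R).
Variables (a b : R) (omega : R -> R) (f : R -> X).
Hypotheses (leab : a <= b) (homega : modulus_of_continuity omega).
Hypothesis hf : Hclass omega a b f.
Local Notation d x y := (@mdist R X x y).
Local Notation wint psi A := (Defs.integral P A (fun t => lscale (psi t) (f t))).

(** Shows that [integral] is not its default [theta] on maps of the class: they are bounded, through
    their value at [a], and uniformly continuous. *)
Lemma Hclass_integral N psi (i : interval R) : (i <= `[a, b])%O ->
  bdd_mfun N [set` i] psi ->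
  is_integral P [set` i] (P \o (fun t => lscale (psi t) (f t))) (wint psi [set` i]).
Proof.
move=> iab bpsi; have [mi fi _ _] := bpsi.
have ab t : t \in i -> t \in `[a, b] by move=> ti; exact: (subitvP iab).
suff [J HJ] : exists J, is_integral P [set` i]
    (P \o (fun t => lscale (psi t) (f t))) J.
  by rewrite (integralE hP mi fi HJ).
apply: (@is_integral_weight_exists _ _ _ hP N (`|a| + `|b|)
  (omega (b - a) + d (f a) theta) _ psi f bpsi).
- move=> t /ab; rewrite in_itv/= => /andP[at_ tb].
  have := ler_norm (- a); have := ler_norm b; rewrite normrN => h1 h2.
  have := normr_ge0 a; have := normr_ge0 b.
  by rewrite ler_norml => h3 h4; apply/andP; split; lra.
- move=> t /ab tI; rewrite (le_trans (metric_triangle _ (f a) _))// lerD2r.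
  rewrite (le_trans (hf tI _)) ?in_itv/= ?lexx//.
  rewrite in_itv/= in tI; case/andP: tI => at_ tb.
  by rewrite (modulus_le homega)// ger0_norm ?subr_ge0// lerD2r.
- move=> e e0; have [eta eta0 heta] := modulus_small homega e0.
  exists eta => // s t /ab sI /ab tI st; rewrite (le_trans (hf sI tI))//.
  exact: heta.
Qed.

Lemma Hclass_integral_setU N psi (i j k : interval R) : (k <= `[a, b])%O ->
  bdd_mfun N [set` k] psi -> (i <= k)%O -> (j <= k)%O ->
  [disjoint [set` i] & [set` j]] -> [set` k] = [set` i] `|` [set` j] ->
  wint psi [set` k] = ladd (wint psi [set` i]) (wint psi [set` j]).
Proof.
move=> kab bk ik jk ij kE; have [mk fk _ _] := bk.
apply: (integralE hP mk fk); rewrite kE; apply: is_integral_setU => //.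
- exact: Hclass_integral (le_trans ik kab) (bdd_mfun_subitv ik bk).
- exact: Hclass_integral (le_trans jk kab) (bdd_mfun_subitv jk bk).
Qed.

Lemma Hclass_integral_cell N psi (i : interval R) x e : (i <= `[a, b])%O ->
  bdd_mfun N [set` i] psi -> {ae mu, forall t, [set` i] t -> 0 < psi t} ->
  x \in `[a, b] -> (forall t, [set` i] t -> omega `|t - x| <= e) ->
  d (wint psi [set` i]) (lscale (\int[mu]_(t in [set` i]) psi t) (P (f x))) <=
  N * e * fine (mu [set` i]).
Proof.
move=> iab bpsi psi0 xI he.
apply: (weighted_integral_cell hP bpsi psi0 (Hclass_integral iab bpsi)).
move=> t ti; rewrite (le_trans (convexifying_lip hP _ _))//.
rewrite (le_trans (hf _ xI)) ?he//; exact: (subitvP iab).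
Qed.

Lemma Hclass_integral_cc0 N psi x : x \in `[a, b] ->
  bdd_mfun N `[x, x] psi -> {ae mu, forall t, `[x, x]%classic t -> 0 < psi t} ->
  wint psi `[x, x] = theta.
Proof.
move=> xab bpsi psi0.
have iab : (`[x, x] <= `[a, b])%O.
  by rewrite in_itv/= in xab; rewrite subitvE !bnd_simp/=.
apply/mdist_positivity/eqP; rewrite eq_le mdist_ge0 andbT.
have := Hclass_integral_cell iab bpsi psi0 xab (e := 0).
rewrite (Rintegral_cc0 (lexx x) bpsi).1 lscale0 fine_leb_itv// subrr mulr0; apply.
move=> t; rewrite /= in_itv/= -eq_le => /eqP <-.
by rewrite subrr normr0 (modulus0 homega).
Qed.

End HclassIntegral.

Section Transport.
Context {R : realType} (a a' b' b M : R) (psi1 psi2 rho : R -> R).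
Local Notation mu := (leb R).
Local Notation LT := (lebesgue_type R).
Hypotheses (aa' : a <= a') (a'b' : a' <= b') (b'b : b' <= b).
Hypotheses (bpsi1 : bdd_mfun M `[a, a'] psi1) (bpsi2 : bdd_mfun M `[b', b] psi2).
Hypotheses (rho_a : rho a = b) (rho_a' : rho a' = b').
Hypothesis rho_le : forall s t, a <= s -> s <= t -> t <= a' -> rho t <= rho s.
Hypothesis rho_cont : forall x e, a <= x <= a' -> 0 < e -> exists2 d, 0 < d &
  forall y, a <= y <= a' -> `|x - y| < d -> `|rho x - rho y| < e.
Hypothesis rho_mass : forall s t, a <= s -> s <= t -> t <= a' ->
  \int[mu]_(u in `]s, t]) psi1 u = \int[mu]_(u in `[rho t, rho s[) psi2 u.

Lemma rho_bounds s : a <= s <= a' -> b' <= rho s <= b.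
Proof.
move=> /andP[as_ sa]; apply/andP; split.
  by rewrite -[leLHS]rho_a' rho_le.
by rewrite -[leRHS]rho_a rho_le.
Qed.

(** Smallness on the cell and on its image at once: a point [v] of the image lies between [rho t]
    and [rho s], both close to [rho x] by continuity. *)
Lemma rho_local x e : a <= x <= a' -> 0 < e -> exists2 d, 0 < d &
  forall s t, a <= s -> s <= x -> x <= t -> t <= a' -> t - s < d ->
  (forall u, s <= u -> u <= t -> `|u - x| < e /\ `|rho u - rho x| < e) /\
  (forall v, rho t <= v -> v <= rho s -> `|v - rho x| < e).
Proof.
move=> xI e0; have [d d0 hd] := rho_cont xI e0.
exists (Num.min d e); first by rewrite lt_min d0.
move=> s t as_ sx xt ta; rewrite lt_min => /andP[tsd tse].
have hu u : s <= u -> u <= t -> `|u - x| < e /\ `|rho u - rho x| < e.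
  move=> su ut; split; first by rewrite ltr_norml; apply/andP; split; lra.
  rewrite distrC; apply: hd; first by rewrite (le_trans as_ su) (le_trans ut ta).
  by rewrite ltr_norml; apply/andP; split; lra.
split=> // v tv vs.
have st := le_trans sx xt.
have [_ h1] := hu s (lexx _) st; have [_ h2] := hu t st (lexx _).
move: h1 h2; rewrite !ltr_norml => /andP[_ h1] /andP[h2 _].
by apply/andP; split; lra.
Qed.

(** The difference [J (rho s) - I s] is shown to be constant in [s]: on a small cell [phi] is frozen
    at [phi (rho x)], and the masses of the cell and of its image coincide. Monotonicity of [phi]
    supplies bounds and measurability of [phi] and of its composition with [rho]. *)
Lemma change_of_variables phi : {in `[b', b] &, {homo phi : s t / s <= t}} ->
  {within `[b', b], continuous phi} ->
  \int[mu]_(t in `[b', b]) (psi2 t * phi t) =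
  \int[mu]_(s in `[a, a']) (psi1 s * phi (rho s)).
Proof.
move=> phi_nd /within_continuous_itvP phi_cont.
have rI s : a <= s <= a' -> rho s \in `[b', b] by move=> /rho_bounds; rewrite in_itv.
pose N := `|phi b'| + `|phi b|.
have bphi : bdd_mfun N `[b', b] phi by exact: nondecreasing_bdd_mfun.
have phiN t : t \in `[b', b] -> `|phi t| <= N by case: bphi => _ _ _; exact.
have bphir : bdd_mfun N `[a, a'] (phi \o rho).
  split; [exact: leb_measurable_itv|exact: leb_itv_fin| |].
    apply: leb_nonincreasing_measurable => s t sI tI st /=.
    rewrite in_itv/= in sI; rewrite in_itv/= in tI.
    apply: phi_nd; [exact: rI|exact: rI|].
    by case/andP: sI => _ sa; case/andP: tI => at_ _; exact: rho_le.
  by move=> t; rewrite /= in_itv/= => tI; apply: phiN; exact: rI.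
have b1 := bdd_mfunM bpsi1 bphir; have b2 := bdd_mfunM bpsi2 bphi.
pose J r := \int[mu]_(t in `[r, b]) (psi2 t * phi t).
pose I s := \int[mu]_(t in `[a, s]) (psi1 t * phi (rho t)).
(* The increment of [m] is [M] times the length of the cell plus the length of its image, which is
   the sum of the two cell errors divided by [e]. *)
pose m s := M * (s - rho s).
have loc e x : 0 < e -> a <= x <= a' -> exists2 d, 0 < d & forall s t,
    a <= s -> s <= x -> x <= t -> t <= a' -> t - s < d ->
    `|(J (rho t) - I t) - (J (rho s) - I s)| <= e * (m t - m s).
  move=> e0 xI; have [eta eta0 heta] := phi_cont _ (rI _ xI) _ e0.
  have [d d0 hd] := rho_local xI eta0; exists d => // s t as_ sx xt ta tsd.
  have [hu hv] := hd s t as_ sx xt ta tsd.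
  have st := le_trans sx xt.
  have sI : a <= s <= a' by rewrite as_ (le_trans st).
  have tI : a <= t <= a' by rewrite ta (le_trans as_).
  have /andP[bs sb] := rho_bounds sI; have /andP[bt tb] := rho_bounds tI.
  have rst := rho_le as_ st ta.
  have -> : J (rho t) = \int[mu]_(u in `[rho t, rho s[) (psi2 u * phi u) + J (rho s).
    exact: (Rintegral_itvco_cc b2 bt rst sb).
  have -> : I t = I s + \int[mu]_(u in `]s, t]) (psi1 u * phi (rho u)).
    exact: (Rintegral_itvcc_oc b1 as_ st ta).
  have i1 : (`]s, t] <= `[a, a'])%O by rewrite subitvE !bnd_simp/= as_ ta.
  have i2 : (`[rho t, rho s[ <= `[b', b])%O by rewrite subitvE !bnd_simp/= bt sb.
  have e1 : `|\int[mu]_(u in `]s, t]) (psi1 u * phi (rho u)) -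
      phi (rho x) * \int[mu]_(u in `]s, t]) psi1 u| <= M * e * (t - s).
    rewrite -(fine_leb_itv false false st).
    apply: (Rintegral_cell (bdd_mfun_subitv i1 bpsi1) (bdd_mfun_subitv i1 bphir)).
    move=> u; rewrite /= in_itv/= => /andP[su ut].
    have [_ hux] := hu u (ltW su) ut; rewrite distrC; apply/ltW/heta.
      by apply: rI; rewrite (le_trans as_ (ltW su)) (le_trans ut ta).
    by rewrite distrC.
  have e2 : `|\int[mu]_(u in `[rho t, rho s[) (psi2 u * phi u) -
      phi (rho x) * \int[mu]_(u in `[rho t, rho s[) psi2 u| <= M * e * (rho s - rho t).
    rewrite -(fine_leb_itv true true rst).
    apply: (Rintegral_cell (bdd_mfun_subitv i2 bpsi2) (bdd_mfun_subitv i2 bphi)).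
    move=> v; rewrite /= in_itv/= => /andP[tv vs].
    rewrite distrC; apply/ltW/heta.
      by rewrite in_itv/= (le_trans bt tv) (le_trans (ltW vs) sb).
    by rewrite distrC; apply: hv => //; exact: ltW.
  rewrite rho_mass// in e1.
  have -> : e * (m t - m s) = M * e * (t - s) + M * e * (rho s - rho t).
    by rewrite /m; ring.
  set A1 := \int[mu]_(u in `]s, t]) _ in e1 *.
  set A2 := \int[mu]_(u in `[rho t, rho s[) (_ * _) in e2 *.
  set m2 := \int[mu]_(u in _) _ in e1 e2.
  have -> : A2 + J (rho s) - (I s + A1) - (J (rho s) - I s) =
      (A2 - phi (rho x) * m2) - (A1 - phi (rho x) * m2) by ring.
  by rewrite (le_trans (ler_normB _ _))// addrC lerD.
have I0 : I a = 0 by have [] := Rintegral_cc0 aa' b1.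
have J0 : J (rho a) = 0 by rewrite rho_a; have [] := Rintegral_cc0 b'b b2.
have up : J (rho a') - I a' <= J (rho a) - I a.
  apply: (@local_to_global _ (fun s => J (rho s) - I s) m _ _ aa') => e x e0 xI.
  have [d d0 hd] := loc e x e0 xI; exists d => // s t as_ sx xt ta tsd.
  exact: (le_trans (ler_norm _) (hd s t as_ sx xt ta tsd)).
have lo : - (J (rho a') - I a') <= - (J (rho a) - I a).
  apply: (@local_to_global _ (fun s => - (J (rho s) - I s)) m _ _ aa') => e x e0 xI.
  have [d d0 hd] := loc e x e0 xI; exists d => // s t as_ sx xt ta tsd.
  rewrite -opprD (le_trans (ler_norm _))// normrN.
  exact: hd.
rewrite -[LHS]/(J b') -[RHS]/(I a') -rho_a'; move: up lo; rewrite I0 J0.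
lra.
Qed.

Lemma rho_sub_ge0 s : a <= s <= a' -> 0 <= rho s - s.
Proof.
move=> sI; have /andP[bs _] := rho_bounds sI; case/andP: sI => _ sa.
by rewrite subr_ge0 (le_trans sa)// (le_trans a'b').
Qed.

Lemma bdd_mfun_modulus_rho omega : modulus_of_continuity omega ->
  bdd_mfun (omega (b - a)) `[a, a'] (fun s => omega (rho s - s)).
Proof.
move=> homega.
have D_le s t : a <= s -> s <= t -> t <= a' -> rho t - t <= rho s - s.
  by move=> as_ st ta; rewrite lerB// rho_le.
split; [exact: leb_measurable_itv|exact: leb_itv_fin| |].
  apply: leb_nonincreasing_measurable => s t sI tI st.
  rewrite in_itv/= in sI; rewrite in_itv/= in tI.
  apply: (modulus_le homega); first exact: rho_sub_ge0.
  by case/andP: sI => _ sa; case/andP: tI => at_ _; exact: D_le.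
move=> t; rewrite /= in_itv/= => tI.
rewrite ger0_norm; last by apply: (modulus_ge0 homega); exact: rho_sub_ge0.
apply: (modulus_le homega); first exact: rho_sub_ge0.
by case/andP: tI => at_ ta; rewrite -rho_a D_le.
Qed.

Section Vector.
Context {X : lspaceType R} (P : X -> X).
Hypothesis hP : convexifying P.
Variables (omega : R -> R) (f : R -> X).
Hypothesis homega : modulus_of_continuity omega.
Hypothesis hf : Hclass omega a b f.
Local Notation d x y := (@mdist R X x y).
Local Notation wint psi A := (Defs.integral P A (fun t => lscale (psi t) (f t))).

Hypothesis psi10 : {ae mu, forall t, `[a, a']%classic t -> 0 < psi1 t}.
Hypothesis psi20 : {ae mu, forall t, `[b', b]%classic t -> 0 < psi2 t}.

(** As [s] grows, the distance between the integrals over [[a, s]] and [[rho s, b]] grows at most as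
    fast as [Q s]. At [s = a] everything vanishes, at [s = a'] the full integrals appear. *)
Lemma deviation_bound :
  d (wint psi1 `[a, a']) (wint psi2 `[b', b]) <=
  \int[mu]_(s in `[a, a']) (psi1 s * omega (rho s - s)).
Proof.
pose D s := rho s - s.
have D_ge0 s : a <= s <= a' -> 0 <= D s by exact: rho_sub_ge0.
have bomD : bdd_mfun (omega (b - a)) `[a, a'] (fun s => omega (D s)).
  exact: bdd_mfun_modulus_rho.
have bprod := bdd_mfunM bpsi1 bomD.
have leab : a <= b by rewrite (le_trans aa')// (le_trans a'b').
pose I s := wint psi1 `[a, s]; pose J r := wint psi2 `[r, b].
pose Q s := \int[mu]_(u in `[a, s]) (psi1 u * omega (D u)).
(* The coefficient 2 accounts for two errors on []s, t]], of the vector integral and of [Q]; the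
   image interval contributes one. *)
pose m s := M * (2 * s - rho s).
have i1 : (`[a, a'] <= `[a, b])%O.
  by rewrite subitvE !bnd_simp/= ?lexx (le_trans a'b').
have i2 : (`[b', b] <= `[a, b])%O.
  by rewrite subitvE !bnd_simp/= ?lexx (le_trans aa').
have loc e x : 0 < e -> a <= x <= a' -> exists2 del, 0 < del & forall s t,
    a <= s -> s <= x -> x <= t -> t <= a' -> t - s < del ->
    (d (I t) (J (rho t)) - Q t) - (d (I s) (J (rho s)) - Q s) <= e * (m t - m s).
  move=> e0 xI; have [eta eta0 heta] := modulus_small homega e0.
  (* Half of [eta], since [D u - D x] collects the variation of [u] and that of [rho u]. *)
  have eta20 : 0 < eta / 2 by rewrite divr_gt0.
  have eta2 : eta / 2 < eta by rewrite ltr_pdivrMr// ltr_pMr// ltr1n.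
  have [del del0 hdel] := rho_local xI eta20.
  exists del => // s t as_ sx xt ta tsd.
  have [hu hv] := hdel s t as_ sx xt ta tsd.
  have st := le_trans sx xt.
  have sI : a <= s <= a' by rewrite as_ (le_trans st).
  have tI : a <= t <= a' by rewrite ta (le_trans as_).
  have /andP[bs sb] := rho_bounds sI; have /andP[bt tb] := rho_bounds tI.
  have /andP[bx xb] := rho_bounds xI; have /andP[ax xa] := xI.
  have rst := rho_le as_ st ta.
  have j1 : (`]s, t] <= `[a, a'])%O by rewrite subitvE !bnd_simp/= as_ ta.
  have j2 : (`[rho t, rho s[ <= `[b', b])%O by rewrite subitvE !bnd_simp/= bt sb.
  have at1 : (`[a, t] <= `[a, a'])%O by rewrite subitvE !bnd_simp/= ?lexx ta.
  have tb2 : (`[rho t, b] <= `[b', b])%O by rewrite subitvE !bnd_simp/= ?lexx bt.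
  have IE : I t = ladd (I s) (wint psi1 `]s, t]).
    apply: (Hclass_integral_setU hP leab homega hf (le_trans at1 i1) (bdd_mfun_subitv at1 bpsi1)).
    - by rewrite subitvE !bnd_simp/= ?lexx.
    - by rewrite subitvE !bnd_simp/= ?lexx as_.
    - exact: disjoint_itvcc_oc.
    - exact: itvccU_oc.
  have JE : J (rho t) = ladd (J (rho s)) (wint psi2 `[rho t, rho s[).
    rewrite laddC.
    apply: (Hclass_integral_setU hP leab homega hf (le_trans tb2 i2) (bdd_mfun_subitv tb2 bpsi2)).
    - by rewrite subitvE !bnd_simp/= ?lexx.
    - by rewrite subitvE !bnd_simp/= ?lexx rst.
    - exact: disjoint_itvco_cc.
    - exact: itvcoU_cc.
  have QE : Q t = Q s + \int[mu]_(u in `]s, t]) (psi1 u * omega (D u)).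
    exact: (Rintegral_itvcc_oc bprod as_ st ta).
  have ae1 := weight_subset_ae j1 psi10; have ae2 := weight_subset_ae j2 psi20.
  have c1 : d (wint psi1 `]s, t])
      (lscale (\int[mu]_(u in `]s, t]) psi1 u) (P (f x))) <= M * e * (t - s).
    rewrite -(fine_leb_itv false false st).
    apply: (Hclass_integral_cell hP leab homega hf (le_trans j1 i1) (bdd_mfun_subitv j1 bpsi1) ae1).
      by rewrite in_itv/= ax (le_trans xa)// (le_trans a'b').
    move=> u; rewrite /= in_itv/= => /andP[su ut]; apply: heta => //.
    exact: lt_trans (hu u (ltW su) ut).1 eta2.
  have c2 : d (wint psi2 `[rho t, rho s[)
      (lscale (\int[mu]_(u in `[rho t, rho s[) psi2 u) (P (f (rho x)))) <=
      M * e * (rho s - rho t).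
    rewrite -(fine_leb_itv true true rst).
    apply: (Hclass_integral_cell hP leab homega hf (le_trans j2 i2) (bdd_mfun_subitv j2 bpsi2) ae2).
      by rewrite in_itv/= xb andbT (le_trans aa')// (le_trans a'b').
    move=> u; rewrite /= in_itv/= => /andP[su ut]; apply: heta => //.
    exact: lt_trans (hv u su (ltW ut)) eta2.
  have c3 : `|\int[mu]_(u in `]s, t]) (psi1 u * omega (D u)) -
      omega (D x) * \int[mu]_(u in `]s, t]) psi1 u| <= M * e * (t - s).
    rewrite -(fine_leb_itv false false st).
    apply: (Rintegral_cell (bdd_mfun_subitv j1 bpsi1) (bdd_mfun_subitv j1 bomD)).
    move=> u; rewrite /= in_itv/= => /andP[su ut].
    have uI : a <= u <= a' by rewrite (le_trans as_ (ltW su)) (le_trans ut ta).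
    rewrite (le_trans (modulus_sub homega (D_ge0 _ uI) (D_ge0 _ xI)))//.
    apply: heta => //; have [h1 h2] := hu u (ltW su) ut.
    rewrite /D (_ : _ - _ = (rho u - rho x) - (u - x)); last by ring.
    by rewrite (le_lt_trans (ler_normB _ _))// [ltRHS]splitr ltrD.
  rewrite rho_mass// in c1 c3.
  (* Both frozen integrals now carry the same coefficient, so homogeneity of the metric bounds their
     distance by [mass * omega (D x)]. *)
  set mass := \int[mu]_(u in `[rho t, rho s[) psi2 u in c1 c2 c3.
  have mass0 : 0 <= mass.
    exact: Rintegral_ge0_ae (bdd_mfun_subitv j2 bpsi2) ae2.
  have c4 : d (lscale mass (P (f x))) (lscale mass (P (f (rho x)))) <=
      omega (D x) * mass.
    rewrite mdist_lscale ger0_norm// mulrC ler_wpM2r//.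
    rewrite (le_trans (convexifying_lip hP _ _))// (le_trans (hf _ _))//.
    - by rewrite in_itv/= ax (le_trans xa)// (le_trans a'b').
    - by rewrite in_itv/= xb andbT (le_trans aa')// (le_trans a'b').
    - by rewrite distrC ger0_norm//; exact: D_ge0.
  have c5 : d (I t) (J (rho t)) <= d (I s) (J (rho s)) +
      d (wint psi1 `]s, t]) (wint psi2 `[rho t, rho s[).
    by rewrite IE JE; exact: mdist_ladd2.
  have c6 := metric_triangle (wint psi1 `]s, t]) (lscale mass (P (f x)))
    (wint psi2 `[rho t, rho s[).
  have c7 := metric_triangle (lscale mass (P (f x)))
    (lscale mass (P (f (rho x)))) (wint psi2 `[rho t, rho s[).
  rewrite (metric_sym (lscale mass (P (f (rho x))))) in c7.
  move: c3; rewrite ler_norml => /andP[c3 _].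
  rewrite lerBrDr addrC lerBlDr in c3.
  have c8 := le_trans c6 (lerD c1 (le_trans c7 (lerD c4 c2))).
  rewrite QE.
  have -> : e * (m t - m s) = 2 * (M * e * (t - s)) + M * e * (rho s - rho t).
    by rewrite /m; ring.
  set Qst := \int[mu]_(u in `]s, t]) _ in c3 *.
  have -> : d (I t) (J (rho t)) - (Q s + Qst) - (d (I s) (J (rho s)) - Q s) =
      d (I t) (J (rho t)) - d (I s) (J (rho s)) - Qst by ring.
  rewrite lerBlDr lerBlDl (le_trans c5)// lerD2l (le_trans c8)//.
  rewrite (_ : _ + _ + Qst = M * e * (t - s) +
    (Qst + M * e * (t - s) + M * e * (rho s - rho t))); last by ring.
  by rewrite lerD2l lerD2r.
have up : d (I a') (J (rho a')) - Q a' <= d (I a) (J (rho a)) - Q a.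
  exact: (@local_to_global _ (fun s => d (I s) (J (rho s)) - Q s) m _ _ aa' loc).
have Ia : I a = theta.
  have ja : (`[a, a] <= `[a, a'])%O by rewrite subitvE !bnd_simp/= ?lexx.
  apply: (Hclass_integral_cc0 hP leab homega hf _ (bdd_mfun_subitv ja bpsi1)).
    by rewrite in_itv/= lexx.
  exact: weight_subset_ae ja psi10.
have Jb : J (rho a) = theta.
  have jb : (`[b, b] <= `[b', b])%O by rewrite subitvE !bnd_simp/= ?lexx b'b.
  rewrite rho_a; apply: (Hclass_integral_cc0 hP leab homega hf _ (bdd_mfun_subitv jb bpsi2)).
    by rewrite in_itv/= lexx andbT.
  exact: weight_subset_ae jb psi20.
have Qa : Q a = 0 by have [] := Rintegral_cc0 aa' bprod.
by move: up; rewrite Ia Jb Qa rho_a' mdistxx subr0 subr_le0.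
Qed.

End Vector.
End Transport.

(** * Integrals of lifted real functions *)

Section Lift.
Context {R : realType} {X : lspaceType R}.
Local Notation d x y := (@mdist R X x y).
Variable x : X.
Hypotheses (cx : convex_elt X x) (ix : inv_elt X x).

Definition lift (v : R) : X :=
  ladd (lscale (Num.max v 0) x) (lscale (Num.max (- v) 0) (linv x)).

Lemma lift_atE (u : R -> R) t : lift_at u x t = lift (u t).
Proof. by []. Qed.

Let G A B := ladd (lscale A x) (lscale B (linv x)).

Let GD A B A' B' : 0 <= A -> 0 <= B -> 0 <= A' -> 0 <= B' ->
  G (A + A') (B + B') = ladd (G A B) (G A' B').
Proof.
by move=> A0 B0 A'0 B'0; rewrite /G cx// (convex_linv cx ix)// laddACA.
Qed.

Let Gdiag C : G C C = theta.
Proof. by rewrite /G -lscaleDr linvP// lscale_theta. Qed.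

(** [G A B] depends on the difference [A - B] alone: the diagonal terms [G C C] vanish and can be
    added freely as long as all coefficients are nonnegative. This is what makes [lift] additive. *)
Let G_diff A B A' B' : 0 <= A -> 0 <= B -> 0 <= A' -> 0 <= B' ->
  A + B' = A' + B -> G A B = G A' B'.
Proof.
move=> A0 B0 A'0 B'0 E.
rewrite -(ladd0 (G A B)) -(Gdiag B') -GD// E (addrC B).
by rewrite GD// Gdiag ladd0.
Qed.

Lemma liftD v w : lift (v + w) = ladd (lift v) (lift w).
Proof.
have m0 z : 0 <= Num.max z 0 :> R by rewrite le_max lexx orbT.
have mE (z : R) : Num.max z 0 - Num.max (- z) 0 = z.
  by case: (leP z 0) => z0; [rewrite max_l ?oppr_ge0|rewrite max_r ?oppr_le0 ?(ltW z0)]; lra.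
rewrite -GD//; apply: G_diff; rewrite ?addr_ge0//.
by have := mE v; have := mE w; have := mE (v + w); lra.
Qed.

Lemma lift0 : lift 0 = theta.
Proof. by rewrite /lift oppr0 maxxx !lscale0 ladd0. Qed.

Lemma lift_pos v : 0 <= v -> lift v = lscale v x.
Proof.
by move=> v0; rewrite /lift max_l// max_r ?oppr_le0// lscale0 ladd0.
Qed.

Lemma lscale_lift (k v : R) : 0 <= k -> lscale k (lift v) = lift (k * v).
Proof.
move=> k0; rewrite /lift lscaleDr !lscaleA.
have kmax z : k * Num.max z 0 = Num.max (k * z) 0 by rewrite maxr_pMr// mulr0.
by rewrite !kmax mulrN.
Qed.

Lemma convex_lift v : convex_elt X (lift v).
Proof.
apply: convex_ladd; apply: convex_lscale => //.
exact: convex_linv.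
Qed.

Hypotheses (iX : isotropic X) (x1 : d x theta = 1).

Lemma mdist_lift v w : d (lift v) (lift w) = `|v - w|.
Proof.
wlog wv : v w / w <= v => [hw|].
  by case/orP: (le_total w v) => ?; [|rewrite metric_sym distrC]; exact: hw.
(* Isotropy cancels the common summand [lift w]. *)
rewrite -{1}(subrK w v) liftD -[X in d _ X](ladd0l (lift w)) iX.
by rewrite lift_pos ?subr_ge0// mdist_lscale_theta x1 mulr1.
Qed.

Variables (P : X -> X) (a b : R) (omega : R -> R) (u : R -> R) (y : X).
Hypotheses (hP : convexifying P) (homega : modulus_of_continuity omega).
Hypothesis hu : forall s t, a <= s <= b -> a <= t <= b ->
  `|u s - u t| <= omega `|s - t|.
Local Notation mu := (leb R).
Let f t := ladd (lift_at u x t) y.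
Local Notation wint psi A := (Defs.integral P A (fun t => lscale (psi t) (f t))).

Lemma Hclass_lift : Hclass omega a b f.
Proof.
move=> s t; rewrite !in_itv/= => sI tI.
by rewrite /f iX !lift_atE mdist_lift hu.
Qed.

(** Reduces the vector integral to real ones. Instead of a linearity theorem, the distance between
    the two sides over [[p, s]] is followed in [s]: each cell is frozen at [f z], where the identity
    is pure algebra in [X]. *)
Lemma lift_integral M N psi p q : a <= p -> p <= q -> q <= b ->
  bdd_mfun M `[p, q] psi -> bdd_mfun N `[p, q] u ->
  {ae mu, forall t, `[p, q]%classic t -> 0 < psi t} ->
  wint psi `[p, q] = ladd (lift (\int[mu]_(t in `[p, q]) (psi t * u t)))
    (lscale (\int[mu]_(t in `[p, q]) psi t) (P y)).
Proof.
move=> ap pq qb bpsi bu psi0.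
have leab : a <= b by rewrite (le_trans ap)// (le_trans pq).
have bprod := bdd_mfunM bpsi bu.
have hf := Hclass_lift.
have ipq : (`[p, q] <= `[a, b])%O by rewrite subitvE !bnd_simp/= ap qb.
pose I s := wint psi `[p, s].
pose U s := \int[mu]_(t in `[p, s]) (psi t * u t).
pose m s := \int[mu]_(t in `[p, s]) psi t.
pose V s := ladd (lift (U s)) (lscale (m s) (P y)).
have m_ge0 s : p <= s -> s <= q -> 0 <= m s.
  move=> ps sq; have j : (`[p, s] <= `[p, q])%O.
    by rewrite subitvE !bnd_simp/= ?lexx sq.
  exact: Rintegral_ge0_ae (bdd_mfun_subitv j bpsi) (weight_subset_ae j psi0).
suff : d (I q) (V q) <= d (I p) (V p).
  have bp : (`[p, p] <= `[p, q])%O by rewrite subitvE !bnd_simp/= ?lexx.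
  have -> : I p = theta.
    apply: (Hclass_integral_cc0 hP leab homega hf _ (bdd_mfun_subitv bp bpsi)).
      by rewrite in_itv/= ap (le_trans pq).
    exact: weight_subset_ae bp psi0.
  have -> : V p = theta.
    rewrite /V /U /m (Rintegral_cc0 pq bprod).1 (Rintegral_cc0 pq bpsi).1.
    by rewrite lift0 lscale0 ladd0.
  rewrite mdistxx => IV; apply: mdist_positivity.
  by apply/eqP; rewrite eq_le mdist_ge0 IV.
(* The factor 2 covers two cell errors, of the vector integral and of the real integral of
   [psi * u]. *)
apply: (@local_to_global _ (fun s => d (I s) (V s)) (fun s => 2 * M * s) _ _ pq).
move=> e z e0 zI; have [eta eta0 heta] := modulus_small homega e0.
exists eta => // s t ps sz zt tq ts.
have st := le_trans sz zt; have /andP[pz zq] := zI.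
have j1 : (`]s, t] <= `[p, q])%O by rewrite subitvE !bnd_simp/= ps tq.
have pt : (`[p, t] <= `[p, q])%O by rewrite subitvE !bnd_simp/= ?lexx tq.
have ztI : z \in `[a, b] by rewrite in_itv/= (le_trans ap)// (le_trans zq).
set I' := wint psi `]s, t].
set U' := \int[mu]_(t in `]s, t]) (psi t * u t).
set m' := \int[mu]_(t in `]s, t]) psi t.
have m'0 : 0 <= m'.
  exact: Rintegral_ge0_ae (bdd_mfun_subitv j1 bpsi) (weight_subset_ae j1 psi0).
have IE : I t = ladd (I s) I'.
  apply: (Hclass_integral_setU hP leab homega hf (le_trans pt ipq)
    (bdd_mfun_subitv pt bpsi)).
  - by rewrite subitvE !bnd_simp/= ?lexx.
  - by rewrite subitvE !bnd_simp/= ?lexx ps.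
  - exact: disjoint_itvcc_oc.
  - exact: itvccU_oc.
have UE : U t = U s + U' by exact: (Rintegral_itvcc_oc bprod ps st tq).
have mE : m t = m s + m' by exact: (Rintegral_itvcc_oc bpsi ps st tq).
have VE : V t = ladd (V s) (ladd (lift U') (lscale m' (P y))).
  have ms0 : 0 <= m s by apply: m_ge0 => //; exact: le_trans st tq.
  by rewrite /V UE mE liftD (convexifying_convex hP y ms0 m'0) laddACA.
have near v : s < v -> v <= t -> omega `|v - z| <= e.
  move=> sv vt; apply: heta => //.
  exact: (dist_between sz zt (ltW sv) vt ts).
have c1 : d I' (lscale m' (P (f z))) <= M * e * (t - s).
  rewrite -(fine_leb_itv false false st).
  apply: (Hclass_integral_cell hP leab homega hf (le_trans j1 ipq)
    (bdd_mfun_subitv j1 bpsi) (weight_subset_ae j1 psi0) ztI).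
  by move=> v; rewrite /= in_itv/= => /andP[sv vt]; exact: near.
have c2 : `|U' - u z * m'| <= M * e * (t - s).
  rewrite -(fine_leb_itv false false st).
  apply: (Rintegral_cell (bdd_mfun_subitv j1 bpsi) (bdd_mfun_subitv j1 bu)).
  move=> v; rewrite /= in_itv/= => /andP[sv vt].
  have vI : a <= v <= b.
    by rewrite (le_trans ap (le_trans ps (ltW sv))) (le_trans vt (le_trans tq qb)).
  have zI' : a <= z <= b by rewrite in_itv/= in ztI.
  exact: le_trans (hu vI zI') (near v sv vt).
have c3 : d (lscale m' (P (f z))) (ladd (lift U') (lscale m' (P y))) =
    `|m' * u z - U'|.
  rewrite (convexifying_ladd hP) lift_atE (convexifying_id hP (convex_lift _)).
  by rewrite lscaleDr iX lscale_lift// mdist_lift.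
have c4 := metric_triangle I' (lscale m' (P (f z)))
  (ladd (lift U') (lscale m' (P y))).
have c5 : d (I t) (V t) <= d (I s) (V s) + d I' (ladd (lift U') (lscale m' (P y))).
  by rewrite IE VE; exact: mdist_ladd2.
rewrite distrC mulrC in c2; rewrite c3 in c4.
have -> : e * (2 * M * t - 2 * M * s) = 2 * (M * e * (t - s)) by ring.
by rewrite lerBlDl (le_trans c5)// lerD2l (le_trans c4)// mulr_natl mulr2n lerD.
Qed.

End Lift.

(** * Concave moduli *)

Section IntegrableSplit.
Context {R : realType}.
Local Notation mu := (leb R).
Local Notation LT := (lebesgue_type R).
Implicit Types (h w : R -> R).

(** For integrands that are integrable but possibly unbounded, as slopes of [omega] near 0 are. *)
Lemma Rintegral_itvcc_cc h (p q r : R) : p <= q -> q <= r ->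
  mu.-integrable (`[p, r]%classic : set LT) (EFin \o h) ->
  \int[mu]_(u in `[p, r]) h u =
  \int[mu]_(u in `[p, q]) h u + \int[mu]_(u in `[q, r]) h u.
Proof.
move=> pq qr ih.
have mI (i : interval R) := leb_measurable_itv i.
have sub (i : interval R) : (i <= `[p, r])%O ->
    mu.-integrable ([set` i] : set LT) (EFin \o h).
  move=> ir; apply: (integrableS (mI `[p, r]) (mI i) _ ih).
  exact: (subitvP ir).
have q0 : \int[mu]_(u in `[q, q]) h u = 0.
  have mq : measurable_fun (`[q, q]%classic : set LT) (EFin \o h).
    apply: (measurable_int mu); apply: sub.
    by rewrite subitvE !bnd_simp/= pq qr.
  have mu0 : mu `[q, q]%classic = 0%E by rewrite leb_itv/= lte_fin ltxx.
  by rewrite /Rintegral (null_set_integral (mI _) mq mu0).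
rewrite (itvccU_oc pq qr) Rintegral_setU ?mI ?disjoint_itvcc_oc//; last first.
  by rewrite -itvccU_oc.
have qE : `[q, r]%classic = `[q, q]%classic `|` `]q, r]%classic by exact: itvccU_oc.
rewrite [in RHS]qE Rintegral_setU ?mI ?disjoint_itvcc_oc//; last first.
  by rewrite -qE; apply: sub; rewrite subitvE !bnd_simp/= pq ?lexx.
by rewrite q0 add0r.
Qed.

(** The error [(t - s) * (m t - m s)] is negligible without continuity of [m]: once [t - s < e] it
    is at most [e] times an increment of the nondecreasing [m]. *)
Lemma le_Rintegral_increment N w (F m : R -> R) (u v : R) : u <= v ->
  bdd_mfun N `[u, v] w ->
  (forall s t, u <= s -> s <= t -> t <= v -> m s <= m t) ->
  (forall s t, u <= s -> s <= t -> t <= v -> exists2 k,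
     forall x, s < x -> x <= t -> w x <= k &
     k * (t - s) <= F t - F s + (t - s) * (m t - m s)) ->
  \int[mu]_(x in `[u, v]) w x <= F v - F u.
Proof.
move=> uv bw m_nd hk.
pose I t := \int[mu]_(x in `[u, t]) w x.
have : I v - F v <= I u - F u.
  apply: (@local_to_global _ (fun t => I t - F t) m _ _ uv) => e x e0 xI.
  exists e => // s t us sx xt tv tse.
  have st := le_trans sx xt.
  have [k wk kF] := hk s t us st tv.
  have IE : I t = I s + \int[mu]_(x in `]s, t]) w x.
    exact: (Rintegral_itvcc_oc bw us st tv).
  have j : (`]s, t] <= `[u, v])%O by rewrite subitvE !bnd_simp/= us tv.
  have bj := bdd_mfun_subitv j bw.
  have mj := leb_measurable_itv `]s, t]; have fj := leb_itv_fin false false s t.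
  have Ik : \int[mu]_(x in `]s, t]) w x <= k * (t - s).
    rewrite -(fine_leb_itv false false st) -(Rintegral_cst mu mj).
    apply: (le_Rintegral mj (bdd_mfun_integrable bj)
      (bdd_mfun_integrable (bdd_mfun_cst k mj fj))).
    by move=> y; rewrite /= in_itv/= => /andP[]; exact: wk.
  have mst : 0 <= m t - m s by rewrite subr_ge0 m_nd.
  have emst : (t - s) * (m t - m s) <= e * (m t - m s).
    by rewrite ler_wpM2r// ltW.
  rewrite IE; set X := \int[mu]_(x in `]s, t]) w x in Ik *.
  have -> : I s + X - F t - (I s - F s) = X - (F t - F s) by ring.
  by rewrite lerBlDl (le_trans Ik)// (le_trans kF)// lerD2l.
have -> : I u = 0 by have [] := Rintegral_cc0 uv bw.
by rewrite lerBlDl sub0r.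
Qed.

Lemma le_integral_truncation (A : set R) w (B : R) :
  measurable (A : set LT) -> measurable_fun (A : set LT) w ->
  (forall x, A x -> 0 <= w x) ->
  (forall k : nat, (\int[mu]_(x in A) (Num.min (w x) k%:R)%:E <= B%:E)%E) ->
  (\int[mu]_(x in A) (w x)%:E <= B%:E)%E.
Proof.
move=> mA mw w0 hB.
pose g (k : nat) x := (Num.min (w x) k%:R)%:E.
have mg k : measurable_fun (A : set LT) (g k).
  apply/measurable_EFinP; apply: (measurable_minr mw).
  exact: measurable_cst.
have g0 k x : A x -> (0 <= g k x)%E.
  by move=> Ax; rewrite lee_fin le_min ler0n w0.
have ndg x : A x -> {homo g^~ x : n m / (n <= m)%N >-> (n <= m)%E}.
  move=> Ax n m nm; rewrite lee_fin le_min ge_min lexx/= ge_min.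
  by rewrite ler_nat nm orbT.
have gw x : A x -> g^~ x @ \oo --> (w x)%:E.
  move=> Ax; apply: cvg_near_cst; near=> k; rewrite /g.
  congr EFin; apply/min_l.
  by near: k; exact: nbhs_infty_ger.
have lim_cvg := @cvg_monotone_convergence _ LT R mu A mA g mg g0 ndg.
rewrite (_ : \int[mu]_(x in A) _ = \int[mu]_(x in A) limn (g^~ x))%E; last first.
  apply: eq_integral => x; rewrite inE => Ax.
  by apply/esym/cvg_lim => //; exact: gw.
apply: (cvge_le _ lim_cvg); near=> k; exact: hB.
Unshelve. all: by end_near. Qed.

End IntegrableSplit.

Section Supergradient.
Context {R : realType} (omega : R -> R).
Hypothesis conc : concave_modulus omega.

Let homega : modulus_of_continuity omega.
Proof. by case: conc. Qed.

(** The three-chord inequality, cross-multiplied: [u] is the convex combination of [w] and [v] with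
    weight [(v - u) / (v - w)] on [w]. *)
Lemma concave_slope w u v : 0 <= w -> w < u -> u < v ->
  (omega v - omega u) * (u - w) <= (omega u - omega w) * (v - u).
Proof.
move=> w0 wu uv; have wv : 0 < v - w by lra.
case: conc => _ /(_ w v ((v - u) / (v - w)) w0).
have v0 : 0 <= v by lra.
have l1 : 0 <= (v - u) / (v - w) <= 1.
  by rewrite divr_ge0 ?ler_pdivrMr ?mul1r ?andTb//; lra.
move=> /(_ v0 l1).
have -> : (v - u) / (v - w) * w + (1 - (v - u) / (v - w)) * v = u.
  by field; rewrite gt_eqF.
set l := (v - u) / (v - w) => h.
have lE : l * (v - w) = v - u by rewrite /l divfK// gt_eqF.
have : (l * omega w + (1 - l) * omega v) * (v - w) <= omega u * (v - w).
  by rewrite ler_wpM2r// ltW.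
have -> : (l * omega w + (1 - l) * omega v) * (v - w) =
  l * (v - w) * omega w + ((v - w) - l * (v - w)) * omega v by ring.
rewrite lE => {}h; move: h.
have -> : (omega v - omega u) * (u - w) =
  (v - w - (v - u)) * omega v - omega u * (u - w) by ring.
have -> : (omega u - omega w) * (v - u) =
  omega u * (v - w) - omega u * (u - w) - (v - u) * omega w by ring.
lra.
Qed.

(** At [u > 0] the supremum of the slopes to the right, that is the right derivative, is taken;
    slopes to the left bound it from above. Monotonicity follows by adding the supergradient
    inequalities at two points, nonnegativity from [omega u <= omega (u + 1)]. *)
Lemma supergradient_exists : exists p : R -> R,
  [/\ forall u v, 0 < u -> 0 <= v -> omega v <= omega u + p u * (v - u),
      forall u v, 0 < u -> u <= v -> p v <= p u &
      forall u, 0 <= p u].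
Proof.
have ex u : exists k, 0 < u -> forall v, 0 <= v -> omega v <= omega u + k * (v - u).
  have [u0|] := ltP 0 u; last by exists 0.
  pose S := [set k | exists2 v, u < v & k = (omega v - omega u) / (v - u)].
  have Sub w : 0 <= w -> w < u -> ubound S ((omega u - omega w) / (u - w)).
    move=> w0 wu _ [v uv ->].
    rewrite ler_pdivrMr ?subr_gt0// mulrAC ler_pdivlMr ?subr_gt0//.
    exact: concave_slope.
  have S0 : S !=set0 by exists ((omega (u + 1) - omega u) / (u + 1 - u)), (u + 1) => //; lra.
  exists (sup S) => _ v v0; case: (ltgtP v u) => [vu|uv|->]; last first.
  - by rewrite subrr mulr0 addr0.
  - rewrite -lerBlDl -ler_pdivrMr ?subr_gt0//; apply: ub_le_sup; last by exists v.
    by exists ((omega u - omega 0) / (u - 0)); exact: Sub.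
  - have : sup S <= (omega u - omega v) / (u - v) by apply: ge_sup => //; exact: Sub.
    rewrite ler_pdivlMr ?subr_gt0//; lra.
have [p0 hp0] := choice ex.
(* The value 0 off the positive axis makes nonnegativity hold without a condition on [u]. *)
pose p u := if 0 < u then p0 u else 0.
have pE u v : 0 < u -> 0 <= v -> omega v <= omega u + p u * (v - u).
  by move=> u0 v0; rewrite /p u0; exact: hp0.
exists p; split => //.
- move=> u v u0; rewrite le_eqVlt => /predU1P[->//|uv].
  have h1 := pE u v u0 (ltW (lt_trans u0 uv)).
  have h2 := pE v u (lt_trans u0 uv) (ltW u0).
  rewrite -(@ler_pM2r _ (v - u)) ?subr_gt0//; lra.
- move=> u; rewrite /p; case: ifP => // u0.
  have := hp0 u u0 (u + 1); rewrite addrAC subrr add0r mulr1.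
  have := modulus_le homega (ltW u0) (_ : u <= u + 1); rewrite lerDl ler01.
  move=> /(_ isT) h1 /(_ _) h2; have := h2 (ltW _); lra.
Qed.

End Supergradient.

(** * Discontinuities of a nonincreasing function *)

Section AntitoneDiscontinuities.
Context {R : realType} (p : R -> R).
Hypothesis p_le : forall u v, 0 < u -> u <= v -> p v <= p u.

Definition continuous_in_pos (u : R) := forall e, 0 < e -> exists2 d, 0 < d &
  forall v, 0 < v -> `|v - u| < d -> `|p v - p u| <= e.

(* Distinct jumps of p are separated by distinct rationals. *)
Lemma countable_discontinuities :
  countable [set u | 0 < u /\ ~ continuous_in_pos u].
Proof.
set S := [set u | _].
have jump u : exists q : rat, S u ->
    (forall w, u < w -> p w < ratr q) /\ (forall w, 0 < w -> w < u -> ratr q < p w).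
  have [[u0 nc]|nS] := pselect (S u); last by exists 0.
  have [e [e0 he]] : exists e, 0 < e /\ forall d, 0 < d ->
      exists v, [/\ 0 < v, `|v - u| < d & e < `|p v - p u|].
    apply/not_existsP => h; apply: nc => e e0.
    have := h e => /not_andP[//|/existsNP[d /not_implyP[d0 hd]]].
    exists d => // v v0 vu; rewrite leNgt; apply/negP => ev.
    by apply: hd; exists v.
  (* The jump is at least [e] on one side. If it is not on the right, some [w' > u] has
     [p w' > p u - e], so points violating continuity close to [u] must lie to its left. *)
  have [right|nright] := pselect (forall w, u < w -> p w <= p u - e).
    have [|q /andP[q1 q2]] := @rat_in_itvoo R (p u - e) (p u); first by lra.
    exists q => _; split => [w uw|w w0 wu]; first exact: le_lt_trans (right w uw) q1.
    by rewrite (lt_le_trans q2)// p_le// ltW.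
  have left w : 0 < w -> w < u -> p u + e <= p w.
    move=> w0 wu; move/existsNP : nright => [w' /not_implyP[uw' /negP]].
    rewrite -ltNge => pw'.
    have [|v [v0 vd ev]] := he (Num.min (w' - u) (u - w)).
      by rewrite lt_min !subr_gt0 uw' wu.
    move: vd; rewrite lt_min !ltr_norml => /andP[/andP[_ v1] /andP[v2 _]].
    have [uv|vu] := leP u v.
      have h1 : p v <= p u by exact: p_le.
      have h2 : p w' <= p v by apply: p_le => //; lra.
      by move: ev; rewrite ler0_norm ?subr_le0//; lra.
    have h1 : p u <= p v by apply: p_le => //; exact: ltW.
    have h2 : p v <= p w by apply: p_le => //; lra.
    by move: ev; rewrite ger0_norm ?subr_ge0//; lra.
  have [|q /andP[q1 q2]] := @rat_in_itvoo R (p u) (p u + e); first by lra.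
  exists q => _; split => [w uw|w w0 wu]; last exact: lt_le_trans q2 (left w w0 wu).
  by rewrite (le_lt_trans _ q1)// p_le// ltW.
have [q hq] := choice jump.
apply/countable_injP; exists (pickle \o q) => u v /set_mem Su /set_mem Sv /=.
move=> /(pcan_inj pickleK) quv.
wlog uv : u v Su Sv quv / u < v => [hw|].
  case: (ltgtP u v) => // uv; first exact: hw.
  by apply/esym; exact: hw.
have [h1 _] := hq u Su; have [_ h2] := hq v Sv; have [u0 _] := Su.
have := h1 ((u + v) / 2); have := h2 ((u + v) / 2); rewrite quv.
have m1 : 0 < (u + v) / 2 by lra.
have m2 : (u + v) / 2 < v by lra.
have m3 : u < (u + v) / 2 by lra.
by move=> /(_ m1 m2) h3 /(_ m3) /(lt_trans h3); rewrite ltxx.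
Qed.

End AntitoneDiscontinuities.

(** * Integrating the slope of a concave modulus *)

Section ConcaveDerivative.
Context {R : realType} (omega p : R -> R).
Hypothesis p_sup : forall u v, 0 < u -> 0 <= v ->
  omega v <= omega u + p u * (v - u).
Hypothesis p_le : forall u v, 0 < u -> u <= v -> p v <= p u.
Hypothesis p_ge0 : forall u, 0 <= p u.
Local Notation mu := (leb R).
Local Notation LT := (lebesgue_type R).

(** The supergradient inequalities at [u] and at [h + u] squeeze the difference quotient between
    [p u] and [p (h + u)]. *)
Lemma derive1_supergradient u : 0 < u -> continuous_in_pos p u ->
  derive1 omega u = p u.
Proof.
move=> u0 cu; rewrite /derive1; apply/cvg_lim => //.
apply/cvgrPdist_le => e e0; have [d d0 hd] := cu e e0.
near=> h.
have hn0 : h != 0 by near: h; exact: nbhs_dnbhs_neq.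
have hd' : `|h| < Num.min d u.
  by near: h; apply: dnbhs0_lt; rewrite lt_min d0.
move: hd'; rewrite lt_min => /andP[hltd]; rewrite ltr_norml => /andP[hgtu _].
have uh0 : 0 < h + u by lra.
have ph : `|p (h + u) - p u| <= e by apply: hd => //; rewrite addrK.
have h1 := p_sup u0 (ltW uh0); have h2 := p_sup uh0 (ltW u0).
have {}h1 : omega (h + u) - omega u <= p u * h by lra.
have {}h2 : p (h + u) * h <= omega (h + u) - omega u by lra.
rewrite /= -[_ *: _]/(h^-1 * _) distrC; set q := h^-1 * _.
have qE : omega (h + u) - omega u = q * h by rewrite /q mulrAC mulVf ?mul1r.
rewrite qE in h1 h2; apply: le_trans ph.
case: (ltgtP h 0) hn0 => // [hneg|hpos] _.
  rewrite !ler_nM2r// in h1 h2.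
  by rewrite !ger0_norm ?subr_ge0 ?(le_trans h1)// lerD2r.
rewrite !ler_pM2r// in h1 h2.
by rewrite !ler0_norm ?subr_le0 ?(le_trans h2)// lerN2 lerD2r.
Unshelve. all: by end_near. Qed.

(* omega is differentiable off the countable set where p jumps. *)
Lemma Rintegral_derive1_comp (D : R -> R) (A B : set R) :
  measurable (A : set LT) -> measurable (B : set LT) -> B `<=` A ->
  (forall s t, A s -> A t -> D s = D t -> s = t) ->
  (forall s, A s -> 0 <= D s) ->
  measurable_fun (A : set LT) (fun s => p (D s)) ->
  \int[mu]_(s in B) derive1 omega (D s) = \int[mu]_(s in B) p (D s).
Proof.
move=> mA mB BA injD D0 mpD.
(* Points with [D s = 0] are included since [p] says nothing about [omega] there. Injectivity of [D]
   keeps this preimage of a countable set countable. *)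
pose N := [set s | A s /\ (D s = 0 \/ 0 < D s /\ ~ continuous_in_pos p (D s))].
have cN : countable N.
  have c0 : countable [set u | u = 0 \/ 0 < u /\ ~ continuous_in_pos p u].
    rewrite (_ : [set _ | _] = [set 0 : R] `|`
      [set u | 0 < u /\ ~ continuous_in_pos p u]); last by [].
    rewrite -bigcup2E; apply: bigcup_countable => [|[|[|n]] _ /=].
    - exact: countableP.
    - exact: countable1.
    - exact: countable_discontinuities.
    - exact: countable0.
  move/countable_injP : c0 => [g injg].
  apply/countable_injP; exists (g \o D) => s t /set_mem [As Ds] /set_mem [At Dt] /= gst.
  by apply: injD => //; apply: injg => //; rewrite inE.
have mpB : measurable_fun (B : set LT) (EFin \o (fun s => p (D s))).
  by apply/measurable_EFinP; exact: measurable_funS mpD.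
have ae : ae_eq mu (B : set LT) (EFin \o (fun s => p (D s)))
    (EFin \o (fun s => derive1 omega (D s))).
  exists N; split.
  - exact: leb_measurable_countable.
  - exact: leb_countable0.
  - move=> s /= /not_implyP[Bs pD]; have As := BA s Bs; split => //.
    have := D0 s As; rewrite le_eqVlt => /predU1P[->|Ds]; [by left|right].
    split => // cu; apply: pD; rewrite derive1_supergradient//.
have md := ae_measurable_fun completed_lebesgue_measure_is_complete ae mpB.
apply/esym; congr fine.
exact: (@ae_eq_integral _ LT R mu B _ _ mB mpB md ae).
Qed.

Section Bounds.
Variables (w : R -> R) (u v : R).
Hypotheses (uv : u <= v) (w0 : forall x, u <= x <= v -> 0 <= w x).
Hypothesis mw : measurable_fun (`[u, v]%classic : set LT) w.

(* p may be unbounded at 0, hence the truncations of w. *)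
Let minw (k : R) x := Num.min (w x) k.

Let bdd_minw k : 0 <= k -> bdd_mfun k `[u, v] (minw k).
Proof.
move=> k0; split; [exact: leb_measurable_itv|exact: leb_itv_fin| |].
  by apply: (measurable_minr mw); exact: measurable_cst.
move=> x; rewrite /= in_itv/= => xI.
by rewrite ger0_norm ?le_min ?w0// ge_min lexx orbT.
Qed.

Let upper (F : R -> R) (B : R) : B = F v - F u ->
  (forall k : nat, exists m : R -> R,
    (forall s t, u <= s -> s <= t -> t <= v -> m s <= m t) /\
    (forall s t, u <= s -> s <= t -> t <= v -> exists2 l,
     forall x, s < x -> x <= t -> minw k%:R x <= l &
     l * (t - s) <= F t - F s + (t - s) * (m t - m s))) ->
  (\int[mu]_(x in `[u, v]) (w x)%:E <= B%:E)%E.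
Proof.
move=> -> hm; apply: (le_integral_truncation (leb_measurable_itv _) mw).
- by move=> x; rewrite /= in_itv/=; exact: w0.
- move=> k; have bk := bdd_minw (ler0n R k).
  rewrite (integral_bdd_mfun bk) lee_fin.
  have [m [m_nd hl]] := hm k.
  exact: (le_Rintegral_increment uv bk m_nd hl).
Qed.

(** On a cell the truncated slope is at most its value at the right end, while the increment of
    [omega] dominates the slope at the left end times the length. The gap is an increment of a
    monotone function times the length, as [le_Rintegral_increment] allows. *)
Lemma integral_le_left tau : v <= tau ->
  (forall x, u <= x <= v -> x < tau -> w x <= p (tau - x)) ->
  (\int[mu]_(x in `[u, v]) (w x)%:E <= (omega (tau - u) - omega (tau - v))%:E)%E.
Proof.
move=> vt wp; apply: (upper (F := fun s => - omega (tau - s))); first by ring.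
(* From [tau] on the slope is replaced by the truncation level [k]; this keeps [m] nondecreasing and
   covers the case [v = tau]. *)
move=> k; pose m s := if s < tau then Num.min (p (tau - s)) k%:R else k%:R.
have mk s : m s <= k%:R by rewrite /m; case: ifP => // _; rewrite ge_min lexx orbT.
exists m; split => s t us st tv.
  rewrite {2}/m; case: ifP => [tt|//]; rewrite /m (le_lt_trans st tt).
  rewrite le_min !ge_min lexx orbT andbT p_le//; lra.
exists (m t).
  move=> x sx xt; have wx : minw k%:R x <= k%:R by rewrite /minw ge_min lexx orbT.
  rewrite /m; case: ifP => [tt|//].
  rewrite le_min wx andbT /minw ge_min (le_trans (wp x _ _)) ?p_le//; lra.
have tsm : m s * (t - s) <= omega (tau - s) - omega (tau - t).
  have [ss|ss] := ltP s tau; last first.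
    have -> : t = s by apply: le_anti; rewrite st andbT (le_trans tv)// (le_trans vt).
    by rewrite !subrr mulr0.
  have p1 : omega (tau - t) <= omega (tau - s) + p (tau - s) * ((tau - t) - (tau - s)).
    by apply: p_sup; lra.
  have ms : m s <= p (tau - s) by rewrite /m ss ge_min lexx.
  have := ler_wpM2r (_ : 0 <= t - s) ms; rewrite subr_ge0 => /(_ st).
  lra.
lra.
Qed.

Lemma integral_le_right sigma : sigma <= u ->
  (forall x, u <= x <= v -> sigma < x -> w x <= p (x - sigma)) ->
  (\int[mu]_(x in `[u, v]) (w x)%:E <= (omega (v - sigma) - omega (u - sigma))%:E)%E.
Proof.
move=> su wp; apply: (upper (F := fun s => omega (s - sigma))); first by [].
move=> k; pose m s := if sigma < s then Num.min (p (s - sigma)) k%:R else k%:R.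
have mk s : m s <= k%:R by rewrite /m; case: ifP => // _; rewrite ge_min lexx orbT.
have m_ni s t : s <= t -> m t <= m s.
  move=> st; rewrite {2}/m; case: ifP => [ss|//]; rewrite /m (lt_le_trans ss st).
  rewrite le_min !ge_min lexx orbT andbT p_le//; lra.
exists (fun s => - m s); split => s t us st tv; first by rewrite lerN2 m_ni.
exists (m s).
  move=> x sx xt; have wx : minw k%:R x <= k%:R by rewrite /minw ge_min lexx orbT.
  rewrite /m; case: ifP => [ss|//].
  rewrite le_min wx andbT /minw ge_min (le_trans (wp x _ _)) ?p_le//; lra.
have tsm : m t * (t - s) <= omega (t - sigma) - omega (s - sigma).
  have [tt|tt] := ltP sigma t; last first.
    have -> : t = s by apply: le_anti; rewrite st andbT (le_trans tt)// (le_trans su).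
    by rewrite !subrr mulr0.
  have p1 : omega (s - sigma) <= omega (t - sigma) + p (t - sigma) * ((s - sigma) - (t - sigma)).
    by apply: p_sup; lra.
  have mt : m t <= p (t - sigma) by rewrite /m tt ge_min lexx.
  have := ler_wpM2r (_ : 0 <= t - s) mt; rewrite subr_ge0 => /(_ st).
  lra.
lra.
Qed.

(** Besides its real form, the finite bound yields the integrability that the lower estimates rely
    on. *)
Lemma Rintegral_le B : (\int[mu]_(x in `[u, v]) (w x)%:E <= B%:E)%E ->
  mu.-integrable (`[u, v]%classic : set LT) (EFin \o w) /\
  \int[mu]_(x in `[u, v]) w x <= B.
Proof.
move=> wB; have iw : mu.-integrable (`[u, v]%classic : set LT) (EFin \o w).
  apply/integrableP; split; first exact/measurable_EFinP.
  apply: le_lt_trans (ltry B); apply: le_trans wB.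
  rewrite le_eqVlt; apply/orP; left; apply/eqP; apply: eq_integral => x.
  by rewrite inE /= in_itv/= => xI; rewrite ger0_norm// w0.
split => //; rewrite -lee_fin; apply: le_trans wB.
rewrite fineK//; apply: integrable_fin_num => //.
exact: leb_measurable_itv.
Qed.

Hypothesis iw : mu.-integrable (`[u, v]%classic : set LT) (EFin \o w).

Let lower (F : R -> R) (k : R) (m : R -> R) : 0 <= k ->
  (forall s t, u <= s -> s <= t -> t <= v -> m s <= m t) ->
  (forall s t, u <= s -> s <= t -> t <= v -> exists2 l,
     forall x, s < x -> x <= t -> - minw k x <= l &
     l * (t - s) <= F t - F s + (t - s) * (m t - m s)) ->
  F u - F v <= \int[mu]_(x in `[u, v]) w x.
Proof.
move=> k0 m_nd hl; have bk := bdd_minw k0.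
have bkN : bdd_mfun k `[u, v] (fun x => - minw k x).
  case: bk => m1 f1 g1 b1; split; [exact: m1|exact: f1|exact: measurable_funN g1|].
  by move=> x xI; rewrite normrN; exact: b1.
have := le_Rintegral_increment uv bkN m_nd hl.
have -> : \int[mu]_(x in `[u, v]) - minw k x = - \int[mu]_(x in `[u, v]) minw k x.
  rewrite -mulN1r -(RintegralZl _ (leb_measurable_itv _) (bdd_mfun_integrable bk)).
  by apply: eq_Rintegral => x _; rewrite mulN1r.
have : \int[mu]_(x in `[u, v]) minw k x <= \int[mu]_(x in `[u, v]) w x.
  apply: (le_Rintegral (leb_measurable_itv _) (bdd_mfun_integrable bk) iw).
  by move=> x _; rewrite ge_min lexx.
lra.
Qed.

(** As [v < tau], the slope [p (tau - x)] is at most [p (tau - v)] on the interval; truncating [w]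
    at that level keeps it above the slope and makes it bounded. *)
Lemma Rintegral_ge_left tau : v < tau ->
  (forall x, u <= x <= v -> p (tau - x) <= w x) ->
  omega (tau - u) - omega (tau - v) <= \int[mu]_(x in `[u, v]) w x.
Proof.
move=> vt wp.
have pn s t : s <= t -> t <= v -> p (tau - s) <= p (tau - t).
  by move=> st tv; apply: p_le; lra.
apply: (lower (F := fun s => omega (tau - s)) (m := fun s => p (tau - s))
  (p_ge0 (tau - v))); first by move=> s t _; exact: pn.
move=> s t us st tv; exists (- p (tau - s)).
  move=> x sx xt; rewrite lerN2 le_min pn ?andbT; [|lra|exact: lexx].
  by rewrite (le_trans (pn s x _ _)) ?wp//; lra.
have : omega (tau - s) <= omega (tau - t) + p (tau - t) * ((tau - s) - (tau - t)).
  by apply: p_sup; lra.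
lra.
Qed.

Lemma Rintegral_ge_right sigma : sigma < u ->
  (forall x, u <= x <= v -> p (x - sigma) <= w x) ->
  omega (v - sigma) - omega (u - sigma) <= \int[mu]_(x in `[u, v]) w x.
Proof.
move=> su wp.
have pn s t : u <= s -> s <= t -> p (t - sigma) <= p (s - sigma).
  by move=> us st; apply: p_le; lra.
have -> : omega (v - sigma) - omega (u - sigma) =
  - omega (u - sigma) - (- omega (v - sigma)) by ring.
apply: (lower (F := fun s => - omega (s - sigma)) (m := fun s => - p (s - sigma))
  (p_ge0 (u - sigma))).
  by move=> s t us st _; rewrite lerN2 pn.
move=> s t us st tv; exists (- p (t - sigma)).
  move=> x sx xt; rewrite lerN2 le_min pn ?andbT; [|lra|lra].
  by rewrite (le_trans (pn x t _ _)) ?wp//; lra.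
have : omega (t - sigma) <= omega (s - sigma) + p (s - sigma) * ((t - sigma) - (s - sigma)).
  by apply: p_sup; lra.
lra.
Qed.

End Bounds.
End ConcaveDerivative.

(** * The extremal function *)

Section ExtremalFunction.
Context {R : realType} (a c b : R) (rho rho_inv omega g : R -> R).
Local Notation mu := (leb R).
Local Notation LT := (lebesgue_type R).
Hypotheses (ac : a <= c) (cb : c <= b).
Hypothesis rho_itv : forall s, a <= s <= c -> c <= rho s <= b.
Hypothesis rho_lt : forall s t, a <= s -> s < t -> t <= c -> rho t < rho s.
Hypothesis rho_c : rho c = c.
Hypothesis rhoK : forall s, a <= s <= c -> rho_inv (rho s) = s.
Hypothesis rho_invK : forall t, c <= t <= b -> rho (rho_inv t) = t.
Hypothesis rho_inv_itv : forall t, c <= t <= b -> a <= rho_inv t <= c.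
Hypothesis rho_inv_lt : forall s t, c <= s -> s < t -> t <= b ->
  rho_inv t < rho_inv s.
Hypothesis rho_cont : forall x e, a <= x <= c -> 0 < e -> exists2 d, 0 < d &
  forall y, a <= y <= c -> `|x - y| < d -> `|rho x - rho y| < e.
Hypothesis conc : concave_modulus omega.
Hypothesis g_left : forall t, t <= c ->
  g t = - \int[mu]_(s in `[t, c]) derive1 omega (rho s - s).
Hypothesis g_right : forall t, c < t ->
  g t = \int[mu]_(s in `[c, t]) derive1 omega (s - rho_inv s).

Let homega : modulus_of_continuity omega.
Proof. by case: conc. Qed.

Let rho_le s t : a <= s -> s <= t -> t <= c -> rho t <= rho s.
Proof.
by move=> as_; rewrite le_eqVlt => /predU1P[->//|st tc]; rewrite ltW// rho_lt.
Qed.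

Let rho_inv_le s t : c <= s -> s <= t -> t <= b -> rho_inv t <= rho_inv s.
Proof.
by move=> cs; rewrite le_eqVlt => /predU1P[->//|st tb]; rewrite ltW// rho_inv_lt.
Qed.

Let rho_inv_c : rho_inv c = c.
Proof. by rewrite -{1}rho_c rhoK// lexx ac. Qed.

Section WithSupergradient.
Variable p : R -> R.
Hypothesis p_sup : forall u v, 0 < u -> 0 <= v ->
  omega v <= omega u + p u * (v - u).
Hypothesis p_le : forall u v, 0 < u -> u <= v -> p v <= p u.
Hypothesis p_ge0 : forall u, 0 <= p u.

Let wl s := p (rho s - s).
Let wr t := p (t - rho_inv t).

Let Dl_gt0 s : a <= s -> s < c -> 0 < rho s - s.
Proof.
move=> as_ sc; have sI : a <= s <= c by rewrite as_ ltW.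
by have /andP[cs _] := rho_itv sI; rewrite subr_gt0 (lt_le_trans sc).
Qed.

Let Dr_gt0 t : c < t -> t <= b -> 0 < t - rho_inv t.
Proof.
move=> ct tb; have tI : c <= t <= b by rewrite tb ltW.
by have /andP[_ tc] := rho_inv_itv tI; rewrite subr_gt0 (le_lt_trans tc).
Qed.

Let measurable_wl : measurable_fun (`[a, c]%classic : set LT) wl.
Proof.
rewrite (itvcoU_cc ac (lexx c)).
apply/measurable_funU; [exact: leb_measurable_itv|exact: leb_measurable_itv|].
split; apply: leb_nondecreasing_measurable => s t.
  rewrite !in_itv/= => /andP[as_ sc] /andP[at_ tc] st.
  apply: p_le; first exact: Dl_gt0.
  by apply: lerB => //; apply: rho_le => //; exact: ltW.
by rewrite !in_itv/= -!eq_le => /eqP <- /eqP <-.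
Qed.

Let measurable_wr : measurable_fun (`[c, b]%classic : set LT) wr.
Proof.
rewrite (itvccU_oc (lexx c) cb).
apply/measurable_funU; [exact: leb_measurable_itv|exact: leb_measurable_itv|].
split; apply: leb_nonincreasing_measurable => s t.
  by rewrite !in_itv/= -!eq_le => /eqP <- /eqP <-.
rewrite !in_itv/= => /andP[cs sb] /andP[ct tb] ts.
apply: p_le; first exact: Dr_gt0.
by apply: lerB => //; apply: rho_inv_le => //; exact: ltW.
Qed.

Let sub_meas (h : R -> R) (u v u' v' : R) : u' <= u -> v <= v' ->
  measurable_fun (`[u', v']%classic : set LT) h ->
  measurable_fun (`[u, v]%classic : set LT) h.
Proof.
move=> uu vv; apply: measurable_funS; first exact: leb_measurable_itv.
by apply: subset_itv; rewrite bnd_simp.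
Qed.

Let gl t : a <= t <= c -> g t = - \int[mu]_(s in `[t, c]) wl s.
Proof.
move=> /andP[at_ tc]; rewrite g_left//; congr (- _).
apply: (Rintegral_derive1_comp p_sup p_le (D := fun s => rho s - s)
  (leb_measurable_itv `[a, c]) (leb_measurable_itv _)).
- by apply: subset_itv; rewrite bnd_simp.
- move=> s s'; rewrite /= !in_itv/= => /andP[as_ sc] /andP[as' s'c] E.
  case: (ltgtP s s') => // ss; [have := rho_lt as_ ss s'c|have := rho_lt as' ss sc].
    by lra.
  by lra.
- move=> s; rewrite /= in_itv/= => sI; have /andP[cs _] := rho_itv sI.
  by case/andP: sI => _ sc; rewrite subr_ge0 (le_trans sc).
- exact: measurable_wl.
Qed.

Let gr t : c <= t <= b -> g t = \int[mu]_(s in `[c, t]) wr s.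
Proof.
move=> /andP[ct tb].
have E : \int[mu]_(s in `[c, t]) derive1 omega (s - rho_inv s) =
    \int[mu]_(s in `[c, t]) wr s.
  apply: (Rintegral_derive1_comp p_sup p_le (D := fun s => s - rho_inv s)
    (leb_measurable_itv `[c, b]) (leb_measurable_itv _)).
  - by apply: subset_itv; rewrite bnd_simp.
  - move=> s s'; rewrite /= !in_itv/= => /andP[cs sb] /andP[cs' s'b] E.
    case: (ltgtP s s') => // ss; [have := rho_inv_lt cs ss s'b|have := rho_inv_lt cs' ss sb].
      by lra.
    by lra.
  - move=> s; rewrite /= in_itv/= => sI; have /andP[_ sc] := rho_inv_itv sI.
    by case/andP: sI => cs _; rewrite subr_ge0 (le_trans sc).
  - exact: measurable_wr.
(* At [t = c] the function [g] is given by its left branch; both branches vanish there. *)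
have [tc|{}ct'] := leP t c; last by rewrite g_right.
have {tc}-> : t = c by apply: le_anti; rewrite tc.
have point0 (h : R -> R) : measurable_fun (`[c, c]%classic : set LT) h ->
    \int[mu]_(s in `[c, c]) h s = 0.
  move=> mh; have mu0 : mu `[c, c]%classic = 0%E by rewrite leb_itv/= lte_fin ltxx.
  have mh' : measurable_fun (`[c, c]%classic : set LT) (EFin \o h).
    exact/measurable_EFinP.
  by rewrite /Rintegral (null_set_integral (leb_measurable_itv _) mh' mu0).
have mwl : measurable_fun (`[c, c]%classic : set LT) wl.
  exact: (sub_meas ac (lexx c) measurable_wl).
have mwr : measurable_fun (`[c, c]%classic : set LT) wr.
  exact: (sub_meas (lexx c) cb measurable_wr).
by rewrite gl ?ac ?lexx// (point0 _ mwl) (point0 _ mwr) oppr0.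
Qed.

(** Since [tau <= rho t2 <= rho s], the slope at [rho s - s] is at most that at [tau - s]. The
    freedom in [tau] is used: [tau = rho t2] serves the second difference estimate, and a [tau]
    inside [[a, b]] the bound of [g] by [omega]. *)
Let wl_le tau t1 t2 : a <= t1 -> t1 <= t2 -> t2 <= c -> t2 <= tau -> tau <= rho t2 ->
  (\int[mu]_(s in `[t1, t2]) (wl s)%:E <= (omega (tau - t1) - omega (tau - t2))%:E)%E.
Proof.
move=> at1 t12 t2c t2tau taur.
have mw := sub_meas at1 t2c measurable_wl.
apply: (integral_le_left p_sup p_le t12 (fun x _ => p_ge0 _) mw t2tau).
move=> x /andP[t1x xt2] xtau; apply: p_le; first by rewrite subr_gt0.
by rewrite lerD2r (le_trans taur)// rho_le// (le_trans at1).
Qed.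

Let wr_le sigma t1 t2 : c <= t1 -> t1 <= t2 -> t2 <= b ->
  rho_inv t1 <= sigma -> sigma <= t1 ->
  (\int[mu]_(s in `[t1, t2]) (wr s)%:E <= (omega (t2 - sigma) - omega (t1 - sigma))%:E)%E.
Proof.
move=> ct1 t12 t2b rs st1.
have mw := sub_meas ct1 t2b measurable_wr.
apply: (integral_le_right p_sup p_le t12 (fun x _ => p_ge0 _) mw st1).
move=> x /andP[t1x xt2] xs; apply: p_le; first by rewrite subr_gt0.
by apply: lerB => //; rewrite (le_trans _ rs)// rho_inv_le// (le_trans xt2).
Qed.

Let iwl t1 t2 : a <= t1 -> t1 <= t2 -> t2 <= c ->
  mu.-integrable (`[t1, t2]%classic : set LT) (EFin \o wl).
Proof.
move=> at1 t12 t2c.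
have mw := sub_meas at1 t2c measurable_wl.
have t2I : a <= t2 <= c by rewrite t2c (le_trans at1).
have /andP[crt2 _] := rho_itv t2I; have t2r := le_trans t2c crt2.
exact: (Rintegral_le (fun x _ => p_ge0 _) mw (wl_le at1 t12 t2c (lexx _) t2r)).1.
Qed.

Let iwr t1 t2 : c <= t1 -> t1 <= t2 -> t2 <= b ->
  mu.-integrable (`[t1, t2]%classic : set LT) (EFin \o wr).
Proof.
move=> ct1 t12 t2b.
have mw := sub_meas ct1 t2b measurable_wr.
have t1I : c <= t1 <= b by rewrite ct1 (le_trans t12).
have /andP[_ rt1c] := rho_inv_itv t1I; have rt1 := le_trans rt1c ct1.
exact: (Rintegral_le (fun x _ => p_ge0 _) mw (wr_le ct1 t12 t2b rt1 (lexx _))).1.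
Qed.

Let glE t1 t2 : a <= t1 -> t1 <= t2 -> t2 <= c ->
  g t2 - g t1 = \int[mu]_(s in `[t1, t2]) wl s.
Proof.
move=> at1 t12 t2c; rewrite !gl ?t2c ?at1 ?(le_trans at1) ?(le_trans t12)//.
rewrite (Rintegral_itvcc_cc t12 t2c (iwl at1 (le_trans t12 t2c) (lexx _))).
by ring.
Qed.

Let grE t1 t2 : c <= t1 -> t1 <= t2 -> t2 <= b ->
  g t2 - g t1 = \int[mu]_(s in `[t1, t2]) wr s.
Proof.
move=> ct1 t12 t2b; rewrite !gr ?t2b ?ct1 ?(le_trans ct1) ?(le_trans t12)//.
rewrite (Rintegral_itvcc_cc ct1 t12 (iwr (lexx _) (le_trans ct1 t12) t2b)).
by ring.
Qed.

Let gl_le tau t1 t2 : a <= t1 -> t1 <= t2 -> t2 <= c -> t2 <= tau -> tau <= rho t2 ->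
  g t2 - g t1 <= omega (tau - t1) - omega (tau - t2).
Proof.
move=> at1 t12 t2c t2tau taur; rewrite glE//.
have mw := sub_meas at1 t2c measurable_wl.
exact: (Rintegral_le (fun x _ => p_ge0 _) mw (wl_le at1 t12 t2c t2tau taur)).2.
Qed.

Let gr_le sigma t1 t2 : c <= t1 -> t1 <= t2 -> t2 <= b ->
  rho_inv t1 <= sigma -> sigma <= t1 ->
  g t2 - g t1 <= omega (t2 - sigma) - omega (t1 - sigma).
Proof.
move=> ct1 t12 t2b rs st1; rewrite grE//.
have mw := sub_meas ct1 t2b measurable_wr.
exact: (Rintegral_le (fun x _ => p_ge0 _) mw (wr_le ct1 t12 t2b rs st1)).2.
Qed.

(** Here [rho x <= rho t1] gives [rho x - x <= rho t1 - x], so the slope is bounded below with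
    [tau = rho t1]. *)
Let gl_ge t1 t2 : a <= t1 -> t1 <= t2 -> t2 < c ->
  omega (rho t1 - t1) - omega (rho t1 - t2) <= g t2 - g t1.
Proof.
move=> at1 t12 t2c; have t2c' := ltW t2c; rewrite glE//.
have mw := sub_meas at1 t2c' measurable_wl.
have t1I : a <= t1 <= c by rewrite at1 (le_trans t12).
have /andP[crt1 _] := rho_itv t1I.
apply: (Rintegral_ge_left p_sup p_le p_ge0 t12 (fun x _ => p_ge0 _) mw (iwl at1 t12 t2c')).
- exact: lt_le_trans crt1.
- move=> x /andP[t1x xt2]; apply: p_le.
    by rewrite Dl_gt0 ?(le_trans at1)// (le_lt_trans xt2).
  by rewrite lerD2r rho_le// (le_trans xt2).
Qed.

Let gr_ge t1 t2 : c < t1 -> t1 <= t2 -> t2 <= b ->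
  omega (t2 - rho_inv t2) - omega (t1 - rho_inv t2) <= g t2 - g t1.
Proof.
move=> ct1 t12 t2b; have ct1' := ltW ct1; rewrite grE//.
have mw := sub_meas ct1' t2b measurable_wr.
have t2I : c <= t2 <= b by rewrite t2b (le_trans ct1').
have /andP[_ rt2c] := rho_inv_itv t2I.
apply: (Rintegral_ge_right p_sup p_le p_ge0 t12 (fun x _ => p_ge0 _) mw (iwr ct1' t12 t2b)).
- exact: le_lt_trans ct1.
- move=> x /andP[t1x xt2]; apply: p_le.
    by rewrite Dr_gt0 ?(le_trans xt2)// (lt_le_trans ct1).
  by apply: lerB => //; rewrite rho_inv_le// (le_trans ct1').
Qed.

Let g_nd s t : a <= s -> s <= t -> t <= b -> g s <= g t.
Proof.
move=> as_ st tb.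
have leftle u v : a <= u -> u <= v -> v <= c -> g u <= g v.
  move=> au uv vc; rewrite -subr_ge0 glE//.
  by apply: Rintegral_ge0 => x _; exact: p_ge0.
have rightle u v : c <= u -> u <= v -> v <= b -> g u <= g v.
  move=> cu uv vb; rewrite -subr_ge0 grE//.
  by apply: Rintegral_ge0 => x _; exact: p_ge0.
have [tc|ct] := leP t c; first exact: leftle.
have [sc|cs] := leP s c; last by apply: rightle => //; exact: ltW.
by rewrite (le_trans (leftle s c _ _ _))// rightle// ltW.
Qed.

(* The increments of K s = g (rho s) - g s - omega (rho s - s) are bounded by a
   second difference of omega, which is small with respect to the increments of
   the monotone function p (rho s - s); the latter is finite only for s < c. *)
Let g_rho s : a <= s <= c -> g (rho s) - g s = omega (rho s - s).
Proof.
pose K s := g (rho s) - g s - omega (rho s - s).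
suff K0 s0 : a <= s0 <= c -> K s0 = 0.
  by move=> /K0; rewrite /K; lra.
move=> {s} /andP[as0 s0c].
(* A crude bound, obtained by splitting at [c]; it forces [K] to tend to 0 at [c], where constancy
   of [K] cannot be reached directly. *)
have Kc t : a <= t <= c -> `|K t| <= 3 * omega (rho t - t).
  move=> tI; have /andP[crt rtb] := rho_itv tI; have /andP[at_ tc] := tI.
  have h1 := gl_le at_ tc (lexx c) (lexx c) (_ : c <= rho c).
  rewrite rho_c lexx subrr (modulus0 homega) subr0 in h1.
  have h2 := gr_le (lexx c) crt rtb (_ : rho_inv c <= c) (lexx c).
  rewrite rho_inv_c lexx subrr (modulus0 homega) subr0 in h2.
  have h3 : omega (c - t) <= omega (rho t - t).
    by apply: (modulus_le homega); rewrite ?subr_ge0// lerD2r.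
  have h4 : omega (rho t - c) <= omega (rho t - t).
    by apply: (modulus_le homega); rewrite ?subr_ge0// lerD2l lerN2.
  have h5 : g t <= g c by apply: g_nd.
  have h6 : g c <= g (rho t) by apply: g_nd.
  have h7 : 0 <= omega (rho t - t).
    by apply: (modulus_ge0 homega); rewrite subr_ge0 (le_trans tc).
  move: {h1}(h1 isT) {h2}(h2 isT) => h1 h2.
  by rewrite ler_norml /K; apply/andP; split; lra.
have Kconst s1 : s0 <= s1 -> s1 < c -> K s1 = K s0.
  move=> s01 s1c.
  pose m s := p (rho s - s).
  have m_nd s t : s0 <= s -> s <= t -> t <= s1 -> m s <= m t.
    move=> s0s st ts1; apply: p_le.
      by apply: Dl_gt0; [rewrite (le_trans as0)// (le_trans s0s)|exact: le_lt_trans s1c].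
    apply: lerB => //; apply: rho_le => //; first exact: le_trans s0s.
    by rewrite (le_trans ts1)// ltW.
  have step s t : s0 <= s -> s <= t -> t <= s1 ->
      `|K t - K s| <= (t - s) * (m t - m s).
    move=> s0s st ts1.
    have as_ := le_trans as0 s0s.
    have tc : t < c by exact: le_lt_trans s1c.
    have at_ := le_trans as_ st; have sc := le_lt_trans st tc.
    have sI : a <= s <= c by rewrite as_ ltW.
    have tI : a <= t <= c by rewrite at_ ltW.
    have /andP[crs rsb] := rho_itv sI; have /andP[crt rtb] := rho_itv tI.
    have rst : rho t <= rho s by apply: rho_le => //; exact: ltW.
    have crt' : c < rho t by rewrite -rho_c rho_lt.
    (* Through [v1] to [v4], [|K t - K s|] is at most the second difference [omega (rho t - s) +
       omega (rho s - t) - omega (rho s - s) - omega (rho t - t)]; the supergradients at [rho t - t]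
       and [rho s - s] then give [w1] and [w2]. *)
    have v1 : g t - g s <= omega (rho t - s) - omega (rho t - t).
      apply: gl_le => //; first exact: ltW.
      by rewrite (le_trans (ltW tc)).
    have v2 : g (rho s) - g (rho t) <= omega (rho s - t) - omega (rho t - t).
      apply: gr_le => //; first by rewrite rhoK.
      by rewrite (le_trans (ltW tc)).
    have v3 := gl_ge as_ st tc.
    have v4 := gr_ge crt' rst rsb; rewrite rhoK// in v4.
    have Dt : 0 < rho t - t by exact: Dl_gt0.
    have Ds : 0 < rho s - s by exact: Dl_gt0.
    have w1 : omega (rho t - s) <= omega (rho t - t) + m t * ((rho t - s) - (rho t - t)).
      by apply: p_sup => //; lra.
    have w2 : omega (rho s - t) <= omega (rho s - s) + m s * ((rho s - t) - (rho s - s)).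
      by apply: p_sup => //; lra.
    rewrite (_ : (t - s) * (m t - m s) =
      m t * ((rho t - s) - (rho t - t)) + m s * ((rho s - t) - (rho s - s))); last by ring.
    move: v1 v2 v3 v4 w1 w2; rewrite /K.
    move: (m t * _) (m s * _) (omega _) (omega _) (omega _) (omega _) => *.
    rewrite ler_norml; apply/andP; split; lra.
  have up : K s1 <= K s0.
    apply: (@local_to_global _ K m _ _ s01) => e x e0 xI.
    exists e => // s t s0s sx xt ts1 tse.
    have st := le_trans sx xt.
    rewrite (le_trans (ler_norm _))// (le_trans (step s t s0s st ts1))//.
    by rewrite ler_wpM2r ?subr_ge0 ?m_nd// ltW.
  have lo : - K s1 <= - K s0.
    apply: (@local_to_global _ (fun s => - K s) m _ _ s01) => e x e0 xI.
    exists e => // s t s0s sx xt ts1 tse.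
    have st := le_trans sx xt.
    rewrite -opprD (le_trans (ler_norm _))// normrN (le_trans (step s t s0s st ts1))//.
    by rewrite ler_wpM2r ?subr_ge0 ?m_nd// ltW.
  by apply: le_anti; rewrite up -lerN2.
apply/eqP; rewrite -normr_eq0 eq_le normr_ge0 andbT.
apply/ler_addgt0Pr => e e0; rewrite add0r.
have e30 : 0 < e / 3 by rewrite divr_gt0.
have [eta eta0 heta] := modulus_small homega e30.
have small t : a <= t <= c -> rho t - t < eta -> `|K t| <= e.
  move=> tI Dt; rewrite (le_trans (Kc t tI))//.
  have /andP[crt _] := rho_itv tI; case/andP: tI => _ tc.
  have : omega (rho t - t) <= e / 3.
    by apply: heta => //; rewrite subr_ge0 (le_trans tc).
  by rewrite ler_pdivlMr// mulrC.
move: s0c; rewrite le_eqVlt => /predU1P[s0c|s0c].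
  by apply: small; rewrite s0c ?ac ?lexx// rho_c subrr.
have eta20 : 0 < eta / 2 by rewrite divr_gt0.
have cI : a <= c <= c by rewrite ac lexx.
have [del del0 hdel] := rho_cont cI eta20.
(* A point close to [c]: [c - t <= eta / 4], and [c - t < del] gives [rho t - c < eta / 2], so
   [rho t - t < eta]. *)
pose t := Num.max s0 (c - Num.min (del / 2) (eta / 4)).
have mpos : 0 < Num.min (del / 2) (eta / 4) by rewrite lt_min !divr_gt0.
have tc : t < c by rewrite gt_max s0c/= ltrBlDr ltrDl.
have s0t : s0 <= t by rewrite le_max lexx.
have at_ := le_trans as0 s0t.
rewrite -(Kconst t s0t tc); apply: small; first by rewrite at_ ltW.
have ct : c - t <= Num.min (del / 2) (eta / 4) by rewrite lerBlDr -lerBlDl le_max lexx orbT.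
move: ct; rewrite le_min => /andP[ct1 ct2].
have := hdel t; rewrite at_ (ltW tc) => /(_ isT).
rewrite ger0_norm ?subr_ge0 ?(ltW tc)// => /(_ (le_lt_trans ct1 _)).
have -> : del / 2 < del by lra.
by move=> /(_ isT); rewrite rho_c ltr_norml => /andP[h _]; lra.
Qed.

Lemma extremal_facts :
  [/\ forall s t, a <= s -> s <= t -> t <= b -> g s <= g t,
      forall s, a <= s <= c -> g (rho s) - g s = omega (rho s - s) &
      forall s t, a <= s <= b -> a <= t <= b -> `|g s - g t| <= omega `|s - t|].
Proof.
split=> // s t.
wlog st : s t / s <= t => [hw sI tI|/andP[as_ sb] /andP[at_ tb]].
  case/orP: (le_total s t) => ?; first exact: hw.
  by rewrite distrC (distrC s); exact: hw.
rewrite distrC ger0_norm ?subr_ge0 ?g_nd// distrC ger0_norm ?subr_ge0//.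
have om0 (x : R) : omega (x - x) = 0 by rewrite subrr (modulus0 homega).
have [tc|ct] := leP t c.
  have := gl_le as_ st tc (lexx t); rewrite om0 subr0; apply.
  have tI : a <= t <= c by rewrite at_.
  by have /andP[crt _] := rho_itv tI; rewrite (le_trans tc).
have [cs|sc] := leP c s.
  have := gr_le cs st tb _ (lexx s); rewrite om0 subr0; apply.
  have sI : c <= s <= b by rewrite cs.
  by have /andP[_ rsc] := rho_inv_itv sI; rewrite (le_trans rsc).
have sI : a <= s <= c by rewrite as_ ltW.
have tI : c <= t <= b by rewrite tb ltW.
have /andP[ars rsc] := rho_inv_itv tI; have /andP[crs rsb] := rho_itv sI.
(* For [s < c < t] the identity [g_rho] is spent on the pair inside [[s, t]]: [rho_inv t] with [t],
   or [s] with [rho s]. The increment over the remaining part is bounded with [tau = t] or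
   [sigma = s], and the [omega] terms telescope. *)
have [ss'|s's] := leP s (rho_inv t).
  have h1 := g_rho (rho_inv_itv tI); rewrite rho_invK// in h1.
  have := gl_le as_ ss' rsc (_ : rho_inv t <= t) (_ : t <= rho (rho_inv t)).
  rewrite rho_invK// lexx (le_trans rsc)// ?(ltW ct)// => /(_ isT isT) h2.
  by move: h1 h2; lra.
have rt : rho s <= t.
  rewrite -(rho_invK tI); apply: rho_le => //; exact: ltW.
have h1 := g_rho sI.
have := gr_le crs rt tb (_ : rho_inv (rho s) <= s) (_ : s <= rho s).
rewrite rhoK// lexx (le_trans (ltW sc))// => /(_ isT isT) h2.
by move: h1 h2; lra.
Qed.

End WithSupergradient.

Lemma extremal_properties :
  [/\ forall s t, a <= s -> s <= t -> t <= b -> g s <= g t,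
      forall s, a <= s <= c -> g (rho s) - g s = omega (rho s - s) &
      forall s t, a <= s <= b -> a <= t <= b -> `|g s - g t| <= omega `|s - t|].
Proof.
have [p [p_sup p_le p_ge0]] := supergradient_exists conc.
exact: (extremal_facts p_sup p_le p_ge0).
Qed.

End ExtremalFunction.

(** * Sharp estimate *)

Lemma Rintegral_affine (R : realType) (M N e alpha : R) (A : set R)
    (psi h : R -> R) : bdd_mfun M A psi -> bdd_mfun N A h ->
  \int[leb R]_(t in A) (psi t * (e * h t + alpha)) =
  e * (\int[leb R]_(t in A) (psi t * h t)) + alpha * \int[leb R]_(t in A) psi t.
Proof.
move=> bpsi bh; have [mA fA _ _] := bpsi; have bp := bdd_mfunM bpsi bh.
have be := bdd_mfunM (bdd_mfun_cst e mA fA) bp.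
have ba := bdd_mfunM (bdd_mfun_cst alpha mA fA) bpsi.
rewrite -(RintegralZl e mA (bdd_mfun_integrable bp)).
rewrite -(RintegralZl alpha mA (bdd_mfun_integrable bpsi)).
rewrite -(RintegralD mA (bdd_mfun_integrable be) (bdd_mfun_integrable ba)).
by apply: eq_Rintegral => t _; ring.
Qed.

(** The standing assumption provides a nonzero invertible convex element, which is rescaled by the
    inverse of its distance to [theta]. *)
Lemma convex_unit_exists (R : realType) (X : lspaceType R) :
  inv_elt X `&` convex_elt X <> [set theta] ->
  exists x : X, [/\ convex_elt X x, inv_elt X x & mdist x theta = 1 :> R].
Proof.
move=> hX.
have [z [[iz cz] z0]] : exists z : X, (inv_elt X z /\ convex_elt X z) /\ z <> theta.
  apply/not_existsP => h; apply: hX; apply/seteqP; split => [z [iz cz]|_ ->].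
    by apply: contrapT => z0; apply: (h z).
  split; last exact: convex_theta.
  by exists theta; rewrite ladd0.
pose k : R := (mdist z theta)^-1.
have dz : 0 < mdist z theta :> R by rewrite mdist_gt0; exact/eqP.
exists (lscale k z); split.
- exact: convex_lscale.
- case: iz => z' zz'; exists (lscale k z').
  by rewrite -lscaleDr zz' lscale_theta.
- by rewrite mdist_lscale_theta gtr0_norm ?invr_gt0// /k mulVf// gt_eqF.
Qed.

Section Main.
Context {R : realType} (a a' b' b : R) (psi1 psi2 omega : R -> R).
Local Notation mu := (leb R).
Hypotheses (haa' : a < a') (ha'b' : a' <= b') (hb'b : b' < b).
Hypotheses (hpsi1 : weight `[a, a'] psi1) (hpsi2 : weight `[b', b] psi2).
Hypothesis hpsi : (\int[mu]_(t in `[a, a']) (psi1 t)%:E =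
                   \int[mu]_(t in `[b', b]) (psi2 t)%:E)%E.
Hypothesis homega : modulus_of_continuity omega.
Local Notation r := (rho a a' b' b psi1 psi2).
Local Notation r_inv := (rho_inv a a' b' b psi1 psi2).
Local Notation g := (extremal a a' b' b psi1 psi2 omega).
Local Notation c := ((a' + b') / 2).
Local Notation bound :=
  (\int[mu]_(s in `[a, a']) (psi1 s * omega (r s - s))).

Let a'c : a' <= c. Proof. by move: ha'b' => ?; lra. Qed.
Let cb' : c <= b'. Proof. by move: ha'b' => ?; lra. Qed.
Let ac : a <= c. Proof. exact: le_trans (ltW haa') a'c. Qed.
Let cb : c <= b. Proof. exact: le_trans cb' (ltW hb'b). Qed.

Let ra : r a = b. Proof. exact: rho_a. Qed.
Let ra' : r a' = b'.
Proof. by rewrite (rho_mid haa' hb'b hpsi1 hpsi2 hpsi)// addrC addKr. Qed.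
Let rc : r c = c. Proof. exact: rho_c. Qed.
Let r_le s t : a <= s -> s <= t -> t <= a' -> r t <= r s.
Proof.
move=> as_ st ta; apply: (rho_le haa' ha'b' hb'b hpsi1 hpsi2 hpsi as_ st).
exact: le_trans ta a'c.
Qed.
Let r_cont x e : a <= x <= a' -> 0 < e -> exists2 d, 0 < d &
  forall y, a <= y <= a' -> `|x - y| < d -> `|r x - r y| < e.
Proof.
move=> /andP[ax xa] e0.
have [|d d0 hd] := rho_continuous haa' ha'b' hb'b hpsi1 hpsi2 hpsi (x := x) _ e0.
  by rewrite ax (le_trans xa).
exists d => // y /andP[ay ya]; apply: hd.
by rewrite ay (le_trans ya).
Qed.
Let r_mass := rho_mass haa' hb'b hpsi1 hpsi2 hpsi.

Let bound_bdd M : bdd_mfun M `[a, a'] psi1 ->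
  bdd_mfun (M * omega (b - a)) `[a, a'] (fun s => psi1 s * omega (r s - s)).
Proof.
move=> b1; apply: bdd_mfunM b1 _.
exact: (bdd_mfun_modulus_rho ha'b' ra ra' r_le homega).
Qed.

Lemma bound_EFin :
  (\int[mu]_(s in `[a, a']) (psi1 s * omega (r s - s))%:E = bound%:E)%E.
Proof.
have [M M0 [b1 _]] := weight_bounded hpsi1 hpsi2.
exact: integral_bdd_mfun (bound_bdd b1).
Qed.

Lemma deviation_le_bound (X : lspaceType R) (P : X -> X) (f : R -> X) :
  convexifying P -> Hclass omega a b f ->
  deviation a a' b' b psi1 psi2 P f <= bound.
Proof.
move=> hP hf; have [M M0 [b1 b2]] := weight_bounded hpsi1 hpsi2.
have [_ _ p1] := hpsi1; have [_ _ p2] := hpsi2.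
exact: (deviation_bound (ltW haa') ha'b' (ltW hb'b) b1 b2 ra ra' r_le r_cont
  r_mass hP homega hf p1 p2).
Qed.

(** Change of variables for [phi t = omega (t - r_inv t)], which is nondecreasing because [r_inv]
    decreases. *)
Lemma bound_rho_inv :
  (bound%:E = \int[mu]_(t in `[b', b]) (psi2 t * omega (t - r_inv t))%:E)%E.
Proof.
have [M M0 [b1 b2]] := weight_bounded hpsi1 hpsi2.
pose phi t := omega (t - r_inv t).
have cI t : t \in `[b', b] -> c <= t <= b.
  by rewrite in_itv/= => /andP[bt ->]; rewrite (le_trans cb').
have D0 t : c <= t <= b -> 0 <= t - r_inv t.
  move=> tI; have /andP[_ h] := rho_inv_itv haa' ha'b' hb'b hpsi1 hpsi2 hpsi tI.
  by case/andP: tI => ct _; rewrite subr_ge0 (le_trans h).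
have phi_nd : {in `[b', b] &, {homo phi : s t / s <= t}}.
  move=> s t /cI sI /cI tI st; apply: (modulus_le homega); first exact: D0.
  apply: lerB => //; move: st; rewrite le_eqVlt => /predU1P[->//|st].
  case/andP: sI => cs _; case/andP: tI => _ tb.
  exact: ltW (rho_inv_lt haa' ha'b' hb'b hpsi1 hpsi2 hpsi cs st tb).
have phi_cont : {within `[b', b], continuous phi}.
  apply/within_continuous_itvP => x xI e e0.
  have e20 : 0 < e / 2 by rewrite divr_gt0.
  have [eta eta0 heta] := modulus_small homega e20.
  have eta20 : 0 < eta / 2 by rewrite divr_gt0.
  have /within_continuous_itvP rc_cont :=
    rho_inv_continuous haa' ha'b' hb'b hpsi1 hpsi2 hpsi.
  have [|d d0 hd] := rc_cont x _ _ eta20; first by rewrite in_itv/=; exact: cI.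
  exists (Num.min d (eta / 2)); first by rewrite lt_min d0.
  move=> y yI; rewrite lt_min => /andP[xyd xye].
  have ryx : `|r_inv x - r_inv y| < eta / 2.
    by apply: hd => //; rewrite in_itv/=; exact: cI.
  rewrite (le_lt_trans (modulus_sub homega (D0 _ (cI _ xI)) (D0 _ (cI _ yI))))//.
  rewrite (@le_lt_trans _ _ (e / 2)) ?ltr_pdivrMr ?ltr_pMr ?ltr1n//.
  apply: heta => //.
  have -> : x - r_inv x - (y - r_inv y) = (x - y) - (r_inv x - r_inv y) by ring.
  by rewrite (le_lt_trans (ler_normB _ _))// [ltRHS]splitr ltrD.
have bphi := nondecreasing_bdd_mfun (ltW hb'b) phi_nd.
rewrite (integral_bdd_mfun (bdd_mfunM b2 bphi)); congr EFin.
rewrite (change_of_variables (ltW haa') (ltW hb'b) b1 b2 ra ra' r_le r_cont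
  r_mass phi_nd phi_cont).
apply: eq_Rintegral => s; rewrite inE/= in_itv/= => /andP[as_ sa].
by rewrite /phi (rhoK haa' ha'b' hb'b hpsi1 hpsi2 hpsi)// as_ (le_trans sa).
Qed.

Lemma extremal_deviation (X : lspaceType R) (P : X -> X) (e alpha : R) (y x : X) :
  convexifying P -> concave_modulus omega -> isotropic X ->
  e = 1 \/ e = -1 ->
  convex_elt X x -> inv_elt X x -> mdist x theta = 1 :> R ->
  let f := fun t => ladd (lift_at (fun u => e * g u + alpha) x t) y in
  Hclass omega a b f /\ deviation a a' b' b psi1 psi2 P f = bound.
Proof.
move=> hP conc iX he cx ix x1 f.
have [M M0 [b1 b2]] := weight_bounded hpsi1 hpsi2.
have [_ _ p1] := hpsi1; have [_ _ p2] := hpsi2.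
have g_left t : t <= c -> g t = - \int[mu]_(s in `[t, c]) derive1 omega (r s - s).
  by move=> tc; rewrite /extremal tc.
have g_right t : c < t -> g t = \int[mu]_(s in `[c, t]) derive1 omega (s - r_inv s).
  by move=> ct; rewrite /extremal leNgt ct.
have [g_nd g_rho g_om] := extremal_properties ac cb
  (rho_itv haa' ha'b' hb'b hpsi1 hpsi2 hpsi)
  (rho_lt haa' ha'b' hb'b hpsi1 hpsi2 hpsi) rc
  (rhoK haa' ha'b' hb'b hpsi1 hpsi2 hpsi)
  (rho_invK haa' ha'b' hb'b hpsi1 hpsi2 hpsi)
  (rho_inv_itv haa' ha'b' hb'b hpsi1 hpsi2 hpsi)
  (rho_inv_lt haa' ha'b' hb'b hpsi1 hpsi2 hpsi)
  (rho_continuous haa' ha'b' hb'b hpsi1 hpsi2 hpsi) conc g_left g_right.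
pose u t := e * g t + alpha.
have e1 : `|e| = 1 by case: he => ->; rewrite ?normrN normr1.
have hu s t : a <= s <= b -> a <= t <= b -> `|u s - u t| <= omega `|s - t|.
  move=> sI tI; have -> : u s - u t = e * (g s - g t) by rewrite /u; ring.
  by rewrite normrM e1 mul1r g_om.
have hf : Hclass omega a b f by exact: (Hclass_lift cx ix iX x1 y hu).
split => //.
have a'b : a' <= b by rewrite (le_trans ha'b')// ltW.
have ab' : a <= b' by rewrite (le_trans (ltW haa')).
have nd1 : {in `[a, a'] &, {homo g : s t / s <= t}}.
  move=> s t; rewrite !in_itv/= => /andP[as_ _] /andP[_ ta'] st.
  by apply: g_nd => //; exact: le_trans a'b.
have nd2 : {in `[b', b] &, {homo g : s t / s <= t}}.
  move=> s t; rewrite !in_itv/= => /andP[bs _] /andP[_ tb] st.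
  by apply: g_nd => //; exact: le_trans bs.
have bg1 := nondecreasing_bdd_mfun (ltW haa') nd1.
have bg2 := nondecreasing_bdd_mfun (ltW hb'b) nd2.
have g_cont : {within `[b', b], continuous g}.
  apply: (modulus_within_continuous homega) => s t.
  rewrite !in_itv/= => /andP[bs sb] /andP[bt tb].
  by apply: g_om; rewrite ?sb ?tb ?andbT; exact: le_trans ab' _.
have bu (i : interval R) N : bdd_mfun N [set` i] g ->
    bdd_mfun (`|e| * N + `|alpha|) [set` i] u.
  move=> bg; have [mi fi _ _] := bg.
  exact: (bdd_mfunD (bdd_mfunM (bdd_mfun_cst e mi fi) bg) (bdd_mfun_cst alpha mi fi)).
have I1 := lift_integral cx ix iX x1 y hP homega hu (lexx a) (ltW haa') a'b
  b1 (bu _ _ bg1) p1.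
have I2 := lift_integral cx ix iX x1 y hP homega hu ab' (ltW hb'b) (lexx b)
  b2 (bu _ _ bg2) p2.
have mE : \int[mu]_(t in `[a, a']) psi1 t = \int[mu]_(t in `[b', b]) psi2 t.
  by rewrite /Rintegral hpsi.
have dE : deviation a a' b' b psi1 psi2 P f =
    `|\int[mu]_(t in `[a, a']) (psi1 t * u t) - \int[mu]_(t in `[b', b]) (psi2 t * u t)|.
  (* The terms in [P y] have equal coefficients, the two masses, and isotropy cancels them. *)
  by rewrite /deviation [X in mdist X _]I1 [X in mdist _ X]I2 mE iX mdist_lift.
(* Moving [g] to [[a, a']] turns it into [g (r s) = g s + omega (r s - s)], whose second summand
   integrates to the bound. *)
have gE : \int[mu]_(t in `[b', b]) (psi2 t * g t) =
    \int[mu]_(s in `[a, a']) (psi1 s * g s) + bound.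
  rewrite (change_of_variables (ltW haa') (ltW hb'b) b1 b2 ra ra' r_le r_cont
    r_mass nd2 g_cont).
  have i1 := bdd_mfun_integrable (bdd_mfunM b1 bg1).
  have i2 := bdd_mfun_integrable (bound_bdd b1).
  rewrite -(RintegralD (leb_measurable_itv _) i1 i2).
  apply: eq_Rintegral => s; rewrite inE/= in_itv/= => /andP[as_ sa].
  by rewrite -g_rho ?as_ ?(le_trans sa)//; ring.
(* No sign analysis of the integrand is made: the bound dominates a distance. *)
have bound0 : 0 <= bound.
  by rewrite (le_trans _ (deviation_le_bound hP hf))// mdist_ge0.
rewrite dE (Rintegral_affine e alpha b1 bg1) (Rintegral_affine e alpha b2 bg2) gE mE.
rewrite (_ : _ - _ = - (e * bound)); last by ring.
by rewrite normrN normrM e1 mul1r ger0_norm.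
Qed.

End Main.

Theorem lemma8 (R : realType) (X : lspaceType R) (P : X -> X)
    (hX : inv_elt X `&` convex_elt X <> [set theta])
    (hP : convexifying P)
    (a a' b' b : R) (haa' : a < a') (ha'b' : a' <= b') (hb'b : b' < b)
    (psi1 psi2 : R -> R)
    (hpsi1 : weight `[a, a'] psi1) (hpsi2 : weight `[b', b] psi2)
    (hpsi : (\int[leb R]_(t in `[a, a']) (psi1 t)%:E =
             \int[leb R]_(t in `[b', b]) (psi2 t)%:E)%E)
    (omega : R -> R) (homega : modulus_of_continuity omega) :
  let r := rho a a' b' b psi1 psi2 in
  let r_inv := rho_inv a a' b' b psi1 psi2 in
  let g := extremal a a' b' b psi1 psi2 omega in
  let S := sup_deviation a a' b' b psi1 psi2 P omega in
  [/\ (S <= \int[leb R]_(s in `[a, a']) (psi1 s * omega (r s - s))%:E)%E,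
      (\int[leb R]_(s in `[a, a']) (psi1 s * omega (r s - s))%:E =
       \int[leb R]_(t in `[b', b]) (psi2 t * omega (t - r_inv t))%:E)%E &
      concave_modulus omega -> isotropic X ->
        (S = \int[leb R]_(s in `[a, a']) (psi1 s * omega (r s - s))%:E)%E /\
        forall (e alpha : R) (y x : X),
          e = 1 \/ e = -1 ->
          convex_elt X x -> inv_elt X x -> mdist x theta = 1 ->
          let f := fun t => ladd (lift_at (fun u => e * g u + alpha) x t) y in
          Hclass omega a b f /\
          (deviation a a' b' b psi1 psi2 P f)%:E = S].
Proof.
move=> r r_inv g S.
have BE := bound_EFin haa' ha'b' hb'b hpsi1 hpsi2 hpsi homega.
have Sle : (S <= \int[leb R]_(s in `[a, a']) (psi1 s * omega (r s - s))%:E)%E.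
  rewrite BE; apply: ge_ereal_sup => _ [f hf <-]; rewrite lee_fin.
  exact: deviation_le_bound.
split=> //; first by rewrite BE; exact: bound_rho_inv.
move=> conc iX.
have attained (e alpha : R) (y x : X) : e = 1 \/ e = -1 ->
    convex_elt X x -> inv_elt X x -> mdist x theta = 1 :> R ->
    let f := fun t => ladd (lift_at (fun u => e * g u + alpha) x t) y in
    Hclass omega a b f /\ (deviation a a' b' b psi1 psi2 P f)%:E =
      (\int[leb R]_(s in `[a, a']) (psi1 s * omega (r s - s))%:E)%E.
  move=> he cx ix x1 f; rewrite BE.
  have [hf ->] := extremal_deviation haa' ha'b' hb'b hpsi1 hpsi2 hpsi homega
    alpha y hP conc iX he cx ix x1.
  by [].
have SE : S = (\int[leb R]_(s in `[a, a']) (psi1 s * omega (r s - s))%:E)%E.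
  apply/eqP; rewrite eq_le Sle/=.
  (* The standing assumption on [X] supplies a direction in which the bound is attained, whence the
     reverse inequality for the supremum. *)
  have [x [cx ix x1]] := convex_unit_exists hX.
  have [hf <-] := attained 1 0 theta x (or_introl erefl) cx ix x1.
  by apply: ereal_sup_ubound; eexists; first exact: hf.
by split => // e alpha y x he cx ix x1 f; rewrite SE; exact: attained.
Qed.
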